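(* For any $K\in L^2(0,2\pi)$, the root vectors of $P_{1,K}$ and of $P_{1,K}^*$ form Riesz bases of $L^2(0,2\pi)$.
   Context: For $K\in L^2(0,2\pi)$ (complex-valued), the operator $P_{1,K}$ in $L^2(0,2\pi)$ is defined by $$\mathrm{dom}(P_{1,K})=\{f\in H^1(0,2\pi)\mid f(0)=f(2\pi)\},\qquad (P_{1,K}f)(x)=if'(x)+f(2\pi)K(x).$$ Its adjoint $P_{1,K}^*$ is given by $P_{1,K}^*f=if'$ on $\{f\in H^1(0,2\pi)\mid f(2\pi)=f(0)+\langle iK,f\rangle\}$, where $\langle f,g\rangle=\int_0^{2\pi}\overline{f(t)}g(t)\,dt$. For an eigenvalue $\lambda$ of an operator $A$, the root space is $\mathcal{R}(\lambda,A)=\{f\mid\exists j\in\mathbb{N}\text{ such that }(A-\lambda)^jf=0\}$; its elements are called root vectors. The family of root vectors of $A$ refers to a system made up of bases of all the root spaces of $A$. A system $\{f_n\}_{n\in\mathbb{Z}}$ in a Hilbert space $\mathcal{H}$ is a Riesz basis if there exist a bounded and boundedly invertible operator $S:\mathcal{H}\to\mathcal{H}$ and an orthonormal basis $\{\psi_n\}_{n\in\mathbb{Z}}$ of $\mathcal{H}$ such that $f_n=S\psi_n$ for each $n\in\mathbb{Z}$. *)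

(* Defs.v *)
From HB Require Import structures.
From mathcomp Require Import all_boot all_order all_algebra.
From mathcomp Require Import generic_quotient ring_quotient.
From mathcomp.real_closed Require Import complex.
From mathcomp Require Import all_classical all_reals all_analysis.
Set Implicit Arguments.
Unset Strict Implicit.
Unset Printing Implicit Defensive.
Import Order.TTheory GRing.Theory Num.Theory.
Import numFieldNormedType.Exports.
Local Open Scope classical_set_scope.
Local Open Scope ring_scope.
Local Open Scope quotient_scope.

Definition cintegral d (T : measurableType d) (R : realType)
    (mu : {measure set T -> \bar R}) (D : set T) (f : T -> R[i]) : R[i] :=
  Complex (\int[mu]_(x in D) complex.Re (f x))
          (\int[mu]_(x in D) complex.Im (f x)).

Section ComplexL2.
Context d (T : measurableType d) (R : realType).
Variable mu : {measure set T -> \bar R}.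
Local Notation C := R[i].
Local Notation Lfun2 := (Lfun mu 2%:E).

Definition sqint : {pred T -> C} :=
  [pred f | ((@complex.Re R \o f) \in Lfun2) && ((@complex.Im R \o f) \in Lfun2)].

Lemma sqint_submod_closed : submod_closed sqint.
Proof.
have [L0 LS] := @Lfun_submod_closed _ T R mu 2%:E (lee1n 2).
split; first by rewrite inE/= ; apply/andP; split; exact: L0.
move=> a f g /andP[rf imf] /andP[rg ig]; rewrite inE; apply/andP; split.
  have -> : @complex.Re R \o (a *: f + g) =
      complex.Re a *: (@complex.Re R \o f) +
      ((- complex.Im a) *: (@complex.Im R \o f) + (@complex.Re R \o g)).
    apply/funext => x /=; rewrite !fctE /= .
    case: a (f x) (g x) => [a1 a2] [f1 f2] [g1 g2] /=.
    by rewrite /GRing.scale /= mulNr addrA.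
  by apply: (LS) => //; exact: LS.
have -> : @complex.Im R \o (a *: f + g) =
    complex.Re a *: (@complex.Im R \o f) +
    (complex.Im a *: (@complex.Re R \o f) + (@complex.Im R \o g)).
  apply/funext => x /=; rewrite !fctE /= .
  case: a (f x) (g x) => [a1 a2] [f1 f2] [g1 g2] /=.
  by rewrite /GRing.scale /= addrA.
by apply: (LS) => //; exact: LS.
Qed.

HB.instance Definition _ :=
  GRing.isSubmodClosed.Build C (T -> C) sqint sqint_submod_closed.

Record L2fun := MkL2fun { l2fun :> T -> C ; l2funP : l2fun \in sqint }.
HB.instance Definition _ := [isSub for l2fun].
HB.instance Definition _ := [Choice of L2fun by <:].
HB.instance Definition _ := [SubChoice_isSubLmodule of L2fun by <:].

Definition ae0 : {pred L2fun} :=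
  [pred f : L2fun | `[< {ae mu, forall x, f x = 0} >]].

Lemma ae0P (f : L2fun) : reflect {ae mu, forall x, f x = 0} (f \in ae0).
Proof. exact: asboolP. Qed.

Lemma ae0_zmod_closed : zmod_closed ae0.
Proof.
split; first by apply/ae0P; exact: aeW.
move=> f g /ae0P f0 /ae0P g0; apply/ae0P.
by apply: filterS2 f0 g0 => x fx gx; rewrite /= !fctE /= fx gx subr0.
Qed.

HB.instance Definition _ := GRing.isZmodClosed.Build L2fun ae0 ae0_zmod_closed.

(* L^2(mu; C): square integrable functions modulo equality mu-a.e. *)
Definition L2 := Quotient.quot ae0.
HB.instance Definition _ := GRing.Zmodule.on L2.
HB.instance Definition _ := EqQuotient.on L2.

Lemma piL2E (f g : L2fun) :
  (\pi_L2 f = \pi_L2 g) <-> {ae mu, forall x, f x = g x}.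
Proof.
split.
  move/eqP; rewrite -(Quotient.idealrBE ae0) => /ae0P.
  by apply: filterS => x; rewrite /= !fctE => /eqP; rewrite subr_eq0 => /eqP.
move=> fg; apply/eqP; rewrite -(Quotient.idealrBE ae0); apply/ae0P.
by apply: filterS fg => x; rewrite /= !fctE => ->; rewrite subrr.
Qed.

Definition L2_to_fun (f : L2) : T -> C := repr f.
Coercion L2_to_fun : L2 >-> Funclass.

Lemma reprL2 (f : L2fun) : {ae mu, forall x, (\pi_L2 f : L2) x = f x}.
Proof. by apply/piL2E; rewrite reprK. Qed.

Definition scaleL2 (a : C) (f : L2) : L2 := \pi_L2 (a *: repr f).

Lemma pi_scaleL2 a (f : L2fun) : scaleL2 a (\pi_L2 f) = \pi_L2 (a *: f).
Proof.
apply/piL2E; apply: filterS (reprL2 f) => x /= fx.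
by rewrite !fctE /= -fx.
Qed.

Lemma piL2D (f g : L2fun) : \pi_L2 (f + g) = \pi_L2 f + \pi_L2 g.
Proof. exact: (@pi_addr _ _ _ _ _ (Quotient.quot ae0)). Qed.

Lemma scaleL2A a b v : scaleL2 a (scaleL2 b v) = scaleL2 (a * b) v.
Proof. by rewrite -[v]reprK [scaleL2 b _]pi_scaleL2 !pi_scaleL2 scalerA. Qed.
Lemma scale1L2 : left_id 1 scaleL2.
Proof. by move=> v; rewrite -[v]reprK !pi_scaleL2 scale1r. Qed.
Lemma scaleL2Dr : right_distributive scaleL2 +%R.
Proof.
by move=> a v w; rewrite -[v]reprK -[w]reprK -piL2D !pi_scaleL2 scalerDr piL2D.
Qed.
Lemma scaleL2Dl v : {morph scaleL2^~ v : a b / a + b}.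
Proof. by move=> a b; rewrite -[v]reprK !pi_scaleL2 scalerDl piL2D. Qed.

HB.instance Definition _ := GRing.Zmodule_isLmodule.Build C L2
  scaleL2A scale1L2 scaleL2Dr scaleL2Dl.

Lemma L2D (f g : L2) : {ae mu, forall x, (f + g : L2) x = f x + g x}.
Proof.
suff -> : f + g = \pi_L2 (repr f + repr g) by exact: reprL2.
by rewrite piL2D !reprK.
Qed.

Lemma L2Z a (f : L2) : {ae mu, forall x, (a *: f : L2) x = a * f x}.
Proof. by exact: reprL2. Qed.

Definition cintegrable (f : T -> C) :=
  mu.-integrable setT (EFin \o (@complex.Re R \o f)) /\
  mu.-integrable setT (EFin \o (@complex.Im R \o f)).

Lemma cintegralP a (f g : T -> C) : cintegrable f -> cintegrable g ->
  cintegral mu setT (fun x => a * f x + g x) =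
  a * cintegral mu setT f + cintegral mu setT g.
Proof.
move=> [rf jf] [rg jg]; rewrite /cintegral.
have Z r (h : T -> R) : mu.-integrable setT (EFin \o h) ->
    mu.-integrable setT (EFin \o (fun x => r * h x)).
  by move=> ih; have := integrableZl measurableT r ih.
have D (h k : T -> R) : mu.-integrable setT (EFin \o h) ->
    mu.-integrable setT (EFin \o k) ->
    mu.-integrable setT (EFin \o (fun x => h x + k x)).
  by move=> ih ik; have := integrableD measurableT ih ik.
have -> : \int[mu]_x complex.Re (a * f x + g x) =
    complex.Re a * \int[mu]_x complex.Re (f x) +
    (- complex.Im a * \int[mu]_x complex.Im (f x) + \int[mu]_x complex.Re (g x)).
  rewrite -!RintegralZl// -!RintegralD//;
    try by do ?[exact: Z|apply: D].
  apply: eq_Rintegral => x _.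
  by case: a (f x) (g x) => [a1 a2] [f1 f2] [g1 g2] /=; rewrite mulNr addrA.
have -> : \int[mu]_x complex.Im (a * f x + g x) =
    complex.Re a * \int[mu]_x complex.Im (f x) +
    (complex.Im a * \int[mu]_x complex.Re (f x) + \int[mu]_x complex.Im (g x)).
  rewrite -!RintegralZl// -!RintegralD//;
    try by do ?[exact: Z|apply: D].
  apply: eq_Rintegral => x _.
  by case: a (f x) (g x) => [a1 a2] [f1 f2] [g1 g2] /=; rewrite addrA.
case: a => a1 a2 /=; apply/eqP; rewrite eq_complex /=; apply/andP; split.
  by rewrite mulNr addrA.
by rewrite addrA.
Qed.

Lemma ae_eq_cintegral (f g : T -> C) : cintegrable f -> cintegrable g ->
  {ae mu, forall x, f x = g x} -> cintegral mu setT f = cintegral mu setT g.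
Proof.
move=> [rf jf] [rg jg] fg; rewrite /cintegral /Rintegral.
congr (Complex (fine _) (fine _)); apply: ae_eq_integral => //.
- exact: measurable_int rf.
- exact: measurable_int rg.
- by apply: filterS fg => x + _ /= => ->.
- exact: measurable_int jf.
- exact: measurable_int jg.
- by apply: filterS fg => x + _ /= => ->.
Qed.

Lemma cintegrable_dot (f g : T -> C) : f \in sqint -> g \in sqint ->
  cintegrable (fun x => f x * (g x)^*).
Proof.
have M (h k : T -> R) : h \in Lfun2 -> k \in Lfun2 ->
    mu.-integrable setT (EFin \o (fun x => h x * k x)).
  by move=> hL kL; apply/Lfun1_integrable; exact: Lfun2_mul_Lfun1.
move=> /andP[rf jf] /andP[rg jg]; split.
- apply: eq_integrable
    (integrableD measurableT (M _ _ rf rg) (M _ _ jf jg)) => // x _ /=.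
  rewrite -EFinD; congr EFin.
  by case: (f x) (g x) => [f1 f2] [g1 g2] /=; rewrite mulrN opprK.
- apply: eq_integrable
    (integrableB measurableT (M _ _ jf rg) (M _ _ rf jg)) => // x _ /=.
  rewrite -EFinB; congr EFin.
  by case: (f x) (g x) => [f1 f2] [g1 g2] /=; rewrite mulrN addrC.
Qed.

(* Linear in the first argument, as MathComp's [{dot _ for _}] requires; the
   inner product <f, g> that is conjugate-linear in f is [L2dot g f]. *)
Definition L2dot (f g : L2) : C :=
  cintegral mu setT (fun x => f x * (g x)^*).

Lemma L2_sqint (f : L2) : (f : T -> C) \in sqint.
Proof. exact: l2funP. Qed.

Lemma L2dotPl h : GRing.linear_for *%R (L2dot ^~ h).
Proof.
move=> a f g; rewrite /L2dot -cintegralP; last 2 first.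
- by apply: cintegrable_dot; exact: L2_sqint.
- by apply: cintegrable_dot; exact: L2_sqint.
apply: ae_eq_cintegral.
- by apply: cintegrable_dot; exact: L2_sqint.
- pose u : L2fun := a *: (repr f) + (repr g).
  have := cintegrable_dot (l2funP u) (L2_sqint h).
  congr cintegrable; apply/funext => x.
  by rewrite /u /= !fctE /= mulrDl mulrA.
apply: filterS2 (L2D (a *: f) g) (L2Z a f) => x /= -> ->.
by rewrite mulrDl mulrA.
Qed.

Lemma L2dot_herm f g : L2dot f g = (-1) ^+ false * (L2dot g f)^*.
Proof.
rewrite expr0 mul1r /L2dot /cintegral.
have [_ jfg] := cintegrable_dot (L2_sqint g) (L2_sqint f).
apply/eqP; rewrite eq_complex /=; apply/andP; split; apply/eqP.
  apply: eq_Rintegral => x _.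
  by case: (f x) (g x) => [f1 f2] [g1 g2] /=; rewrite mulrC [f2 * _]mulrC ?mulrN ?mulNr mulrC.
rewrite -mulN1r -RintegralZl//; apply: eq_Rintegral => x _.
case: (f x) (g x) => [f1 f2] [g1 g2] /=.
by rewrite mulN1r opprD !mulrN opprK addrC [f2 * _]mulrC [f1 * _]mulrC addrC.
Qed.

Lemma L2dotPr (f : L2) : GRing.linear_for (@Num.conj C \; *%R) (L2dot f).
Proof.
move=> a g h /=; rewrite ![L2dot f _]L2dot_herm !expr0 !mul1r.
by rewrite L2dotPl rmorphD rmorphM.
Qed.

Lemma L2dot_gt0 (f : L2) : f != 0 -> 0 < L2dot f f.
Proof.
pose h x : R := complex.Re (f x) ^+ 2 + complex.Im (f x) ^+ 2.
have [ir _] := cintegrable_dot (L2_sqint f) (L2_sqint f).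
have E : L2dot f f = Complex (\int[mu]_x h x) 0.
  apply/eqP; rewrite eq_complex /=; apply/andP; split; apply/eqP.
    apply: eq_Rintegral => x _; rewrite /h.
    by case: (f x) => [f1 f2] /=; rewrite mulrN opprK.
  transitivity (\int[mu]_x (0 : R)); last by rewrite Rintegral_cst// mul0r.
  apply: eq_Rintegral => x _; case: (f x) => [f1 f2] /=.
  by rewrite mulrN [f1 * _]mulrC addNr.
have h0 x : 0 <= h x by rewrite addr_ge0 ?sqr_ge0.
have ih : mu.-integrable setT (EFin \o h).
  apply: eq_integrable ir => // x _ /=; rewrite /h.
  by case: (f x) => [f1 f2] /=; rewrite mulrN opprK.
move=> fn0; rewrite E ltcE /= eqxx /= lt_neqAle Rintegral_ge0 ?andbT//.
apply: contra fn0 => /eqP/esym I0; apply/eqP.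
have <- : \pi_L2 0 = 0 by exact: (@pi_zeror _ _ _ _ _ (Quotient.quot ae0)).
rewrite -[f]reprK; apply/piL2E.
have : ae_eq mu setT (EFin \o h) (cst 0%E).
  apply/(ae_eq_integral_abs _ measurableT (measurable_int _ ih)).
  transitivity (\int[mu]_x (h x)%:E)%E.
    by apply: eq_integral => x _ /=; rewrite ger0_norm.
  rewrite -[LHS]fineK; first by congr EFin.
  exact: integrable_fin_num.
apply: filterS => x /= /(_ I) [] /eqP.
rewrite paddr_eq0 ?sqr_ge0// !sqrf_eq0 => /andP[/eqP a0 /eqP b0].
by apply/eqP; rewrite eq_complex -[repr f x]/(f x) a0 b0 eqxx.
Qed.

HB.instance Definition _ := bilinear_isBilinear.Build C L2 L2 C *%R
  (@Num.conj C \; *%R) L2dot (L2dotPl, L2dotPr).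
HB.instance Definition _ :=
  isHermitianSesquilinear.Build C L2 false Num.conj L2dot L2dot_herm.
HB.instance Definition _ := isDotProduct.Build C L2 L2dot L2dot_gt0.

End ComplexL2.

(* An inner product space is given as a module [H] with a form [dot]; [dot] is
   linear in its first argument and conjugate-linear in the second one. *)
Section HilbertSpace.
Variables (R : rcfType) (H : lmodType R[i]).
Variable dot : {dot H for @Num.conj R[i]}.
Local Notation C := R[i].

Definition hnorm (x : H) : C := sqrtC (dot x x).

Definition bounded_op (S : H -> H) : Prop :=
  exists M : C, forall x, hnorm (S x) <= M * hnorm x.

Definition orthonormal_family (I : eqType) (psi : I -> H) : Prop :=
  forall i j, dot (psi i) (psi j) = (i == j)%:R.

Definition total_family (I : Type) (psi : I -> H) : Prop :=
  forall (x : H) (e : C), 0 < e ->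
    exists (s : seq I) (a : I -> C), hnorm (x - \sum_(i <- s) a i *: psi i) < e.

Definition orthonormal_basis (I : eqType) (psi : I -> H) : Prop :=
  orthonormal_family psi /\ total_family psi.

Definition riesz_basis (I : eqType) (f : I -> H) : Prop :=
  exists (S Sinv : {linear H -> H}) (psi : I -> H),
    [/\ bounded_op S, bounded_op Sinv, cancel S Sinv /\ cancel Sinv S,
        orthonormal_basis psi & forall n, f n = S (psi n)].

(* Partially defined operators are represented by their graphs: [A f g] means
   that f belongs to dom(A) and A f = g. *)
Definition operator := H -> H -> Prop.

Definition adjoint (A : operator) : operator :=
  fun g h => forall f k, A f k -> dot k g = dot f h.

Definition is_eigenvalue (A : operator) (lam : C) : Prop :=
  exists2 f : H, f != 0 & A f (lam *: f).

Fixpoint shift_iter (A : operator) (lam : C) (j : nat) : operator :=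
  fun f g => if j is j'.+1
             then exists2 h, A f (h + lam *: f) & shift_iter A lam j' h g
             else f = g.

Definition root_space (A : operator) (lam : C) : set H :=
  [set f | exists j, shift_iter A lam j f 0].

(* The vectors f n with n in J form an (algebraic) basis of the subspace V. *)
Definition basis_of_subspace (I : eqType) (f : I -> H) (J : set I) (V : set H)
    : Prop :=
  (forall (s : seq I) (a : I -> C), uniq s -> [set` s] `<=` J ->
     \sum_(i <- s) a i *: f i = 0 -> {in s, forall i, a i = 0}) /\
  V = [set x | exists (s : seq I) (a : I -> C),
         [set` s] `<=` J /\ x = \sum_(i <- s) a i *: f i].

(* f enumerates the union of bases of all the root spaces of A; lam n is the
   eigenvalue to which the root vector f n belongs. *)
Definition root_vector_family (A : operator) (I : eqType) (f : I -> H) : Prop :=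
  exists lam : I -> C,
    (forall n, is_eigenvalue A (lam n)) /\
    (forall z, is_eigenvalue A z ->
       basis_of_subspace f [set n | lam n = z] (root_space A z)).

(* Bases of the root spaces can be rescaled arbitrarily, which does not preserve
   the Riesz basis property; hence some choice of these bases is asserted. *)
Definition root_vectors_form_riesz_basis (A : operator) : Prop :=
  exists f : int -> H, root_vector_family A f /\ riesz_basis f.

End HilbertSpace.

Definition mu02pi (R : realType) : {measure set (measurableTypeR R) -> \bar R} :=
  mrestr (@lebesgue_measure R) (measurable_itv `]0, 2 * (pi : R)[).

Notation L2pi R := (L2 (mu02pi R)).

Definition dot02pi (R : realType) : {dot (L2pi R) for @Num.conj R[i]} :=
  @L2dot _ _ R (mu02pi R).

Section PeriodicOperator.
Variable R : realType.

(* F is the absolutely continuous representative of f on [0, 2pi], and its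
   almost everywhere defined derivative is the class g of L^2(0, 2pi); so
   H^1(0, 2pi) consists of the f for which such F and g exist. *)
Definition H1_rep (f : L2pi R) (F : R -> R[i]) (g : L2pi R) : Prop :=
  {ae (mu02pi R), forall x, f x = F x} /\
  {in `[0, 2 * pi], forall x : R,
     F x = F 0 + cintegral (@lebesgue_measure R) `]0, x[ g}.

Definition P1 (K : L2pi R) : operator (L2pi R) :=
  fun f h => exists (F : R -> R[i]) (g : L2pi R),
    [/\ H1_rep f F g, F 0 = F (2 * pi) & h = 'i *: g + F (2 * pi) *: K].

End PeriodicOperator.

(* Main.v *)
(* The resolvent A of P_{1,K} at a point z is bounded and injective, and the root
   vectors of P_{1,K} are those of A.  A zero lam of
     Delta(lam) = exp(2 pi i lam) - 1 - i int_0^{2 pi} K(x) exp(i lam x) dx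
   gives the eigenvector g = exp(- i conj(lam) x) of A^*:
   <A f, g> = (lam - z)^{-1} <f, g> (second argument conjugated).  By contraction
   Delta has, for all integers n outside a finite set, a zero n + eps_n with eps_n
   bounded by the n-th Fourier coefficient of K; by Bessel's inequality the
   corresponding g_n are quadratically close to the Fourier basis e_n.  Hence there
   is an isomorphism X with <X f, e_n> = <f, g_n> for all those n, and X A X^{-1} is
   block triangular: a matrix on finitely many e_n, a diagonal with distinct entries
   tending to 0 on the others, and a coupling between them that is removed by
   solving Sylvester equations.  So A is similar to the direct sum of a matrix and a
   diagonal operator, and so is A^*; a basis of generalized eigenvectors of the
   matrix, completed by the remaining e_n, is mapped by the similarity to a Riesz
   basis of root vectors. *)

From HB Require Import structures.
From mathcomp Require Import all_boot all_order all_algebra.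
From mathcomp Require Import ring lra.
From mathcomp.real_closed Require Import complex.
From mathcomp Require Import all_classical all_reals all_analysis measurable_realfun.
Require Import Defs.
Set Implicit Arguments.
Unset Strict Implicit.
Unset Printing Implicit Defensive.
Import Order.TTheory GRing.Theory Num.Theory.
Import numFieldNormedType.Exports.
Local Open Scope ring_scope.

(** The operator P is unbounded and given as a relation, so everything is transferred to the bounded
    resolvent A: P - w corresponds to 1 - (w - z) A, and root spaces become kernels of powers of the
    latter. Eigenvectors of A^* are pure exponentials, whereas those of A involve K; hence the
    comparison with the Fourier basis is made on the adjoint side. Zeros of Delta are neither
    counted nor given multiplicities: for the exceptional n the map X keeps e_n itself, so X = 1 + E
    with E of norm at most 1/2 is invertible whatever happens there, and linear algebra in the
    finite block takes care of the remaining eigenvalues and their Jordan chains. The Sylvester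
    equations are solvable because A is injective, which makes the finite block M invertible, while
    the diagonal entries 1 / (lam_n - z) tend to 0; the finitely many n whose entry is not small
    against M^-1 are moved into the block, so coincidences between the spectra of the two parts do
    no harm. *)

Notation normc := ComplexField.Normc.normc.
Notation Re := complex.Re.
Notation Im := complex.Im.

(** * Orthonormal bases of complex Hilbert spaces *)

Section NormC.
Variable R : realType.
Implicit Types z w : R[i].

Lemma rcD (a b : R) : (a + b)%:C%C = a%:C%C + b%:C%C. Proof. exact: rmorphD. Qed.
Lemma rcB (a b : R) : (a - b)%:C%C = a%:C%C - b%:C%C. Proof. exact: rmorphB. Qed.
Lemma rcM (a b : R) : (a * b)%:C%C = a%:C%C * b%:C%C. Proof. exact: rmorphM. Qed.
Lemma rcX (a : R) n : (a ^+ n)%:C%C = a%:C%C ^+ n. Proof. exact: rmorphXn. Qed.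

Lemma conj_rc (a : R) : (a%:C%C)^* = a%:C%C. Proof. exact: conjc_real. Qed.

Lemma normcE z : (normc z)%:C%C = `|z|.
Proof. by []. Qed.

Lemma normc_ge0 z : 0 <= normc z.
Proof. by case: z => a b; rewrite sqrtr_ge0. Qed.

Lemma normcJ z : normc z^* = normc z.
Proof. by apply: complexI; rewrite !normcE norm_conjC. Qed.

Lemma normcM z w : normc (z * w) = normc z * normc w.
Proof. exact: ComplexField.Normc.normcM. Qed.

Lemma normcN z : normc (- z) = normc z.
Proof. by apply: complexI; rewrite !normcE normrN. Qed.

Lemma normcD z w : normc (z + w) <= normc z + normc w.
Proof. exact: le_normcD. Qed.

Lemma normcB z w : normc (z - w) <= normc z + normc w.
Proof. by rewrite -(normcN w); exact: normcD. Qed.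

Lemma normc0 : normc (0 : R[i]) = 0.
Proof. by apply: complexI; rewrite normcE normr0. Qed.

Lemma normc1 : normc (1 : R[i]) = 1.
Proof. by apply: complexI; rewrite normcE normr1. Qed.

Lemma normc_eq0 z : (normc z == 0) = (z == 0).
Proof.
apply/eqP/eqP => [|->]; [exact: ComplexField.Normc.eq0_normc | exact: normc0].
Qed.

Lemma normcV z : normc z^-1 = (normc z)^-1.
Proof. exact: ComplexField.Normc.normcV. Qed.

Lemma normc_real (r : R) : normc r%:C%C = `|r|.
Proof. by rewrite /= expr0n /= addr0 sqrtr_sqr. Qed.

Lemma sqr_normcE z : (normc z ^+ 2)%:C%C = z * z^*.
Proof. by rewrite rcX normcE normCK. Qed.

Lemma normc_sqr z : normc z ^+ 2 = Re z ^+ 2 + Im z ^+ 2.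
Proof. by case: z => a b /=; rewrite sqr_sqrtr // addr_ge0 ?sqr_ge0. Qed.

Lemma ge_Re z : `|Re z| <= normc z.
Proof. by have := normc_ge_Re z; rewrite -normcE lecR. Qed.

Lemma ReE' (r : R) z : Re (r%:C%C * z) = r * Re z.
Proof. by case: z => a b /=; rewrite mul0r subr0. Qed.

Lemma ReD' z w : Re (z + w) = Re z + Re w.
Proof. by case: z w => [a b] [c d]. Qed.

Lemma ReN' z : Re (- z) = - Re z.
Proof. by case: z => [a b]. Qed.

Lemma Re_conj z : Re z^* = Re z.
Proof. by case: z => a b. Qed.

Lemma Re_sum (I : Type) (s : seq I) (P : pred I) (F : I -> R[i]) :
  Re (\sum_(i <- s | P i) F i) = \sum_(i <- s | P i) Re (F i).
Proof. by rewrite (big_morph (@complex.Re R) ReD' (erefl _)). Qed.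

End NormC.

Section Hilbert.
Variables (R : realType) (H : lmodType R[i]).
Variable dot : {dot H for @Num.conj R[i]}.
Local Notation C := R[i].
Implicit Types x y : H.

Definition nrm2 x : R := Re (dot x x).
Definition nrm x : R := Num.sqrt (nrm2 x).

Lemma dotxx x : dot x x = (nrm2 x)%:C%C.
Proof.
have /ger0_Im := dnorm_ge0 dot x; rewrite /nrm2.
by case: (dot x x) => a b /= ->.
Qed.

Lemma nrm2_ge0 x : 0 <= nrm2 x.
Proof. by rewrite -lecR -dotxx dnorm_ge0. Qed.

Lemma nrm_ge0 x : 0 <= nrm x. Proof. exact: sqrtr_ge0. Qed.

Lemma sqr_nrm x : nrm x ^+ 2 = nrm2 x.
Proof. by rewrite sqr_sqrtr // nrm2_ge0. Qed.

Lemma hnormE x : hnorm dot x = (nrm x)%:C%C.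
Proof.
by rewrite /hnorm dotxx -sqr_nrm rcX sqrCK // lecR nrm_ge0.
Qed.

Lemma nrm2_eq0 x : (nrm2 x == 0) = (x == 0).
Proof. by rewrite -(dnorm_eq0 dot) dotxx eq_complex /= eqxx andbT. Qed.

Lemma nrm_eq0 x : (nrm x == 0) = (x == 0).
Proof. by rewrite -nrm2_eq0 -sqr_nrm expf_eq0. Qed.

Lemma nrm20 : nrm2 0 = 0. Proof. by apply/eqP; rewrite nrm2_eq0. Qed.
Lemma nrm0 : nrm 0 = 0. Proof. by apply/eqP; rewrite nrm_eq0. Qed.

Lemma dotC x y : dot x y = (dot y x)^*.
Proof. by rewrite hermC /= expr0 mul1r. Qed.

Lemma dotDl x y z : dot (x + y) z = dot x z + dot y z.
Proof. exact: linearDl. Qed.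
Lemma dotDr x y z : dot x (y + z) = dot x y + dot x z.
Proof. exact: linearDr. Qed.
Lemma dotBl x y z : dot (x - y) z = dot x z - dot y z.
Proof. exact: linearBl. Qed.
Lemma dotBr x y z : dot x (y - z) = dot x y - dot x z.
Proof. exact: linearBr. Qed.
Lemma dotZl a x y : dot (a *: x) y = a * dot x y.
Proof. exact: linearZl_LR. Qed.
Lemma dotZr a x y : dot x (a *: y) = a^* * dot x y.
Proof. exact: linearZr_LR. Qed.
Lemma dot0l x : dot 0 x = 0. Proof. exact: linear0l. Qed.
Lemma dot0r x : dot x 0 = 0. Proof. exact: linear0r. Qed.
Lemma dotNl x y : dot (- x) y = - dot x y. Proof. exact: linearNl. Qed.
Lemma dotNr x y : dot x (- y) = - dot x y. Proof. exact: linearNr. Qed.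
Lemma dot_suml (I : Type) (s : seq I) (P : pred I) F y :
  dot (\sum_(i <- s | P i) F i) y = \sum_(i <- s | P i) dot (F i) y.
Proof. exact: linear_sumlz. Qed.
Lemma dot_sumr (I : Type) (s : seq I) (P : pred I) F y :
  dot y (\sum_(i <- s | P i) F i) = \sum_(i <- s | P i) dot y (F i).
Proof. exact: linear_sumr. Qed.

Lemma nrm2Z a x : nrm2 (a *: x) = normc a ^+ 2 * nrm2 x.
Proof.
apply: complexI; rewrite -dotxx dotZl dotZr mulrA dotxx -sqr_normcE.
by rewrite -rcM.
Qed.

Lemma nrmZ a x : nrm (a *: x) = normc a * nrm x.
Proof.
by rewrite /nrm nrm2Z sqrtrM ?sqr_ge0 // sqrtr_sqr ger0_norm ?normc_ge0.
Qed.

Lemma nrm2N x : nrm2 (- x) = nrm2 x.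
Proof. by rewrite /nrm2 dotNl dotNr opprK. Qed.

Lemma nrmN x : nrm (- x) = nrm x.
Proof. by rewrite /nrm nrm2N. Qed.

Lemma nrm2D x y : nrm2 (x + y) = nrm2 x + nrm2 y + 2 * Re (dot x y).
Proof.
rewrite /nrm2 dotDl !dotDr (dotC y x) !ReD' Re_conj; ring.
Qed.

Lemma cauchy_schwarz x y : normc (dot x y) <= nrm x * nrm y.
Proof.
have [->|y0] := eqVneq y 0; first by rewrite dot0r normc0 nrm0 mulr0.
have b0 : 0 < nrm2 y by rewrite lt_neqAle nrm2_ge0 eq_sym nrm2_eq0 y0.
rewrite -(@ler_pXn2r _ 2) ?nnegrE ?mulr_ge0 ?nrm_ge0 ?normc_ge0 //.
rewrite exprMn !sqr_nrm.
have := nrm2_ge0 ((nrm2 y)%:C%C *: x - dot x y *: y).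
have -> : nrm2 ((nrm2 y)%:C%C *: x - dot x y *: y) =
    nrm2 y * (nrm2 x * nrm2 y - normc (dot x y) ^+ 2).
  apply: complexI; rewrite -[LHS]dotxx (rcM (nrm2 y)) rcB rcM sqr_normcE.
  rewrite dotBl !dotBr !dotZl !dotZr !dotxx (dotC y x) conj_rc; ring.
by rewrite pmulr_rge0 // subr_ge0.
Qed.

Lemma nrmD x y : nrm (x + y) <= nrm x + nrm y.
Proof.
rewrite -(@ler_pXn2r _ 2) ?nnegrE ?addr_ge0 ?nrm_ge0 //.
rewrite sqrrD !sqr_nrm nrm2D addrAC lerD2r lerD2l.
rewrite mulr_natl lerMn2r /=; apply: le_trans (cauchy_schwarz x y).
exact: le_trans (ler_norm _) (ge_Re _).
Qed.

Lemma nrmB x y : nrm (x - y) <= nrm x + nrm y.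
Proof. by rewrite -(nrmN y); exact: nrmD. Qed.

Lemma nrm_sum (I : Type) (s : seq I) (P : pred I) (F : I -> H) :
  nrm (\sum_(i <- s | P i) F i) <= \sum_(i <- s | P i) nrm (F i).
Proof.
elim/big_rec2: _ => [|i y1 y2 _ le]; first by rewrite nrm0.
by apply: le_trans (nrmD _ _) _; rewrite lerD2l.
Qed.

(** The real counterpart of [bounded_op]; the nonnegative constant allows bounds to be multiplied
    and added directly. *)
Definition bnd (T : H -> H) := exists2 M : R, 0 <= M & forall x, nrm (T x) <= M * nrm x.

Lemma bnd_bounded_op T : bnd T -> bounded_op dot T.
Proof.
move=> [M M0 h]; exists M%:C%C => x.
by rewrite !hnormE -rcM lecR.
Qed.

Lemma bnd_comp T S : bnd T -> bnd S -> bnd (fun x => T (S x)).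
Proof.
move=> [M M0 hM] [N N0 hN]; exists (M * N); first exact: mulr_ge0.
move=> x; rewrite -mulrA; apply: le_trans (hM _) _.
by apply: ler_wpM2l.
Qed.

Lemma bnd_id : bnd id.
Proof. by exists 1 => // x; rewrite mul1r. Qed.

Lemma bndD T S : bnd T -> bnd S -> bnd (fun x => T x + S x).
Proof.
move=> [M M0 hM] [N N0 hN]; exists (M + N); first exact: addr_ge0.
move=> x; rewrite mulrDl; apply: le_trans (nrmD _ _) _.
exact: lerD.
Qed.

Lemma bndN T : bnd T -> bnd (fun x => - T x).
Proof. by move=> [M M0 hM]; exists M => // x; rewrite nrmN. Qed.

(** Operators are often obtained by [choice] and proved linear afterwards; this bundles them. *)
Lemma to_linear (f : H -> H) : (forall a x y, f (a *: x + y) = a *: f x + f y) ->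
  {g : {linear H -> H} | g =1 f}.
Proof.
move=> lf; pose g : {linear H -> H} := HB.pack f (GRing.isLinear.Build C H H *:%R f lf).
by exists g.
Qed.

End Hilbert.

(** * Riesz-Fischer, Parseval, and operators prescribed by their coordinates *)

Section ONB.
Variables (R : realType) (H : lmodType R[i]).
Variable dot : {dot H for @Num.conj R[i]}.
Local Notation C := R[i].
Local Notation nrm := (nrm dot).
Local Notation nrm2 := (nrm2 dot).
Implicit Types x y : H.

Lemma big_sub_seq (V : nmodType) (I : eqType) (s u : seq I) (F : I -> V) :
  uniq s -> uniq u -> {subset s <= u} ->
  \sum_(i <- u) F i = \sum_(i <- s) F i + \sum_(i <- u | i \notin s) F i.
Proof.
move=> us uu su; rewrite (bigID (mem s)) /=; congr (_ + _).
rewrite -big_filter; apply: perm_big; apply: uniq_perm => //.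
  exact: filter_uniq.
move=> i; rewrite mem_filter andb_idr //; exact: su.
Qed.

Variables (I : eqType) (e : I -> H).
Hypothesis eo : orthonormal_family dot e.

Definition psum (c : I -> C) (s : seq I) : R := \sum_(i <- s) normc (c i) ^+ 2.

Lemma dot_comb (s : seq I) (a : I -> C) i : uniq s ->
  dot (\sum_(j <- s) a j *: e j) (e i) = if i \in s then a i else 0.
Proof.
move=> us; rewrite dot_suml.
under eq_bigr do rewrite dotZl eo.
case: ifPn => [si|si].
  rewrite (bigD1_seq i) //= eqxx mulr1 big1 ?addr0 // => j /negPf ji.
  by rewrite ji mulr0.
rewrite big_seq big1 // => j js; case: eqP => [ji|_]; last by rewrite mulr0.
by rewrite ji in js; rewrite js in si.
Qed.

Lemma nrm2_comb (s : seq I) (a : I -> C) : uniq s ->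
  nrm2 (\sum_(j <- s) a j *: e j) = psum a s.
Proof.
move=> us; apply: complexI; rewrite -[LHS]dotxx dot_sumr.
rewrite (raddf_sum (real_complex R)) big_seq [RHS]big_seq.
apply: eq_bigr => i si; rewrite dotZr dot_comb // si mulrC.
by rewrite -[LHS]sqr_normcE.
Qed.

Lemma nrm2_resid x (s : seq I) : uniq s ->
  nrm2 (x - \sum_(i <- s) dot x (e i) *: e i) =
  nrm2 x - psum (fun i => dot x (e i)) s.
Proof.
move=> us; set y := \sum_(i <- s) _.
rewrite nrm2D nrm2N dotNr ReN' (nrm2_comb _ us).
have -> : Re (dot x y) = psum (fun i => dot x (e i)) s.
  rewrite /y dot_sumr Re_sum; apply: eq_bigr => i _.
  by rewrite dotZr mulrC -sqr_normcE.
ring.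
Qed.

Lemma bessel x (s : seq I) : uniq s -> psum (fun i => dot x (e i)) s <= nrm2 x.
Proof. by move=> us; rewrite -subr_ge0 -nrm2_resid // nrm2_ge0. Qed.

Lemma psum_sub c (s u : seq I) : uniq s -> uniq u -> {subset s <= u} ->
  psum c u = psum c s + psum c [seq i <- u | i \notin s].
Proof. by move=> us uu su; rewrite /psum (big_sub_seq _ us uu su) big_filter. Qed.

Lemma comb_sub c (s u : seq I) : uniq s -> uniq u -> {subset s <= u} ->
  nrm2 (\sum_(i <- u) c i *: e i - \sum_(i <- s) c i *: e i) =
  psum c u - psum c s.
Proof.
move=> us uu su; rewrite (psum_sub _ us uu su) addrAC subrr add0r.
by rewrite (big_sub_seq _ us uu su) addrAC subrr add0r -big_filter nrm2_comb ?filter_uniq.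
Qed.

(** The index type carries no order, so summability is a bound over finite sets of indices instead
    of convergence of a series. *)
Definition sqsum (c : I -> C) := exists M : R, forall s, uniq s -> psum c s <= M.

(** Spelled out with epsilons because [H] is a bare module with a form, without a topology. *)
Definition hcomplete := forall u : nat -> H,
  (forall eps : R, 0 < eps -> exists N, forall m n, (N <= m)%N -> (N <= n)%N ->
     nrm (u m - u n) <= eps) ->
  exists x, forall eps : R, 0 < eps -> exists N, forall n, (N <= n)%N -> nrm (x - u n) <= eps.

(** [S] is the sum of the family, taken as the supremum of the finite partial sums. *)
Lemma sqsum_approx c (M : R) : (forall s, uniq s -> psum c s <= M) ->
  exists2 S : R, S <= M & (forall s, uniq s -> psum c s <= S) /\
    (forall d : R, 0 < d -> exists2 s, uniq s & S - d <= psum c s).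
Proof.
move=> hM; pose A := [set psum c s | s in [set s | uniq s]]%classic.
have A0 : (A !=set0)%classic by exists (psum c [::]); exists [::].
have hA : has_sup A by split => //; exists M => _ [s us <-]; exact: hM.
exists (sup A); first by apply: ge_sup => // _ [s us <-]; exact: hM.
split=> [s us|d d0]; first by apply: ub_le_sup; [case: hA | exists s].
have [_ [s us <-] lt] := sup_adherent d0 hA.
by exists s => //; exact: ltW.
Qed.

(** A finite set whose partial sum is within d of the supremum leaves at most d for every finite set
    disjoint from it. *)
Lemma sqsum_tail c (d : R) : sqsum c -> 0 < d ->
  exists s0 : seq I, forall s, uniq s -> (forall i, i \in s -> i \notin s0) -> psum c s <= d.
Proof.
move=> [M /sqsum_approx [S _ [hS /(_ d)]]] + d0 => /(_ d0) [s0 us0 le].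
exists s0 => s us dis.
have uu : uniq (s0 ++ s).
  rewrite cat_uniq us0 us andbT /=; apply/hasPn => i /dis //.
have := hS _ uu; rewrite /psum big_cat /= -/(psum c s0) -/(psum c s) => h.
lra.
Qed.

(** Half of the parallelogram identity: |x + y|^2 <= 2 |x|^2 + 2 |y|^2. *)
Lemma nrm_le2 x y (d : R) : nrm2 x <= d -> nrm2 y <= d -> nrm2 (x + y) <= 4 * d.
Proof.
move=> hx hy; have := nrm2_ge0 dot (x - y).
rewrite !nrm2D nrm2N dotNr ReN' => h; lra.
Qed.

Lemma nrm_le x (d : R) : 0 <= d -> (nrm x <= d) = (nrm2 x <= d ^+ 2).
Proof. by move=> d0; rewrite -sqr_nrm ler_pXn2r // nnegrE ?nrm_ge0. Qed.

Lemma lim_nrm2 (x : H) (u : nat -> H) (M : R) : 0 <= M ->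
  (forall n, nrm2 (u n) <= M) ->
  (forall eps : R, 0 < eps -> exists n, nrm (x - u n) <= eps) -> nrm2 x <= M.
Proof.
move=> M0 uM xu; rewrite -[M]sqr_sqrtr // -nrm_le ?sqrtr_ge0 //.
apply/ler_addgt0Pr => eps e0; have [n hn] := xu _ e0.
have -> : x = (x - u n) + u n by rewrite subrK.
apply: le_trans (nrmD _ _ _) _; rewrite addrC lerD //.
by rewrite nrm_le ?sqrtr_ge0 // sqr_sqrtr.
Qed.

Lemma dot_lim (x y : H) (u : nat -> H) (c : C) :
  (forall eps : R, 0 < eps -> exists N, forall n, (N <= n)%N -> nrm (x - u n) <= eps) ->
  (forall eps : R, 0 < eps -> exists N, forall n, (N <= n)%N -> normc (dot (u n) y - c) <= eps) ->
  dot x y = c.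
Proof.
move=> xu uc; apply/eqP; rewrite -subr_eq0 -normc_eq0 eq_le normc_ge0 andbT.
apply/ler_addgt0Pr => eps e0; rewrite add0r.
have d0 : 0 < eps / (1 + nrm y) / 2.
  by rewrite !divr_gt0 // ltr_pwDl // nrm_ge0.
have [N hN] := xu _ d0; have e2 : 0 < eps / 2 by lra.
have [N' hN'] := uc _ e2.
have := hN _ (leq_maxl N N'); have := hN' _ (leq_maxr N N').
set n := maxn N N' => h1 h2.
have -> : dot x y - c = dot (x - u n) y + (dot (u n) y - c).
  by rewrite dotBl; ring.
apply: le_trans (normcD _ _) _.
have := cauchy_schwarz dot (x - u n) y.
have y0 := nrm_ge0 dot y.
have : nrm (x - u n) * nrm y <= eps / (1 + nrm y) / 2 * (1 + nrm y).
  by apply: ler_pM => //; [exact: nrm_ge0 | lra].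
have -> : eps / (1 + nrm y) / 2 * (1 + nrm y) = eps / 2.
  by field; apply/eqP => h; lra.
lra.
Qed.

Hypothesis cpl : hcomplete.

Lemma inv_small (eps : R) : 0 < eps -> exists N, forall n, (N <= n)%N -> n.+1%:R^-1 <= eps.
Proof.
move=> e0; exists (Num.truncn (eps^-1)) => n le.
rewrite invf_ple ?posrE ?ltr0n // ltW //.
apply: lt_le_trans (truncnS_gt _) _.
by rewrite ler_nat ltnS.
Qed.

(** The vector is the limit of the combinations over finite sets [s k] whose partial sums come
    within 1/(k+1) of the supremum. *)
Lemma riesz_fischer c (M : R) : (forall s, uniq s -> psum c s <= M) ->
  exists2 x, forall i, dot x (e i) = c i & nrm2 x <= M.
Proof.
move=> hM; have [S SM [hS aS]] := sqsum_approx hM.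
have S0 : 0 <= S by have := hS [::] isT; rewrite /psum big_nil.
pose d k : R := k.+1%:R^-1.
have d0 k : 0 < d k by rewrite invr_gt0 ltr0n.
have {aS} /choice [s hs] : forall k, exists s, uniq s /\ S - d k <= psum c s.
  by move=> k; have [s us h] := aS _ (d0 k); exists s.
pose u k := \sum_(i <- s k) c i *: e i.
have uu k : uniq (s k) by case: (hs k).
have hu k l : nrm2 (u k - u l) <= 4 * Num.max (d k) (d l).
  (* The sets [s k] need not be nested, so two combinations are compared through their union. *)
  pose t := undup (s k ++ s l).
  have ut : uniq t by exact: undup_uniq.
  have -> : u k - u l = (u k - \sum_(i <- t) c i *: e i) + (\sum_(i <- t) c i *: e i - u l).
    by rewrite addrA subrK.
  have sk : {subset s k <= t} by move=> i; rewrite mem_undup mem_cat => ->.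
  have sl : {subset s l <= t} by move=> i; rewrite mem_undup mem_cat orbC => ->.
  apply: nrm_le2.
    rewrite -nrm2N opprB comb_sub //.
    have := hS _ ut; have [_] := hs k.
    have : d k <= Num.max (d k) (d l) by rewrite le_max lexx.
    lra.
  rewrite comb_sub //.
  have := hS _ ut; have [_] := hs l.
  have : d l <= Num.max (d k) (d l) by rewrite le_max lexx orbT.
  lra.
have [x hx] : exists x, forall eps : R, 0 < eps -> exists N, forall n, (N <= n)%N -> nrm (x - u n) <= eps.
  apply: cpl => eps e0.
  have e4 : 0 < eps ^+ 2 / 4 by rewrite divr_gt0 // exprn_gt0.
  have [N hN] := inv_small e4; exists N => m n mN nN.
  rewrite nrm_le ?(ltW e0) //; apply: le_trans (hu m n) _.
  have : Num.max (d m) (d n) <= eps ^+ 2 / 4 by rewrite ge_max !hN.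
  lra.
exists x => [i|]; last first.
  apply: (le_trans _ SM); apply: (@lim_nrm2 x u) => // [n|eps e0].
    by rewrite nrm2_comb //; exact: hS.
  by have [N hN] := hx _ e0; exists N; exact: hN.
apply: (dot_lim hx) => eps e0.
have e4 : 0 < eps ^+ 2 by rewrite exprn_gt0.
have [N hN] := inv_small e4; exists N => n nN.
rewrite dot_comb //; case: ifPn => si; first by rewrite subrr normc0 ltW.
rewrite sub0r normcN -(@ler_pXn2r _ 2) ?nnegrE ?normc_ge0 ?(ltW e0) //.
apply: (le_trans _ (hN _ nN)).
(* An index missing from [s n] can be added to it, so |c i|^2 is at most the gap to the supremum. *)
have uis : uniq (i :: s n) by rewrite /= si uu.
have := hS _ uis; rewrite /psum big_cons -/(psum c (s n)).
have [_] := hs n; rewrite -/(d n) => h1 h2; lra.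
Qed.

Hypothesis et : forall x, (forall i, dot x (e i) = 0) -> x = 0.

Lemma coord_inj x y : (forall i, dot x (e i) = dot y (e i)) -> x = y.
Proof.
by move=> h; apply/eqP; rewrite -subr_eq0; apply/eqP/et => i; rewrite dotBl h subrr.
Qed.

(** The vector built by [riesz_fischer] from the coordinates of x has the desired norm bound, and it
    is x because coordinates separate points. *)
Lemma parseval_le x (M : R) :
  (forall s, uniq s -> psum (fun i => dot x (e i)) s <= M) -> nrm2 x <= M.
Proof. by move=> /riesz_fischer [y /coord_inj -> ]. Qed.

Lemma approx_comb x (eps : R) : 0 < eps ->
  exists2 s, uniq s & nrm (x - \sum_(i <- s) dot x (e i) *: e i) <= eps.
Proof.
move=> e0; have := @sqsum_approx (fun i => dot x (e i)) (nrm2 x) (bessel x).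
case=> S SM [/parseval_le xS aS].
have [|s us hs] := aS (eps ^+ 2); first by rewrite exprn_gt0.
exists s => //; rewrite nrm_le ?(ltW e0) // nrm2_resid //; lra.
Qed.

(** Hypothesis [et], the triviality of the orthogonal complement, is the form of totality that
    Fourier coefficients can verify; density of finite combinations follows from it by Parseval. *)
Lemma orthonormal_basis_coord : orthonormal_basis dot e.
Proof.
split=> // x r r0; have rE : r = (Re r)%:C%C.
  by have := ger0_Im (ltW r0); case: r {r0} => a b /= ->.
rewrite rE in r0 *; rewrite ltcR in r0.
have e2 : 0 < Re r / 2 by lra.
have [s us hs] := approx_comb x e2.
exists s, (fun i => dot x (e i)); rewrite hnormE ltcR.
by apply: le_lt_trans hs _; lra.
Qed.

Lemma bnd_linear_ext (T S : {linear H -> H}) : bnd dot T -> bnd dot S ->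
  (forall i, T (e i) = S (e i)) -> T =1 S.
Proof.
move=> bT bS h x; have [M M0 hM] := bndD bT (bndN bS).
apply/eqP; rewrite -subr_eq0 -(nrm_eq0 dot) eq_le nrm_ge0 andbT.
apply/ler_addgt0Pr => eps e0; rewrite add0r.
have d0 : 0 < eps / (1 + M) by rewrite divr_gt0 // ltr_pwDl.
have [s us hs] := approx_comb x d0.
set y := \sum_(i <- s) _ in hs.
have Ty : T y = S y.
  by rewrite !linear_sum; apply: eq_bigr => i _; rewrite !linearZ /= h.
have -> : T x - S x = T (x - y) - S (x - y).
  by rewrite (linearB T) (linearB S) /= Ty opprB addrA subrK.
apply: le_trans (hM (x - y)) _.
rewrite mulrC -(@divfK _ (1 + M) _ eps) ?gt_eqF ?ltr_pwDl //.
apply: ler_pM => //; [exact: nrm_ge0 | lra].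
Qed.

(** Adjoints and quadratically small perturbations are both built this way: square summable
    coordinates define a vector, and its uniqueness makes the operator linear. *)
Lemma coord_op (c : H -> I -> C) (M : R) : 0 <= M ->
  (forall a x y i, c (a *: x + y) i = a * c x i + c y i) ->
  (forall x s, uniq s -> psum (c x) s <= M ^+ 2 * nrm2 x) ->
  exists T : {linear H -> H}, (forall x i, dot (T x) (e i) = c x i) /\
    (forall x, nrm (T x) <= M * nrm x).
Proof.
move=> M0 cl cM.
have /choice [f hf] : forall x, exists y, (forall i, dot y (e i) = c x i) /\
    nrm2 y <= M ^+ 2 * nrm2 x.
  by move=> x; have [y h1 h2] := riesz_fischer (cM x); exists y.
have [|T TE] := @to_linear _ _ f.
  move=> a x y; apply: coord_inj => i.
  by rewrite dotDl dotZl !(hf _).1 cl.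
exists T; split=> x; rewrite TE; first exact: (hf x).1.
rewrite nrm_le ?mulr_ge0 ?nrm_ge0 // exprMn sqr_nrm; exact: (hf x).2.
Qed.

(** The coordinates of T' y are forced to be <y, T e_i>. The adjoint identity then holds for y
    against finite combinations of the e_i, and extends by density. *)
Lemma adjoint_ex (T : {linear H -> H}) : bnd dot T ->
  exists2 T' : {linear H -> H}, bnd dot T' & forall x y, dot (T x) y = dot x (T' y).
Proof.
move=> bT; have [M M0 hM] := bT.
have [||T' [T'e T'M]] := @coord_op (fun y i => dot y (T (e i))) M M0.
- by move=> a x y i; rewrite dotDl dotZl.
- move=> y s us; set c := fun i => _.
  (* Duality: |w|^2 = <y, T w> <= M |y| |w|, hence |w| <= M |y|. *)
  pose w := \sum_(i <- s) c i *: e i.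
  have wE : nrm2 w = psum c s by exact: nrm2_comb.
  have : (psum c s) = Re (dot y (T w)).
    rewrite linear_sum dot_sumr Re_sum; apply: eq_bigr => i _.
    by rewrite linearZ /= dotZr -/(c i) mulrC -sqr_normcE.
  move=> E; have : nrm2 w <= nrm y * (M * nrm w).
    rewrite wE E; apply: le_trans (ler_norm _) _.
    apply: le_trans (ge_Re _) _; apply: le_trans (cauchy_schwarz _ _ _) _.
    by rewrite ler_wpM2l ?nrm_ge0.
  rewrite -wE -!sqr_nrm.
  have := nrm_ge0 dot w; rewrite le_eqVlt => /orP[/eqP <- _|w0].
    by rewrite expr0n /= mulr_ge0 ?sqr_ge0.
  rewrite expr2 mulrA ler_pM2r // => h.
  rewrite -expr2 -exprMn ler_pXn2r ?nnegrE ?mulr_ge0 ?nrm_ge0 //.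
  by rewrite mulrC.
have bT' : bnd dot T' by exists M.
exists T' => // x y.
have [z zE] : exists z, z = dot (T x) y - dot x (T' y) by eexists.
apply/eqP; rewrite -subr_eq0 -zE -normc_eq0 eq_le normc_ge0 andbT.
apply/ler_addgt0Pr => eps e0; rewrite add0r.
have d0 : 0 < eps / (1 + 2 * M * nrm y) by rewrite divr_gt0 // ltr_pwDl // !mulr_ge0 ?nrm_ge0.
have [s us hs] := approx_comb x d0.
set v := \sum_(i <- s) _ in hs.
have hv : dot (T v) y = dot v (T' y).
  rewrite linear_sum !dot_suml; apply: eq_bigr => i _.
  by rewrite linearZ /= !dotZl (dotC _ _ y) -T'e -(dotC _ (e i)).
have -> : z = dot (T (x - v)) y - dot (x - v) (T' y).
  by rewrite zE linearB /= !dotBl hv; ring.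
apply: le_trans (normcB _ _) _.
have h1 : normc (dot (T (x - v)) y) <= (M * nrm (x - v)) * nrm y.
  by apply: le_trans (cauchy_schwarz _ _ _) _; rewrite ler_wpM2r ?nrm_ge0.
have h2 : normc (dot (x - v) (T' y)) <= nrm (x - v) * (M * nrm y).
  by apply: le_trans (cauchy_schwarz _ _ _) _; rewrite ler_wpM2l ?nrm_ge0.
have h3 : nrm (x - v) * (1 + 2 * M * nrm y) <= eps.
  by rewrite -ler_pdivlMr // ltr_pwDl // !mulr_ge0 ?nrm_ge0.
have := nrm_ge0 dot (x - v); nra.
Qed.

(** A Hilbert-Schmidt bound: by Cauchy-Schwarz each coordinate of T x is at most |p_i| |x|. *)
Lemma perturb_op (p : I -> H) (q : R) : 0 <= q ->
  (forall s, uniq s -> \sum_(i <- s) nrm2 (p i) <= q ^+ 2) ->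
  exists T : {linear H -> H}, (forall x i, dot (T x) (e i) = dot x (p i)) /\
    (forall x, nrm (T x) <= q * nrm x).
Proof.
move=> q0 hq; apply: coord_op => //.
  by move=> a x y i; rewrite dotDl dotZl.
move=> x s us; apply: le_trans (_ : (\sum_(i <- s) nrm2 (p i)) * nrm2 x <= _); last first.
  by rewrite ler_wpM2r ?nrm2_ge0 ?hq.
rewrite mulr_suml; apply: ler_sum => i _.
rewrite -!sqr_nrm -exprMn ler_pXn2r ?nnegrE ?mulr_ge0 ?nrm_ge0 ?normc_ge0 //.
by rewrite mulrC cauchy_schwarz.
Qed.

(** The equation x + E x = y is solved by iterating x -> y - E x from 0; the iterates stay in the
    ball of radius |y| / (1 - r). *)
Lemma neumann (E : {linear H -> H}) (r : R) : 0 <= r -> r < 1 ->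
  (forall x, nrm (E x) <= r * nrm x) ->
  exists Y : {linear H -> H}, [/\ bnd dot Y, forall x, Y (x + E x) = x &
     forall x, Y x + E (Y x) = x].
Proof.
move=> r0 r1 hE.
have /choice [f hf] : forall y, exists x, x + E x = y.
  move=> y; pose u := fix u n := if n is n'.+1 then y - E (u n') else 0.
  pose B := nrm y / (1 - r).
  have B0 : 0 <= B by rewrite divr_ge0 ?nrm_ge0 // subr_ge0 ltW.
  have hB : nrm y + r * B = B by rewrite /B; field; apply/eqP => h; lra.
  have uB n : nrm (u n) <= B.
    elim: n => [|n IH] /=; first by rewrite nrm0.
    apply: le_trans (nrmB _ _ _) _; have := hE (u n).
    have : r * nrm (u n) <= r * B by rewrite ler_wpM2l.
    lra.
  have ud n k : nrm (u (n + k)%N - u n) <= r ^+ n * B.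
    elim: n => [|n IH]; first by rewrite add0n /= subr0 expr0 mul1r.
    rewrite addSn /=.
    have -> : y - E (u (n + k)%N) - (y - E (u n)) = - E (u (n + k)%N - u n).
      by rewrite (linearB E) /= opprD opprK addrACA subrr add0r opprB addrC.
    rewrite nrmN exprS -mulrA; apply: le_trans (hE _) _.
    by rewrite ler_wpM2l.
  have rB (eps : R) : 0 < eps -> exists N, forall n, (N <= n)%N -> r ^+ n * B <= eps.
    move=> e0; have d0 : 0 < eps / (1 + B) by rewrite divr_gt0 // ltr_pwDl.
    have /cvgrPdist_le /(_ _ d0) [N _ hN] : ((fun n => r ^+ n) @ \oo --> (0:R))%classic.
      by apply: cvg_expr; rewrite ger0_norm.
    exists N => n nN; have /= := hN n nN.
    rewrite sub0r normrN ger0_norm ?exprn_ge0 // => h.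
    have : r ^+ n * B <= eps / (1 + B) * (1 + B).
      by apply: ler_pM => //; rewrite ?exprn_ge0 //; lra.
    by rewrite divfK // gt_eqF // ltr_pwDl.
  have [x hx] : exists x, forall eps : R, 0 < eps -> exists N, forall n, (N <= n)%N -> nrm (x - u n) <= eps.
    apply: cpl => eps e0; have [N hN] := rB _ e0; exists N => m n mN nN.
    wlog mn : m n mN nN / (n <= m)%N.
      move=> W; case: (leqP n m) => [|/ltnW] mn; first exact: W.
      by rewrite -nrmN opprB; exact: W.
    by rewrite -(subnKC mn); apply: le_trans (ud _ _) _; exact: hN.
  exists x; apply/eqP; rewrite -subr_eq0 -(nrm_eq0 dot) eq_le nrm_ge0 andbT.
  apply/ler_addgt0Pr => eps e0; rewrite add0r.
  have e2 : 0 < eps / 2 by lra.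
  have [N hN] := hx _ e2.
  have h1 := hN N (leqnn _); have h2 := hN N.+1 (leqnSn _).
  have -> : x + E x - y = (x - u N.+1) + E (x - u N).
    by rewrite (linearB E) /= opprB addrACA [E (u N) - _ + _]addrAC subrr add0r.
  apply: le_trans (nrmD _ _ _) _.
  have := hE (x - u N); have := nrm_ge0 dot (x - u N); nra.
(* Injectivity makes the chosen solutions linear in y and provides the left inverse property. *)
have inj x y : x + E x = y + E y -> x = y.
  move=> h; apply/eqP; rewrite -subr_eq0 -(nrm_eq0 dot).
  have : nrm (x - y) <= r * nrm (x - y).
    have {1}-> : nrm (x - y) = nrm (E (x - y)).
      rewrite -nrmN; congr (nrm _); rewrite (linearB E) /=.
      by rewrite opprB; apply/eqP; rewrite subr_eq addrC addrA h addrK.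
    exact: hE.
  have := nrm_ge0 dot (x - y) => a b; apply/eqP; nra.
have [|Y YE] := @to_linear _ _ f.
  move=> a x y; apply: inj; rewrite hf linearD linearZ /= addrACA -scalerDr.
  by rewrite !hf.
exists Y; split.
- exists (1 - r)^-1; first by rewrite invr_ge0 subr_ge0 ltW.
  move=> x; rewrite YE mulrC ler_pdivlMr ?subr_gt0 //.
  have := hE (f x); have : nrm (f x) <= nrm x + nrm (E (f x)).
    by have := nrmB dot (f x + E (f x)) (E (f x)); rewrite addrK hf.
  lra.
- by move=> x; rewrite YE; apply: inj; rewrite hf.
- by move=> x; rewrite YE hf.
Qed.

End ONB.

(** * Root vectors of block-diagonal operators *)

Section RootBasis.
Variables (F : closedFieldType) (n : nat) (M : 'M[F]_n.+1).

Lemma horner_mx_XsubC_exp a j : horner_mx M (('X - a%:P) ^+ j) = (M - a%:M) ^+ j.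
Proof. by rewrite rmorphXn rmorphB /= horner_mx_X horner_mx_C. Qed.

(** A basis of generalized eigenvectors without Jordan normal form. The last clause says that the
    expansion of a generalized eigenvector for [a] uses only basis rows belonging to [a]. *)
Lemma root_basis_matrix : exists (P : 'M[F]_n.+1) (rho : 'I_n.+1 -> F),
  [/\ P \in unitmx,
      forall k, exists j, row k P *m (M - (rho k)%:M) ^+ j = 0 &
      forall a (v : 'rV_n.+1) j, v *m (M - a%:M) ^+ j = 0 ->
        forall k, rho k != a -> (v *m invmx P) 0 k = 0].
Proof.
have [r rE] := closed_field_poly_normal (char_poly M).
rewrite (monicP (char_poly_monic M)) scale1r in rE.
(* The exponent N is the number of roots with multiplicity, hence at least every single
   multiplicity. *)
pose s := undup r; pose N := size r; pose m := size s.
pose a_ (i : 'I_m) := s`_i.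
pose q_ (i : 'I_m) : {poly F} := ('X - (a_ i)%:P) ^+ N.
have cop : {in xpredT &, forall i j : 'I_m, j != i -> coprimep (q_ i) (q_ j)}.
  move=> i j _ _ ji; rewrite coprimep_expr ?coprimep_expl //.
  rewrite coprimep_XsubC root_XsubC nth_uniq ?undup_uniq //.
have full : (\sum_i kermxpoly M (q_ i) :=: 1)%MS.
  apply: eqmx_trans (eqmx_sym (kermxpoly_prod M cop)) _.
  apply: kermxpoly_min; apply: dvdp_trans (mxminpoly_dvd_char _) _.
  rewrite rE prodrXl.
  have {rE} : {subset r <= s} by move=> z; rewrite mem_undup.
  have -> : \prod_(i < m) ('X - (a_ i)%:P) = \prod_(z <- s) ('X - z%:P).
    by rewrite (big_nth 0) big_mkord.
  rewrite /N; elim: (r) => [|z r' IH] sub; first by rewrite big_nil dvd1p.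
  rewrite big_cons exprS dvdp_mul //.
    by rewrite dvdp_XsubCl root_prod_XsubC sub ?mem_head.
  by apply: IH => y yr; apply: sub; rewrite in_cons yr orbT.
(* All rows of all generalized eigenspaces are stacked; the stack has full rank, and P selects
   independent rows from it. *)
pose G := \matrix_(i < #|{: 'I_m * 'I_n.+1}|)
   row (enum_val i).2 (kermxpoly M (q_ (enum_val i).1)).
have Gfull : row_full G.
  rewrite -sub1mx -full; apply/sumsmx_subP => i _; apply/row_subP => k.
  have -> : row k (kermxpoly M (q_ i)) = row (enum_rank (i, k)) G.
    by rewrite rowK enum_rankK.
  exact: row_sub.
pose f := fullrankfun Gfull; pose P := rowsub f G.
pose rho k := a_ (enum_val (f k)).1.
have Pu : P \in unitmx by exact: fullrowsub_unit.
have Pk l : row l P *m (M - (rho l)%:M) ^+ N = 0.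
  rewrite row_rowsub rowK -horner_mx_XsubC_exp.
  by rewrite -row_mul /kermxpoly mulmx_ker row0.
exists P, rho; split=> // [k|a v j vj k rka]; first by exists N.
pose c := v *m invmx P.
have vE : v = \sum_k c 0 k *: row k P.
  by rewrite -mulmx_sum_row /c mulmxKV.
(* The foreign part w = v - u is annihilated by a power of 'X - a as well as by a polynomial prime
   to it, so it vanishes. *)
pose u := \sum_(k | rho k == a) c 0 k *: row k P.
pose w := \sum_(k | rho k != a) c 0 k *: row k P.
have vuw : v = u + w by rewrite vE (bigID (fun k => rho k == a)).
have Pk' l L : (N <= L)%N -> row l P *m (M - (rho l)%:M) ^+ L = 0.
  by move=> NL; rewrite -(subnKC NL) exprD mulmxA Pk mul0mx.
have w1 : (w <= kermxpoly M (('X - a%:P) ^+ (j + N)))%MS.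
  apply/sub_kermxP; rewrite horner_mx_XsubC_exp.
  have -> : w = v - u by rewrite vuw addrAC subrr add0r.
  rewrite mulmxBl exprD mulmxA vj mul0mx sub0r -exprD.
  rewrite mulmx_suml big1 ?oppr0 // => l /eqP la.
  by rewrite -scalemxAl -la Pk' ?scaler0 // leq_addl.
pose q := \prod_(z <- s | z != a) ('X - z%:P) ^+ N.
have w2 : (w <= kermxpoly M q)%MS.
  apply/sub_kermxP; rewrite mulmx_suml big1 // => l la.
  rewrite -scalemxAl /q (big_rem (rho l)) /=; last by rewrite mem_nth.
  by rewrite la rmorphM /= mulmxA horner_mx_XsubC_exp Pk mul0mx scaler0.
have w0 : w = 0.
  apply/eqP; rewrite -submx0 -(@mxdirect_kermxpoly _ _ M (('X - a%:P) ^+ (j + N)) q).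
    by rewrite sub_capmx w1 w2.
  rewrite coprimep_expl // (@big_morph _ _ (coprimep ('X - a%:P)) true andb) ?coprimep1 //; last first.
    by move=> x y; rewrite coprimepMr.
  rewrite big_all_cond; apply/allP => z _; apply/implyP => za.
  by rewrite coprimep_expr // coprimep_XsubC root_XsubC.
have : w *m invmx P = 0 by rewrite w0 mul0mx.
move=> /matrixP /(_ 0 k); rewrite [RHS]mxE /w mulmx_suml summxE.
rewrite (bigD1 k) //= big1 ?addr0 => [|l /andP[_ lk]].
  by rewrite -scalemxAl -row_mul mulmxV // !mxE eqxx mulr1.
by rewrite -scalemxAl -row_mul mulmxV // !mxE (negPf lk) mulr0.
Qed.
End RootBasis.

(** * Operators preserving a finite block of an orthonormal basis *)

Section Blocks.
Variables (R : realType) (H : lmodType R[i]).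
Variable dot : {dot H for @Num.conj R[i]}.
Local Notation C := R[i].
Local Notation nrm := (nrm dot).
Local Notation nrm2 := (nrm2 dot).
Local Notation bnd := (bnd dot).
Implicit Types x y : H.
Variables (I : eqType) (e : I -> H).
Hypothesis eo : orthonormal_family dot e.
Hypothesis et : forall x, (forall i, dot x (e i) = 0) -> x = 0.
Hypothesis cpl : hcomplete dot.

Lemma nrm_e i : nrm (e i) = 1.
Proof. by apply: (etrans (congr1 (fun z => Num.sqrt (complex.Re z)) (eo i i))); rewrite eqxx sqrtr1. Qed.

Lemma normc_coord x i : normc (dot x (e i)) <= nrm x.
Proof. by have := cauchy_schwarz dot x (e i); rewrite nrm_e mulr1. Qed.

Section Tuple.
Variables (n : nat) (s : n.+1.-tuple I).
Hypothesis us : uniq s.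

Definition vec (v : 'rV[C]_n.+1) : H := \sum_k v 0 k *: e (tnth s k).
Definition crd (x : H) : 'rV[C]_n.+1 := \row_k dot x (e (tnth s k)).
(** Row k holds the coordinates of the image of the k-th basis vector, so T acts on coordinate rows
    by multiplication from the right. *)
Definition blk (T : H -> H) : 'M[C]_n.+1 :=
  \matrix_(k, l) dot (T (e (tnth s k))) (e (tnth s l)).
Definition in_span (x : H) := forall m, m \notin s -> dot x (e m) = 0.

Lemma vecP a v w : vec (a *: v + w) = a *: vec v + vec w.
Proof.
rewrite /vec scaler_sumr -big_split; apply: eq_bigr => k _ /=.
by rewrite !mxE scalerDl scalerA.
Qed.

Lemma vec0 : vec 0 = 0.
Proof. by rewrite /vec big1 // => k _; rewrite mxE scale0r. Qed.

Lemma vecD v w : vec (v + w) = vec v + vec w.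
Proof. by have := vecP 1 v w; rewrite !scale1r. Qed.

Lemma vecZ a v : vec (a *: v) = a *: vec v.
Proof. by have := vecP a v 0; rewrite vec0 !addr0. Qed.

Lemma vecB v w : vec (v - w) = vec v - vec w.
Proof. by rewrite vecD -[- w]scaleN1r vecZ scaleN1r. Qed.

Lemma crdP a x y : crd (a *: x + y) = a *: crd x + crd y.
Proof. by apply/rowP => k; rewrite !mxE dotDl dotZl. Qed.

Lemma crd0 : crd 0 = 0.
Proof. by apply/rowP => k; rewrite !mxE dot0l. Qed.

Lemma crdZ a x : crd (a *: x) = a *: crd x.
Proof. by apply/rowP => k; rewrite !mxE dotZl. Qed.

Lemma crdB x y : crd (x - y) = crd x - crd y.
Proof. by apply/rowP => k; rewrite !mxE dotBl. Qed.

Lemma dot_vec v k : dot (vec v) (e (tnth s k)) = v 0 k.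
Proof.
rewrite /vec dot_suml (bigD1 k) //= big1 ?addr0 => [|l lk].
  by rewrite dotZl eo eqxx mulr1.
by rewrite dotZl eo (inj_eq ((tuple_uniqP s) us)) (negPf lk) mulr0.
Qed.

Lemma vec_in_span v : in_span (vec v).
Proof.
move=> m ms; rewrite /vec dot_suml big1 // => k _; rewrite dotZl eo.
by case: eqP => [E|_]; [rewrite -E mem_tnth in ms | rewrite mulr0].
Qed.

Lemma vecK v : crd (vec v) = v.
Proof. by apply/rowP => k; rewrite mxE dot_vec. Qed.

Lemma crdK x : in_span x -> vec (crd x) = x.
Proof.
move=> xs; apply: (coord_inj et) => i; have [/tnthP [k ->]|im] := boolP (i \in s).
  by rewrite dot_vec mxE.
by rewrite vec_in_span // xs.
Qed.

Lemma vec_eq0 v : vec v = 0 -> v = 0.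
Proof. by move=> h; rewrite -(vecK v) h crd0. Qed.

Lemma vec_blk (T : {linear H -> H}) v :
  (forall k, in_span (T (e (tnth s k)))) -> T (vec v) = vec (v *m blk T).
Proof.
move=> inv; apply: (coord_inj et) => i; rewrite linear_sum dot_suml.
have [/tnthP [l ->]|im] := boolP (i \in s).
  rewrite dot_vec mxE; apply: eq_bigr => k _.
  by rewrite linearZ /= dotZl mxE.
rewrite vec_in_span // big1 // => k _.
by rewrite linearZ /= dotZl inv // mulr0.
Qed.

Lemma nrm2_vec v : nrm2 (vec v) = \sum_k normc (v 0 k) ^+ 2.
Proof.
apply: complexI; rewrite -[LHS]dotxx {2}/vec dot_sumr.
rewrite (raddf_sum (real_complex R)); apply: eq_bigr => k _.
by rewrite dotZr dot_vec mulrC; exact: esym (sqr_normcE _).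
Qed.

Lemma vec_mul_bound (Q : 'M[C]_n.+1) : exists2 K : R, 0 <= K &
  forall (v : 'rV[C]_n.+1) (N : R), (forall k, normc (v 0 k) <= N) -> nrm (vec (v *m Q)) <= K * N.
Proof.
exists (\sum_k nrm (vec (row k Q))).
  by apply: sumr_ge0 => k _; exact: nrm_ge0.
move=> v N vN.
have -> : vec (v *m Q) = \sum_k v 0 k *: vec (row k Q).
  rewrite mulmx_sum_row.
  have VS : {morph vec : a b / a + b} by move=> a b; exact: vecD.
  by rewrite (big_morph _ VS vec0); apply: eq_bigr => k _; rewrite vecZ.
apply: le_trans (nrm_sum _ _ _ _) _; rewrite mulr_suml.
apply: ler_sum => k _; rewrite nrmZ mulrC ler_wpM2l ?nrm_ge0 //.
Qed.

Lemma normc_vec (v : 'rV[C]_n.+1) k : normc (v 0 k) <= nrm (vec v).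
Proof. by rewrite -dot_vec normc_coord. Qed.

Lemma vec_mul_bnd (Q : 'M[C]_n.+1) : exists2 K : R, 0 <= K &
  forall v : 'rV[C]_n.+1, nrm (vec (v *m Q)) <= K * nrm (vec v).
Proof.
have [K K0 hK] := vec_mul_bound Q; exists K => // v.
by apply: hK => k; exact: normc_vec.
Qed.

(* Acts as the matrix Q on the span of e over s and as the identity on its
   orthogonal complement. *)
Lemma matrix_op (Q : 'M[C]_n.+1) : exists2 U : {linear H -> H}, bnd U &
  forall x, U x = x + vec (crd x *m (Q - 1%:M)).
Proof.
have [|U UE] := @to_linear _ _ (fun x => x + vec (crd x *m (Q - 1%:M))).
  move=> a x y; rewrite crdP mulmxDl -scalemxAl vecP scalerDr.
  by rewrite addrACA.
exists U => //; have [K K0 hK] := vec_mul_bound (Q - 1%:M).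
exists (1 + K); first by rewrite addr_ge0.
move=> x; rewrite UE mulrDl mul1r; apply: le_trans (nrmD _ _ _) _.
rewrite lerD2l; apply: hK => k; rewrite mxE; exact: normc_coord.
Qed.

Lemma crd_matrix_op (Q : 'M[C]_n.+1) x : crd (x + vec (crd x *m (Q - 1%:M))) = crd x *m Q.
Proof.
have -> : x + vec (crd x *m (Q - 1%:M)) = 1 *: x + vec (crd x *m (Q - 1%:M)).
  by rewrite scale1r.
by rewrite crdP vecK scale1r mulmxBr mulmx1 addrC subrK.
Qed.

End Tuple.

(** A is similar, through S, to the direct sum of a matrix and a diagonal operator. The block is
    nonempty so that [root_basis_matrix] applies to it. *)
Definition block_diag (A : H -> H) (nu : I -> C) (n : nat) (s : n.+1.-tuple I)
    (S Sinv D : {linear H -> H}) :=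
  [/\ uniq s, [/\ bnd S, bnd Sinv & bnd D], cancel S Sinv /\ cancel Sinv S,
      forall x, A (S x) = S (D x) &
      (forall i, i \notin s -> D (e i) = nu i *: e i) /\
      (forall i, i \in s -> in_span s (D (e i)))].

Lemma seq_tuple (s : seq I) : (0 < size s)%N -> exists n (t : n.+1.-tuple I), s = t.
Proof. by case: s => [//|i s] _; exists (size s), (in_tuple (i :: s)). Qed.

(* The coupling l n between e n and the finite block is removed by solving the
   Sylvester equation z (nu n - M) = l n; enlarging the finite block keeps its
   solutions uniformly bounded by l n, hence square summable. *)
Lemma triangular_block_diag (T : {linear H -> H}) (nu : I -> C) n0 (s0 : n0.+1.-tuple I) :
  bnd T -> (forall x, T x = 0 -> x = 0) -> uniq s0 ->
  (forall x i, i \notin s0 -> dot (T x) (e i) = nu i * dot x (e i)) ->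
  (forall d : R, 0 < d -> exists t : seq I, forall i, i \notin t -> normc (nu i) <= d) ->
  exists n (s : n.+1.-tuple I) S Sinv D, {subset s0 <= s} /\ block_diag T nu s S Sinv D.
Proof.
move=> bT injT us0 hT hnu.
have inv0 i : in_span s0 (T (e i) - nu i *: e i).
  move=> m ms; rewrite dotBl dotZl hT // eo; case: eqP => [->|_].
    by rewrite subrr.
  by rewrite !mulr0 subrr.
have inv k : in_span s0 (T (e (tnth s0 k))).
  move=> m ms; rewrite hT // eo; case: eqP => [E|_]; last by rewrite mulr0.
  by rewrite -E mem_tnth in ms.
set M := blk s0 T.
(* T maps the finite span into itself and is injective there. *)
have Mu : M \in unitmx.
  rewrite -row_free_unit; apply: inj_row_free => v vM.
  by apply: (vec_eq0 us0); apply: injT; rewrite (vec_blk us0) // vM vec0.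
have [K K0 hK] := vec_mul_bnd us0 (invmx M).
(* For |nu_i| <= d the map v -> nu_i v M^-1 has norm at most 1/2; the remaining finitely many i join
   the block [s1]. *)
pose d := (2 * (K + 1))^-1.
have d0 : 0 < d by rewrite invr_gt0; lra.
have dK : d * K <= 2^-1.
  rewrite /d mulrC ler_pdivrMr; lra.
have [t ht] := hnu _ d0.
pose s1 := undup (s0 ++ t).
have us1 : uniq s1 by exact: undup_uniq.
have s01 : {subset s0 <= s1} by move=> i h; rewrite mem_undup mem_cat h.
have nus1 i : i \notin s1 -> i \notin s0 /\ normc (nu i) <= d.
  by rewrite mem_undup mem_cat negb_or => /andP[h1 h2]; split => //; exact: ht.
pose l i := crd s0 (T (e i) - nu i *: e i).
(* Inside the enlarged block nothing is decoupled, hence the value 0 there. *)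
pose z i := if i \in s1 then 0 else l i *m invmx ((nu i)%:M - M).
have small i v : normc (nu i) <= d ->
    nrm (vec s0 (nu i *: (v *m invmx M))) <= 2^-1 * nrm (vec s0 v).
  move=> nd; rewrite vecZ nrmZ.
  apply: le_trans (_ : d * (K * nrm (vec s0 v)) <= _).
    by apply: ler_pM; rewrite ?normc_ge0 ?nrm_ge0.
  by rewrite mulrA ler_wpM2r ?nrm_ge0.
have zE i : i \notin s1 -> nu i *: z i - z i *m M = l i.
  move=> is1; rewrite /z (negPf is1) -mul_mx_scalar -mulmxBr mulmxKV //.
  (* A kernel vector satisfies v = nu_i v M^-1, whose norm is at most half that of v. *)
  rewrite -row_free_unit; apply: inj_row_free => v.
  rewrite mulmxBr mul_mx_scalar => /eqP; rewrite subr_eq0 => /eqP h.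
  have := small i v (nus1 _ is1).2; rewrite scalemxAl h mulmxK // => h2.
  apply: (vec_eq0 us0); apply/eqP; rewrite -(nrm_eq0 dot).
  by have := nrm_ge0 dot (vec s0 v) => h3; apply/eqP; lra.
have zl i : i \notin s1 -> nrm (vec s0 (z i)) <= 2 * K * nrm (vec s0 (l i)).
  move=> is1; have : z i = nu i *: (z i *m invmx M) - l i *m invmx M.
    by rewrite -(zE _ is1) mulmxBl -scalemxAl mulmxK // opprB addrC subrK.
  move=> {1}->; have := small i (z i) (nus1 _ is1).2.
  have := hK (l i).
  have := nrmB dot (vec s0 (nu i *: (z i *m invmx M))) (vec s0 (l i *m invmx M)).
  rewrite -vecB.
  have -> : nu i *: (z i *m invmx M) - l i *m invmx M = z i.
    by rewrite -(zE _ is1) mulmxBl -scalemxAl mulmxK // opprB addrC subrK.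
  lra.
have [T' bT' TT'] := adjoint_ex eo cpl et bT.
(* Since |z_i| <= 2 K |l_i| and the coordinates of l_i are conjugates of <T' e_k, e_i>, Bessel
   applied to each T' e_k bounds the sum of all |z_i|^2. *)
pose q2 := 4 * K ^+ 2 * \sum_k nrm2 (T' (e (tnth s0 k))).
have q20 : 0 <= q2.
  by rewrite !mulr_ge0 ?sqr_ge0 // sumr_ge0 // => k _; exact: nrm2_ge0.
have zsum u : uniq u -> \sum_(i <- u) nrm2 (vec s0 (z i)) <= Num.sqrt q2 ^+ 2.
  move=> uu; rewrite sqr_sqrtr //.
  apply: le_trans (_ : \sum_(i <- u) 4 * K ^+ 2 *
     (\sum_k normc (dot (T' (e (tnth s0 k))) (e i)) ^+ 2) <= _).
    apply: ler_sum => i _.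
    have [is1|is1] := boolP (i \in s1).
      rewrite /z is1 vec0 nrm20 !mulr_ge0 ?sqr_ge0 // sumr_ge0 // => k _.
      exact: sqr_ge0.
    have -> : 4 * K ^+ 2 * \sum_k normc (dot (T' (e (tnth s0 k))) (e i)) ^+ 2 =
       (2 * K * nrm (vec s0 (l i))) ^+ 2.
      rewrite !exprMn sqr_nrm (nrm2_vec us0); congr (_ * _); first by ring.
      apply: eq_bigr => k _; rewrite /l mxE dotBl dotZl eo.
      have [is0 _] := nus1 _ is1.
      case: eqP => [E|_]; first by rewrite E mem_tnth in is0.
      by rewrite mulr0 subr0 TT' (dotC dot (e i)) normcJ.
    by rewrite -sqr_nrm ler_pXn2r ?nnegrE ?mulr_ge0 ?nrm_ge0 ?zl.
  rewrite -mulr_sumr ler_wpM2l ?mulr_ge0 ?sqr_ge0 // exchange_big /=.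
  by apply: ler_sum => k _; exact: bessel.
(* [perturb_op] prescribes coordinates rather than images, so the operator sending e_i to z_i is
   obtained as an adjoint. *)
have [Zs [ZsE ZsM]] := perturb_op eo cpl et (sqrtr_ge0 q2) zsum.
have bZs : bnd Zs by exists (Num.sqrt q2); rewrite ?sqrtr_ge0.
have [Z bZ ZZs] := adjoint_ex eo cpl et bZs.
have Ze i : Z (e i) = vec s0 (z i).
  apply: (coord_inj et) => j.
  by rewrite dotC -ZZs ZsE -dotC.
have Z0 i : i \in s1 -> Z (e i) = 0 by move=> h; rewrite Ze /z h vec0.
have Zv v : Z (vec s0 v) = 0.
  rewrite linear_sum big1 // => k _; rewrite linearZ /= Z0 ?scaler0 //.
  by apply: s01; exact: mem_tnth.
(* Z takes values in the span over [s0] and vanishes on that span; therefore 1 - Z is the inverse of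
   1 + Z. *)
have ZZ x : Z (Z x) = 0.
  have [|W WE] := @to_linear _ _ (fun x => Z (Z x)).
    by move=> a y w; rewrite !linearP.
  have [|W0 W0E] := @to_linear _ _ (fun _ : H => 0 : H).
    by move=> a y w; rewrite scaler0 addr0.
  rewrite -(WE x) -(W0E x); apply: (bnd_linear_ext eo cpl et) => [||i].
  - by have [m m0 hm] := bnd_comp bZ bZ; exists m => // y; rewrite WE.
  - by exists 0 => // y; rewrite W0E nrm0 mul0r.
  - by rewrite WE W0E Ze Zv.
have [|S SE] := @to_linear _ _ (fun x => x + Z x).
  by move=> a x y; rewrite linearP scalerDr addrACA.
have [|Sv SvE] := @to_linear _ _ (fun x => x - Z x).
  by move=> a x y; rewrite linearP opprD scalerBr addrACA.
have bS : bnd S by have [m m0 hm] := bndD (bnd_id dot) bZ; exists m => // y; rewrite SE.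
have bSv : bnd Sv by have [m m0 hm] := bndD (bnd_id dot) (bndN bZ); exists m => // y; rewrite SvE.
have SK : cancel S Sv.
  by move=> x; rewrite SvE SE linearD ZZ addr0 addrK.
have SvK : cancel Sv S.
  by move=> x; rewrite SE SvE linearB /= ZZ subr0 subrK.
pose D : {linear H -> H} := (Sv \o (T \o S))%FUN.
have DE x : D x = Sv (T (S x)) by [].
have [|n [s sE]] := @seq_tuple s1.
  by rewrite lt0n size_eq0; apply/eqP => h; have := s01 _ (mem_tnth 0 s0); rewrite h.
have us : uniq s by rewrite -sE.
have ms i : (i \in s) = (i \in s1) by rewrite sE.
exists n, s, S, Sv, D; split=> [i|]; first by rewrite ms; exact: s01.
split=> //.
- by split=> //; exact: bnd_comp bSv (bnd_comp bT bS).
- by move=> x; rewrite DE SvK.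
split=> i; rewrite ms => is1.
  (* T (e_i + z_i) = nu_i e_i + l_i + z_i M, and the Sylvester equation turns l_i + z_i M into nu_i
     z_i. *)
  rewrite DE; suff -> : T (S (e i)) = S (nu i *: e i) by rewrite SK.
  rewrite linearZ /= SE Ze linearD (vec_blk us0) // scalerDr.
  have -> : T (e i) = nu i *: e i + vec s0 (l i).
    by rewrite /l (crdK us0) // addrC subrK.
  by rewrite -(zE _ is1) vecB vecZ -addrA subrK.
move=> m; rewrite ms => mns.
rewrite DE SE Z0 // addr0 SvE dotBl.
have ms0 := (nus1 _ mns).1.
have -> : Z (T (e i)) = 0.
  have -> : T (e i) = vec s0 (l i) + nu i *: e i.
    by rewrite /l (crdK us0) // subrK.
  by rewrite linearD Zv linearZ /= Z0 // scaler0 addr0.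
rewrite dot0l subr0 hT // eo; case: eqP => [E|_]; last by rewrite mulr0.
by rewrite -E is1 in mns.
Qed.

Lemma block_diag_similar (A T : {linear H -> H}) (X Y : {linear H -> H}) nu n (s : n.+1.-tuple I) S Sinv D :
  bnd X -> bnd Y -> cancel X Y -> cancel Y X -> (forall x, X (A x) = T (X x)) ->
  block_diag T nu s S Sinv D -> exists S1 Sinv1, block_diag A nu s S1 Sinv1 D.
Proof.
move=> bX bY XK YK AT [us [bS bSv bD] [SK SvK] TS hD].
exists (Y \o S)%FUN, (Sinv \o X)%FUN; split=> //.
- by split=> //; exact: bnd_comp.
- by split=> x /=; rewrite ?YK ?SK ?SvK ?XK.
- by move=> x /=; rewrite -TS -[in RHS](YK (S x)) -AT XK.
Qed.

(** Taking adjoints in A S = S D gives A^* Sinv^* = Sinv^* D^*, so Sinv^* takes over the role of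
    S. *)
Lemma block_diag_adjoint (A A' : {linear H -> H}) nu n (s : n.+1.-tuple I) S Sinv D :
  (forall x y, dot (A x) y = dot x (A' y)) -> block_diag A nu s S Sinv D ->
  exists S1 Sinv1 D1, block_diag A' (fun i => (nu i)^*) s S1 Sinv1 D1 /\
    (forall x y, dot (D x) y = dot x (D1 y)).
Proof.
move=> AA' [us [bS bSv bD] [SK SvK] AS [hD hDs]].
have [S' bS' SS'] := adjoint_ex eo cpl et bS.
have [Sv' bSv' SSv'] := adjoint_ex eo cpl et bSv.
have [D' bD' DD'] := adjoint_ex eo cpl et bD.
have ext x y : (forall z, dot z x = dot z y) -> x = y.
  by move=> h; apply: (coord_inj et) => i; rewrite dotC h -dotC.
exists Sv', S', D'; split=> //; split=> //.
- split=> x; apply: ext => w.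
    by rewrite -SS' -SSv' SK.
  by rewrite -SSv' -SS' SvK.
- move=> x; apply: ext => w.
  by rewrite -AA' -!SSv' -DD' -[w in LHS]SvK AS SK.
have D'e i j : dot (D' (e i)) (e j) = dot (e i) (D (e j)).
  by rewrite dotC -DD' -dotC.
split=> i is1.
  apply: (coord_inj et) => j; rewrite D'e dotZl.
  have [js|js] := boolP (j \in s).
    rewrite dotC hDs // conjC0 eo; case: eqP => [E|_]; last by rewrite mulr0.
    by rewrite E js in is1.
  by rewrite hD // dotZr eo; case: eqP => [->//|_]; rewrite !mulr0.
move=> m ms; rewrite D'e hD // dotZr eo; case: eqP => [E|_]; last by rewrite mulr0.
by rewrite -E is1 in ms.
Qed.

Lemma block_diag_inj (A : H -> H) nu n (s : n.+1.-tuple I) S Sinv (D : {linear H -> H}) :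
  block_diag A nu s S Sinv D -> (forall x, A x = 0 -> x = 0) -> forall x, D x = 0 -> x = 0.
Proof.
move=> [_ _ [SK _] AS _] iA x Dx; rewrite -(SK x) (iA (S x)) ?linear0 //.
by rewrite AS Dx linear0.
Qed.

Lemma block_unit (D : {linear H -> H}) n (s : n.+1.-tuple I) : uniq s ->
  (forall x, D x = 0 -> x = 0) -> (forall k, in_span s (D (e (tnth s k)))) ->
  blk s D \in unitmx.
Proof.
move=> us iD inv; rewrite -row_free_unit; apply: inj_row_free => v vM.
by apply: (vec_eq0 us); apply: iD; rewrite (vec_blk us) // vM vec0.
Qed.

(** Injectivity does not pass to adjoints in general. Here D has an invertible matrix block and
    nonzero diagonal entries, so its range contains every e_i, and nothing but 0 is orthogonal to
    the range of A. *)
Lemma block_diag_adjoint_inj (A A' : {linear H -> H}) nu n (s : n.+1.-tuple I) S Sinv D :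
  (forall x y, dot (A x) y = dot x (A' y)) -> block_diag A nu s S Sinv D ->
  (forall x, A x = 0 -> x = 0) -> forall x, A' x = 0 -> x = 0.
Proof.
move=> AA' bd iA x A'x; have [us [bS bSv bD] [SK SvK] AS [hD hDs]] := bd.
have iD := block_diag_inj bd iA.
have h w : dot (S (D w)) x = 0 by rewrite -AS AA' A'x dot0r.
have [S' bS' SS'] := adjoint_ex eo cpl et bS.
have S'x : S' x = 0.
  apply: et => i; have hE w : dot (D w) (S' x) = 0 by rewrite -SS'.
  have [/tnthP [k ->]|im] := boolP (i \in s).
    have inv l : in_span s (D (e (tnth s l))) by apply: hDs; exact: mem_tnth.
    (* The argument is the preimage of the k-th block vector under D. *)
    have := hE (vec s (delta_mx 0 k *m invmx (blk s D))).
    rewrite (vec_blk us) // mulmxKV ?block_unit //.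
    have -> : vec s (delta_mx 0 k) = e (tnth s k).
      rewrite /vec (bigD1 k) //= big1 ?addr0 => [|l lk].
        by rewrite mxE !eqxx scale1r.
      by rewrite mxE (negPf lk) andbF scale0r.
    by rewrite dotC => /(congr1 Num.conj); rewrite conjCK conjC0.
  have := hE (e i); rewrite hD // dotZl => /eqP; rewrite mulf_eq0 => /orP[/eqP n0|].
    have := iD (e i); rewrite hD // n0 scale0r => /(_ erefl) ei0.
    by rewrite ei0 dot0r.
  by move=> /eqP hh; rewrite dotC hh conjC0.
apply: et => i; rewrite dotC -(SvK (e i)) SS' S'x dot0r conjC0 //.
Qed.

End Blocks.

(** * Root vectors of an operator read off from its resolvent *)

Section RootVectors.
Variables (R : realType) (H : lmodType R[i]).
Variable dot : {dot H for @Num.conj R[i]}.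
Local Notation C := R[i].
Local Notation bnd := (bnd dot).
Implicit Types x y : H.

(** If A is the resolvent of P at z, then 1 - (w - z) A equals A (P - w) on the domain of P; so with
    k = w - z this stands for P - w up to an injective factor. *)
Definition resid (T : H -> H) (k : C) (x : H) := x - k *: T x.

Lemma resid_linear (T : {linear H -> H}) k a x y :
  resid T k (a *: x + y) = a *: resid T k x + resid T k y.
Proof.
rewrite /resid linearP scalerDr opprD addrACA scalerBr.
by rewrite scalerA mulrC -scalerA.
Qed.

Lemma iter_resid_linear (T : {linear H -> H}) k j a x y :
  iter j (resid T k) (a *: x + y) = a *: iter j (resid T k) x + iter j (resid T k) y.
Proof. by elim: j => //= j ->; rewrite resid_linear. Qed.

Lemma iter_resid0 (T : {linear H -> H}) k j : iter j (resid T k) 0 = 0.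
Proof.
by elim: j => //= j ->; rewrite /resid linear0 scaler0 subrr.
Qed.

Lemma iter_resid_comm (T : {linear H -> H}) k j x :
  iter j (resid T k) (T x) = T (iter j (resid T k) x).
Proof. by elim: j => //= j ->; rewrite /resid (linearB T) /= (linearZ_LR T). Qed.

Lemma iter_resid_le (T : {linear H -> H}) k j l x : (j <= l)%N ->
  iter j (resid T k) x = 0 -> iter l (resid T k) x = 0.
Proof.
by move=> jl h; rewrite -(subnK jl) iterD h iter_resid0.
Qed.

Section Graph.
Variables (O : operator H) (A : {linear H -> H}) (z : C).
Hypothesis hO : forall f k, O f k <-> f = A (k - z *: f).
Hypothesis iA : forall x, A x = 0 -> x = 0.

Lemma inj_lin x y : A x = A y -> x = y.
Proof.
by move=> h; apply/eqP; rewrite -subr_eq0; apply/eqP/iA; rewrite linearB /= h subrr.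
Qed.

Lemma graph_eq f h w : O f (h + w *: f) <-> resid A (w - z) f = A h.
Proof.
rewrite hO /resid -addrA -scalerBl linearD linearZ /=; split=> [{1}->|<-].
  by rewrite addrK.
by rewrite subrK.
Qed.

(** A commutes with 1 - (w - z) A and is injective, so the factor A produced by each application of
    P - w can be cancelled. *)
Lemma shift_iterE w j f : shift_iter O w j f 0 <-> iter j (resid A (w - z)) f = 0.
Proof.
elim: j f => [//|j IH] f; rewrite iterSr; split.
  by move=> [h /graph_eq -> /IH h0]; rewrite iter_resid_comm h0 linear0.
move=> h0.
(* Domain membership has to be produced: a power of 1 - (w - z) A is the identity minus something in
   the range of A, so a vector killed by it lies in that range. *)
have [g gE] : exists g, resid A (w - z) f = A g.
  have [g gE] : exists g, iter j (resid A (w - z)) (resid A (w - z) f) = resid A (w - z) f - A g.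
    elim: j {h0 IH} => [|j [g gE]] /=; first by exists 0; rewrite linear0 subr0.
    exists (g + (w - z) *: (resid A (w - z) f - A g)).
    by rewrite gE {1}/resid -addrA -opprD linearD linearZ /=.
  by exists g; apply/eqP; rewrite -subr_eq0 -gE h0.
exists g; first by apply/graph_eq.
by apply/IH/inj_lin; rewrite linear0 -iter_resid_comm -gE.
Qed.

Lemma eigenvalue_neq w : is_eigenvalue O w -> w != z.
Proof.
move=> [f f0 /hO]; rewrite -scalerBl; apply: contra_eq_neq => ->.
by rewrite subrr scale0r linear0.
Qed.

Variables (I : eqType) (e : I -> H).
Hypothesis eo : orthonormal_family dot e.
Hypothesis et : forall x, (forall i, dot x (e i) = 0) -> x = 0.
Hypothesis cpl : hcomplete dot.
Variables (nu : I -> C) (n : nat) (s : n.+1.-tuple I) (S Sinv D : {linear H -> H}).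
Hypothesis bd : block_diag dot e A nu s S Sinv D.
Hypothesis nu_inj : forall i j, i \notin s -> j \notin s -> nu i = nu j -> i = j.

(** The action of D is given on basis vectors only; the bounded adjoint carries it over to the
    coordinates of an arbitrary x. *)
Lemma block_diag_coord i x : i \notin s -> dot (D x) (e i) = nu i * dot x (e i).
Proof.
move=> is1; have [us [_ _ bD] _ _ [hD hDs]] := bd.
have [D' bD' DD'] := adjoint_ex eo cpl et bD.
rewrite DD'; suff -> : D' (e i) = (nu i)^* *: e i by rewrite dotZr conjCK.
apply: (coord_inj et) => j; rewrite dotC -DD' -dotC dotZl.
have [js|js] := boolP (j \in s).
  rewrite dotC hDs // conjC0 eo; case: eqP => [E|_]; last by rewrite mulr0.
  by rewrite E js in is1.
by rewrite hD // dotZr eo; case: eqP => [->//|_]; rewrite !mulr0.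
Qed.

Lemma block_diag_crd x : crd dot e s (D x) = crd dot e s x *m blk dot e s D.
Proof.
have [us [_ _ bD] _ _ [hD hDs]] := bd.
have inv k : in_span dot e s (D (e (tnth s k))) by apply: hDs; exact: mem_tnth.
have [D' bD' DD'] := adjoint_ex eo cpl et bD.
rewrite -[RHS](vecK eo us) -(vec_blk eo et us) //.
apply/eqP; rewrite -subr_eq0 -crdB -linearB /=; set y := x - _.
have ys k : dot y (e (tnth s k)) = 0 by rewrite dotBl dot_vec // mxE subrr.
apply/eqP/rowP => k; rewrite !mxE DD'.
suff -> : D' (e (tnth s k)) = vec e s (crd dot e s (D' (e (tnth s k)))).
  rewrite /vec dot_sumr big1 // => l _; by rewrite dotZr ys mulr0.
rewrite crdK // => m ms.
rewrite dotC -DD' -dotC hD // dotZr eo; case: eqP => [E|_]; last by rewrite mulr0.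
by rewrite -E mem_tnth in ms.
Qed.

Lemma block_diag_iter_coord i k j x : i \notin s ->
  dot (iter j (resid D k) x) (e i) = (1 - k * nu i) ^+ j * dot x (e i).
Proof.
move=> is1; elim: j => [|j IH] /=; first by rewrite expr0 mul1r.
rewrite /resid dotBl dotZl block_diag_coord // IH exprS; ring.
Qed.

Lemma block_diag_iter_crd k j x :
  crd dot e s (iter j (resid D k) x) = crd dot e s x *m (1%:M - k *: blk dot e s D) ^+ j.
Proof.
elim: j => [|j IH] /=; first by rewrite expr0 mulmx1.
rewrite /resid crdB crdZ block_diag_crd IH exprSr mulmxA.
by rewrite mulmxBr mulmx1 -scalemxAr.
Qed.

Lemma root_space_in_seq (f : I -> H) (L : seq I) (a : I -> C) w :
  {in L, forall i, root_space O w (f i)} -> root_space O w (\sum_(i <- L) a i *: f i).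
Proof.
elim: L => [|i L IH] h; first by rewrite big_nil; exists 0%N.
have [|j /shift_iterE hj] := IH.
  by move=> l lL; apply: h; rewrite in_cons lL orbT.
have [|l /shift_iterE hl] := h i; first exact: mem_head.
exists (maxn l j); apply/shift_iterE; rewrite big_cons iter_resid_linear.
rewrite (iter_resid_le (leq_maxl _ _) hl) (iter_resid_le (leq_maxr _ _) hj).
by rewrite scaler0 addr0.
Qed.

(** The family is S U e_i, where U changes the basis inside the block to generalized eigenvectors;
    it is a Riesz basis because S U is an isomorphism. An eigenvalue mu of A corresponds to the
    eigenvalue z + 1/mu of O. *)
Theorem block_diag_root_riesz_basis :
  exists f : I -> H, root_vector_family O f /\ riesz_basis dot f.
Proof.
have [us [bS bSv bD] [SK SvK] AS [hD hDs]] := bd.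
have iD := block_diag_inj bd iA.
have inv k : in_span dot e s (D (e (tnth s k))) by apply: hDs; exact: mem_tnth.
set M := blk dot e s D.
have [P [rho [Pu Prho Pgen]]] := root_basis_matrix M.
have [U bU UE] := matrix_op eo s P.
have [V bV VE] := matrix_op eo s (invmx P).
have crdU x : crd dot e s (U x) = crd dot e s x *m P by rewrite UE crd_matrix_op.
have crdV x : crd dot e s (V x) = crd dot e s x *m invmx P by rewrite VE crd_matrix_op.
have UK : cancel U V.
  move=> x; rewrite VE crdU UE -addrA -vecD -!mulmxA -mulmxDr mulmxBr mulmxV // mulmx1.
  by rewrite [_ - _ + _]addrA subrK subrr mulmx0 vec0 addr0.
have VK : cancel V U.
  move=> x; rewrite UE crdV VE -addrA -vecD -!mulmxA -mulmxDr mulmxBr mulVmx // mulmx1.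
  by rewrite [_ - _ + _]addrA subrK subrr mulmx0 vec0 addr0.
have Unot x i : i \notin s -> dot (U x) (e i) = dot x (e i).
  by move=> is1; rewrite UE dotDl (vec_in_span eo) // addr0.
have Vnot x i : i \notin s -> dot (V x) (e i) = dot x (e i).
  by move=> is1; rewrite VE dotDl (vec_in_span eo) // addr0.
have Ue i : i \notin s -> U (e i) = e i.
  move=> is1; rewrite UE; suff -> : crd dot e s (e i) = 0 by rewrite mul0mx vec0 addr0.
  apply/rowP => k; rewrite !mxE eo; case: eqP => // E.
  by rewrite E mem_tnth in is1.
have crde k : crd dot e s (e (tnth s k)) = delta_mx 0 k.
  apply/rowP => l; rewrite !mxE eo eqxx /= eq_sym.
  by rewrite (inj_eq ((tuple_uniqP s) us)).
have Us k : U (e (tnth s k)) = vec e s (row k P).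
  rewrite -(crdK eo et us (x := U _)); last first.
    move=> m ms; rewrite Unot // eo; case: eqP => // E.
    by rewrite -E mem_tnth in ms.
  by rewrite crdU crde -rowE.
(* Meaningful for i in [s] only; elsewhere [inord] returns a default. *)
pose pos i : 'I_n.+1 := inord (index i s).
have posK i : i \in s -> tnth s (pos i) = i.
  move=> si; rewrite (tnth_nth i) inordK ?nth_index //.
  by have := si; rewrite -index_mem size_tuple.
pose f i := S (U (e i)).
pose mu i := if i \in s then rho (pos i) else nu i.
pose lam i := z + (mu i)^-1.
have iterS k j y : iter j (resid A k) (S y) = S (iter j (resid D k) y).
  by elim: j => //= j ->; rewrite /resid AS (linearB S) /= (linearZ_LR S).
(* The last nonzero vector among row k P times the powers of M - rho k is an honest eigenvector. *)
have Meig k : exists2 v : 'rV_n.+1, v != 0 & v *m M = rho k *: v.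
  have [j jP] := Prho k.
  have Pk0 : row k P != 0.
    apply: contraL Pu => /eqP h; rewrite -row_free_unit; apply/negP => /row_freeP [Q PQ].
    have : row k (P *m Q) = 0 by rewrite row_mul h mul0mx.
    rewrite PQ => /matrixP /(_ 0 k); rewrite !mxE eqxx => /eqP.
    by rewrite oner_eq0.
  elim: j (row k P) Pk0 jP => [|j IH] v v0; first by rewrite expr0 mulmx1 => h; rewrite h eqxx in v0.
  rewrite exprS mulmxA; have [h _|h] := eqVneq (v *m (M - (rho k)%:M)) 0; last exact: IH.
  exists v => //; move/eqP: h; rewrite mulmxBr mul_mx_scalar subr_eq0 => /eqP //.
have eig i : exists2 g, g != 0 & A g = mu i *: g.
  rewrite /mu; case: ifPn => is1.
    have [v v0 vM] := Meig (pos i).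
    exists (S (vec e s v)); last by rewrite AS (vec_blk eo et us) // vM vecZ linearZ.
    apply: contra v0 => /eqP h; apply/eqP/(vec_eq0 eo us).
    by rewrite -(SK (vec e s v)) h linear0.
  exists (S (e i)); last by rewrite AS hD // linearZ.
  apply/eqP => h; have := SK (e i); rewrite h linear0 => e0.
  have := eo i i; rewrite -e0 dot0l eqxx => /eqP.
  by rewrite eq_sym oner_eq0.
have mu0 i : mu i != 0.
  have [g g0 gE] := eig i; apply: contraNneq g0 => h.
  by apply/eqP/iA; rewrite gE h scale0r.
have lamE i w : lam i = w -> mu i = (w - z)^-1.
  by move=> <-; rewrite /lam addrC addKr invrK.
have root_f i : root_space O (lam i) (f i).
  rewrite /root_space /=; set k := lam i - z.
  have kE : k = (mu i)^-1 by rewrite /k /lam addrC addKr.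
  have k0 : k != 0 by rewrite kE invr_eq0.
  have [is1|is1] := boolP (i \in s); last first.
    exists 1%N; apply/shift_iterE; rewrite -/k iterS /= /resid Ue // hD //.
    have -> : nu i = mu i by rewrite /mu (negPf is1).
    by rewrite scalerA kE mulVf // scale1r subrr linear0.
  have [j jP] := Prho (pos i); exists j; apply/shift_iterE.
  rewrite -/k iterS -(posK _ is1) Us.
  set v := row _ P in jP *.
  have -> : iter j (resid D k) (vec e s v) = vec e s (v *m (1%:M - k *: M) ^+ j).
    elim: (j) => [|j' /= ->]; first by rewrite expr0 mulmx1.
    rewrite /resid (vec_blk eo et us) // -vecZ -vecB exprSr mulmxA.
    by rewrite mulmxBr mulmx1 -scalemxAr.
  have -> : 1%:M - k *: M = (- k) *: (M - (rho (pos i))%:M).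
    rewrite scaleNr -scalerN opprB scalerBr scale_scalar_mx kE /mu is1.
    by rewrite mulVf //; have := mu0 i; rewrite /mu is1.
  by rewrite exprZn -scalemxAr jP scaler0 vec0 linear0.
exists f; split; last first.
  exists (S \o U)%FUN, (V \o Sinv)%FUN, e; split=> //.
  - by apply: bnd_bounded_op; exact: bnd_comp.
  - by apply: bnd_bounded_op; exact: bnd_comp.
  - by split=> x /=; rewrite ?SK ?UK ?VK ?SvK.
  - exact: orthonormal_basis_coord.
exists lam; split=> [i|w ew].
  have [g g0 gE] := eig i; exists g => //; apply/hO.
  by rewrite -scalerBl linearZ /= gE scalerA /lam addrC addKr mulVf // scale1r.
have wz := eigenvalue_neq ew.
have k0 : w - z != 0 by rewrite subr_eq0.
split=> [L a uL LJ|].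
  have -> : \sum_(i <- L) a i *: f i = S (U (\sum_(i <- L) a i *: e i)).
    by rewrite !linear_sum; apply: eq_bigr => i _; rewrite !linearZ.
  move=> h; have {h} h : \sum_(i <- L) a i *: e i = 0.
    by rewrite -[LHS]UK -[U _]SK h !linear0.
  move=> i iL; have := dot_comb eo a i uL; rewrite h dot0l iL => <- //.
apply/seteqP; split=> [x [j /shift_iterE xj]|x [L [a [LJ ->]]]]; last first.
  apply: root_space_in_seq => i iL; have := root_f i.
  by have /= -> := LJ _ iL.
set k := w - z in k0 xj.
pose y := Sinv x.
have xS : x = S y by rewrite SvK.
have yj : iter j (resid D k) y = 0.
  by rewrite -[LHS]SK -iterS -xS xj linear0.
(* The i-th coordinate is multiplied by (1 - k nu_i)^j, which is nonzero for these i. *)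
have ynot i : i \notin s -> nu i != k^-1 -> dot y (e i) = 0.
  move=> is1 nk; have := block_diag_iter_coord k j y is1.
  rewrite yj dot0l => /esym/eqP; rewrite mulf_eq0 expf_eq0 => /orP[/andP[_]|/eqP //].
  rewrite subr_eq0 => /eqP h; case/eqP: nk.
  by rewrite -[nu i](mulKf k0) -h mulr1.
have ycrd : crd dot e s y *m (M - k^-1%:M) ^+ j = 0.
  have := block_diag_iter_crd k j y; rewrite yj crd0.
  have -> : 1%:M - k *: M = (- k) *: (M - (k^-1)%:M).
    by rewrite scaleNr -scalerN opprB scalerBr scale_scalar_mx divff.
  rewrite exprZn -scalemxAr => /esym/eqP; rewrite scalemx_eq0 expf_eq0 oppr_eq0 (negPf k0) andbF /=.
  by move/eqP.
pose u := V y.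
have u0 i : mu i != k^-1 -> dot u (e i) = 0.
  rewrite /mu; case: ifPn => is1 h; last by rewrite Vnot // ynot.
  have := Pgen _ _ _ ycrd _ h; rewrite -crdV mxE posK //.
(* The span consists of finite combinations, so the indices with mu_i = 1/k must form a finite set:
   finitely many in the block and, by [nu_inj], at most one outside. *)
have [L LJ uL] : exists2 L : seq I, ([set` L] `<=` [set i | lam i = w])%classic &
    uniq L /\ forall i, mu i = k^-1 -> i \in L.
  have lamk i : mu i = k^-1 -> lam i = w.
    by move=> h; rewrite /lam h invrK /k addrC subrK.
  pose L1 := [seq i <- s | mu i == k^-1].
  have uL1 : uniq L1 by rewrite filter_uniq.
  have [[i0 [is0 ik]]|no] := pselect (exists i, i \notin s /\ nu i = k^-1).
    exists (i0 :: L1).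
      move=> i; rewrite /= in_cons => /orP[/eqP ->|].
        by apply: lamk; rewrite /mu (negPf is0).
      by rewrite mem_filter => /andP[/eqP h _]; exact: lamk.
    split=> [|i ih] /=; first by rewrite uL1 andbT mem_filter (negPf is0) andbF.
    rewrite in_cons mem_filter ih eqxx /=; have [|is1] := boolP (i \in s); first by rewrite orbT.
    rewrite orbF; apply/eqP/nu_inj => //; rewrite ik -ih /mu (negPf is1) //.
  exists L1.
    by move=> i /=; rewrite mem_filter => /andP[/eqP h _]; exact: lamk.
  split=> // i ih; rewrite mem_filter ih eqxx /=; have [//|is1] := boolP (i \in s).
  by case: no; exists i; split=> //; rewrite -ih /mu (negPf is1).
exists L, (fun i => dot u (e i)); split=> //.
have uE : u = \sum_(i <- L) dot u (e i) *: e i.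
  apply: (coord_inj et) => i; rewrite (dot_comb eo _ _ uL.1).
  by case: ifPn => // iL; apply: u0; apply: contra iL => /eqP; exact: uL.2.
rewrite xS -(VK y) -/u {1}uE !linear_sum; apply: eq_bigr => i _.
by rewrite !linearZ.
Qed.

End Graph.
End RootVectors.

(** * Eigenvectors of the adjoint that are quadratically close to an orthonormal basis *)

Section Perturbation.
Variables (R : realType) (H : lmodType R[i]).
Variable dot : {dot H for @Num.conj R[i]}.
Local Notation C := R[i].
Variables (I : eqType) (i0 : I) (e : I -> H).
Hypothesis eo : orthonormal_family dot e.
Hypothesis et : forall x, (forall i, dot x (e i) = 0) -> x = 0.
Hypothesis cpl : hcomplete dot.

(** The pairs (A w, w + z A w) exhaust the graph of O; testing the defining identity on them shows
    that A' is the resolvent of the adjoint at the conjugate of z. *)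
Lemma adjoint_graph (O : operator H) (A A' : {linear H -> H}) (z : C) :
  (forall f k, O f k <-> f = A (k - z *: f)) ->
  (forall x y, dot (A x) y = dot x (A' y)) ->
  forall g h, adjoint dot O g h <-> g = A' (h - z^* *: g).
Proof.
move=> hO AA' g h; have ext x y : (forall w, dot w x = dot w y) -> x = y.
  by move=> hh; apply: (coord_inj et) => i; rewrite dotC hh -dotC.
split=> [adj|gE].
  apply: ext => w; rewrite -AA' dotBr dotZr conjCK.
  have /adj <- : O (A w) (w + z *: A w) by apply/hO; rewrite addrK.
  by rewrite dotDl dotZl addrK.
move=> f k /hO fE; set w := k - z *: f in fE.
have -> : k = w + z *: f by rewrite subrK.
by rewrite dotDl dotZl {1}gE -AA' -fE dotBr dotZr conjCK subrK.
Qed.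

(** The bound 4^-1 on the total squared distance makes the perturbation E of norm at most 2^-1,
    within reach of [neumann]. *)
Theorem perturbed_root_riesz_basis (O : operator H) (A : {linear H -> H}) (z : C)
    (s0 : seq I) (g : I -> H) (nu : I -> C) :
  bnd dot A -> (forall x, A x = 0 -> x = 0) ->
  (forall f k, O f k <-> f = A (k - z *: f)) ->
  (forall x i, i \notin s0 -> dot (A x) (g i) = nu i * dot x (g i)) ->
  (forall s, uniq s -> (forall i, i \in s -> i \notin s0) ->
     \sum_(i <- s) nrm2 dot (g i - e i) <= 4^-1) ->
  (forall d : R, 0 < d -> exists t : seq I, forall i, i \notin t -> normc (nu i) <= d) ->
  (forall i j, i \notin s0 -> j \notin s0 -> nu i = nu j -> i = j) ->
  (exists f : I -> H, root_vector_family O f /\ riesz_basis dot f) /\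
  (exists f : I -> H, root_vector_family (adjoint dot O) f /\ riesz_basis dot f).
Proof.
move=> bA iA hO hg gsum nu0 nu_inj.
(* With p_i = 0 the map X fixes the coordinates in [s0], where nothing is known about g_i. *)
pose p i := if i \in s0 then 0 else g i - e i.
have [||E [EE EM]] := @perturb_op _ _ dot _ e eo cpl et p 2^-1.
- by rewrite invr_ge0.
- move=> s us; rewrite (bigID (mem s0)) /= big1 ?add0r => [|i is0]; last first.
    by rewrite /p is0 nrm20.
  have -> : (2^-1 : R) ^+ 2 = 4^-1 by field.
  rewrite -big_filter big_seq.
  have := gsum [seq i <- s | i \notin s0] (filter_uniq _ us).
  rewrite big_seq => h; apply: le_trans (h _) => [|i]; last by rewrite mem_filter => /andP[].
  rewrite le_eqVlt; apply/orP; left; apply/eqP; apply: eq_bigr => i.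
  by rewrite mem_filter /p => /andP[/negPf ->].
have [||Y [bY YK KY]] := @neumann _ _ dot cpl E 2^-1 _ _ EM.
- by rewrite invr_ge0.
- by rewrite invf_lt1 ?ltr1n.
have [|X XE] := @to_linear _ _ (fun x => x + E x).
  by move=> a x y; rewrite linearP scalerDr addrACA.
have XK : cancel X Y by move=> x; rewrite XE YK.
have YX : cancel Y X by move=> x; rewrite XE KY.
have bX : bnd dot X.
  have bE : bnd dot E by exists 2^-1; rewrite ?invr_ge0.
  by have [m m0 hm] := bndD (bnd_id dot) bE; exists m => // x; rewrite XE.
pose T : {linear H -> H} := (X \o (A \o Y))%FUN.
have TE x : T x = X (A (Y x)) by [].
have bT : bnd dot T by apply: bnd_comp bX (bnd_comp bA bY).
have iT x : T x = 0 -> x = 0.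
  move=> h; rewrite -(YX x) (iA (Y x)) ?linear0 //.
  by rewrite -(XK (A _)) -TE h linear0.
have Xg x i : i \notin s0 -> dot (X x) (e i) = dot x (g i).
  by move=> is0; rewrite XE dotDl EE /p (negPf is0) dotBr addrC subrK.
(* The index [i0] guarantees a nonempty block. *)
pose s0' := undup (i0 :: s0).
have [|n0 [s1 s1E]] := @seq_tuple _ s0'.
  by rewrite lt0n size_eq0; apply/eqP => h; have := mem_undup (i0 :: s0) i0; rewrite -/s0' h mem_head.
have s1s0 i : i \notin s1 -> i \notin s0.
  by apply: contra => h; change (i \in (s1 : seq I)); rewrite -s1E mem_undup in_cons h orbT.
have us1 : uniq s1 by rewrite -s1E undup_uniq.
have [|n [s [S [Sv [D [sub bd]]]]]] := triangular_block_diag eo et cpl bT iT us1 _ nu0.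
  move=> x i /s1s0 is0; rewrite TE Xg // hg // -Xg // YX //.
have AX x : X (A x) = T (X x) by rewrite TE XK.
have [S1 [Sv1 bd1]] := block_diag_similar bX bY XK YX AX bd.
have ninj i j : i \notin s -> j \notin s -> nu i = nu j -> i = j.
  move=> si sj; apply: nu_inj; apply: s1s0.
    by apply: contra si; exact: sub.
  by apply: contra sj; exact: sub.
split.
  exact: (block_diag_root_riesz_basis hO iA eo et cpl bd1 ninj).
have [A' bA' AA'] := adjoint_ex eo cpl et bA.
have [S2 [Sv2 [D2 [bd2 _]]]] := block_diag_adjoint eo et cpl AA' bd1.
apply: (block_diag_root_riesz_basis (adjoint_graph hO AA') _ eo et cpl bd2).
  exact: (block_diag_adjoint_inj eo et cpl AA' bd1 iA).
by move=> i j si sj /(congr1 Num.conj); rewrite !conjCK; exact: ninj.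
Qed.

End Perturbation.

(** * The contraction principle on a disc of the complex plane *)

Section ComplexFixpoint.
Variables (R : realType) (H : lmodType R[i]).
Variable dot : {dot H for @Num.conj R[i]}.
Local Notation C := R[i].
Hypothesis cpl : hcomplete dot.
Variable v : H.
Hypothesis v1 : dot v v = 1.

Lemma half_pow_small (c eps : R) : 0 < eps -> exists N : nat, 2^-1 ^+ N * c <= eps.
Proof.
move=> e0; exists (Num.truncn (c / eps)); set N := Num.truncn _.
have h : c / eps < N.+1%:R := truncnS_gt _.
have h2 : N.+1%:R <= 2 ^+ N :> R by rewrite -natrX ler_nat ltn_expl.
rewrite exprVn mulrC ler_pdivrMr ?exprn_gt0 // mulrC -ler_pdivrMr //.
by rewrite ltW // (lt_le_trans h).
Qed.

(* Completeness of C is inherited from H through the line spanned by [v]. *)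
Lemma complex_complete (u : nat -> C) :
  (forall eps : R, 0 < eps -> exists N, forall m n, (N <= m)%N -> (N <= n)%N ->
     normc (u m - u n) <= eps) ->
  exists x, forall eps : R, 0 < eps -> exists N, forall n, (N <= n)%N -> normc (x - u n) <= eps.
Proof.
have nv : nrm dot v = 1 by rewrite /nrm /nrm2 v1 /= sqrtr1.
move=> hu; have [|x hx] := cpl (u := fun n => u n *: v).
  move=> eps /hu [N hN]; exists N => m n Nm Nn.
  by rewrite -scalerBl nrmZ nv mulr1 hN.
exists (dot x v) => eps /hx [N hN]; exists N => n /hN.
apply: le_trans; have -> : dot x v - u n = dot (x - u n *: v) v.
  by rewrite dotBl dotZl v1 mulr1.
by apply: le_trans (cauchy_schwarz _ _ _) _; rewrite nv mulr1.
Qed.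

(** Banach iteration from 0 with ratio 1/2. The a priori bound by 2 |T 0| is what later controls the
    displacement of an eigenvalue by a Fourier coefficient. *)
Lemma complex_fixpoint (T : C -> C) (r : R) : normc (T 0) <= r / 2 ->
  (forall x y, normc x <= r -> normc y <= r -> normc (T x - T y) <= 2^-1 * normc (x - y)) ->
  exists x, [/\ normc x <= r, T x = x & normc x <= 2 * normc (T 0)].
Proof.
move=> T0 hT; have r0 : 0 <= r.
  by have := le_trans (normc_ge0 _) T0; rewrite pmulr_lge0 ?invr_gt0.
have Tr x : normc x <= r -> normc (T x) <= r.
  move=> xr; have -> : T x = (T x - T 0) + T 0 by rewrite subrK.
  apply: le_trans (normcD _ _) _; have := hT _ _ xr (_ : normc 0 <= r).
  by rewrite normc0 subr0 => /(_ r0); lra.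
pose u n := iter n T 0.
have ur n : normc (u n) <= r by elim: n => [|n IH]; [rewrite normc0 | exact: Tr].
have uN n j : normc (u (n + j)%N - u n) <= 2^-1 ^+ n * r.
  elim: n => [|n IH]; first by rewrite expr0 mul1r subr0 ur.
  rewrite addSn /=; apply: le_trans (hT _ _ (ur _) (ur _)) _.
  by rewrite exprS -mulrA ler_wpM2l ?invr_ge0.
have [|x hx] := complex_complete (u := u).
  move=> eps e0; have [N hN] := half_pow_small (2 * r) e0.
  exists N => m n /subnKC <- /subnKC <-.
  have -> : u (N + (m - N))%N - u (N + (n - N))%N =
     (u (N + (m - N))%N - u N) - (u (N + (n - N))%N - u N) by ring.
  apply: le_trans (normcB _ _) _; apply: le_trans hN.
  by rewrite mulrCA mulr_natl mulr2n lerD.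
have xr : normc x <= r.
  apply/ler_addgt0Pl => eps /hx [N /(_ _ (leqnn _)) h].
  have -> : x = (x - u N) + u N by rewrite subrK.
  by apply: le_trans (normcD _ _) _; rewrite lerD.
have Tx : T x = x.
  apply/eqP; rewrite -subr_eq0 -normc_eq0 eq_le normc_ge0 andbT.
  apply/ler_addgt0Pl => eps e0; rewrite addr0.
  have [N hN] := hx (eps / 2) (divr_gt0 e0 (ltr0Sn _ 1)).
  have h1 := hN _ (leqnn _); have h2 := hN _ (leqnSn N).
  have -> : T x - x = (T x - T (u N)) - (x - u N.+1) by rewrite /=; ring.
  apply: le_trans (normcB _ _) _; have := hT _ _ xr (ur N).
  by have := normc_ge0 (x - u N); lra.
exists x; split => //.
have h : normc x <= normc (T x - T 0) + normc (T 0).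
  by rewrite -{1}Tx; apply: le_trans (normcD _ _); rewrite subrK.
have := hT x 0 xr; rewrite normc0 subr0 => /(_ r0); lra.
Qed.
End ComplexFixpoint.

(** * Square integrable complex functions *)

Local Open Scope classical_set_scope.

Section SquareIntegrable.
Context d (T : measurableType d) (R : realType).
Variable mu : {measure set T -> \bar R}.
Local Notation C := R[i].

Definition cmeasurable (f : T -> C) :=
  measurable_fun [set: T] (fun x => Re (f x)) /\ measurable_fun [set: T] (fun x => Im (f x)).

Lemma sqint_cmeasurable f : f \in sqint mu -> cmeasurable f.
Proof.
by move=> /andP[/andP[+ _] /andP[+ _]]; rewrite !inE.
Qed.

Lemma measurable_sqr_normc f : cmeasurable f ->
  measurable_fun [set: T] (EFin \o (fun x => normc (f x) ^+ 2 : R)).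
Proof.
move=> [mr mi]; apply/measurable_EFinP.
under eq_fun do rewrite normc_sqr.
by apply: measurable_funD; apply: measurable_funX.
Qed.

Lemma cmeasurableB f g : cmeasurable f -> cmeasurable g -> cmeasurable (fun x => f x - g x).
Proof.
move=> [rf jf] [rg jg]; split.
  have -> : (fun x => Re (f x - g x)) = (fun x => Re (f x) - Re (g x)).
    by apply/funext => x; case: (f x) (g x) => [? ?] [? ?].
  exact: measurable_funB.
have -> : (fun x => Im (f x - g x)) = (fun x => Im (f x) - Im (g x)).
  by apply/funext => x; case: (f x) (g x) => [? ?] [? ?].
exact: measurable_funB.
Qed.

Lemma cmeasurableM f g : cmeasurable f -> cmeasurable g -> cmeasurable (fun x => f x * g x).
Proof.
move=> [rf jf] [rg jg]; split.
  have -> : (fun x => Re (f x * g x)) = (fun x => Re (f x) * Re (g x) - Im (f x) * Im (g x)).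
    by apply/funext => x; case: (f x) (g x) => [? ?] [? ?].
  by apply: measurable_funB; exact: measurable_funM.
have -> : (fun x => Im (f x * g x)) = (fun x => Re (f x) * Im (g x) + Im (f x) * Re (g x)).
  by apply/funext => x; case: (f x) (g x) => [? ?] [? ?].
by apply: measurable_funD; exact: measurable_funM.
Qed.

Lemma cmeasurableJ f : cmeasurable f -> cmeasurable (fun x => (f x)^*).
Proof.
move=> [rf jf]; split.
  by under eq_fun do rewrite Re_conj.
have -> : (fun x => Im (f x)^*) = (fun x => - Im (f x)).
  by apply/funext => x; case: (f x) => [? ?].
exact: measurableT_comp.
Qed.

Lemma cmeasurable_cst (c : C) : cmeasurable (fun=> c).
Proof. by split; exact: measurable_cst. Qed.

Lemma Lfun2P (f : T -> R) : measurable_fun [set: T] f ->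
  (\int[mu]_x (f x ^+ 2)%:E < +oo)%E -> f \in Lfun mu 2%:E.
Proof.
move=> mf fi; rewrite inE; apply/andP; split; rewrite inE //=.
rewrite /finite_norm unlock; apply: poweR_lty.
apply: le_lt_trans fi; rewrite le_eqVlt; apply/orP; left; apply/eqP.
by apply: eq_integral => x _ /=; rewrite powR_mulrn // real_normK ?num_real.
Qed.

Lemma sqintP f : cmeasurable f -> (\int[mu]_x (normc (f x) ^+ 2)%:E < +oo)%E ->
  f \in sqint mu.
Proof.
move=> mf fi; have [mr mi] := mf; apply/andP; split; apply: Lfun2P => //;
  apply: le_lt_trans fi; apply: ge0_le_integral => //.
- by move=> x _; rewrite lee_fin sqr_ge0.
- by apply/measurable_EFinP; exact: measurable_funX.
- exact: measurable_sqr_normc.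
- by move=> x _; rewrite lee_fin normc_sqr lerDl sqr_ge0.
- by move=> x _; rewrite lee_fin sqr_ge0.
- by apply/measurable_EFinP; exact: measurable_funX.
- exact: measurable_sqr_normc.
- by move=> x _; rewrite lee_fin normc_sqr lerDr sqr_ge0.
Qed.

Definition cls (f : T -> C) (hf : f \in sqint mu) : L2 mu :=
  \pi_(L2 mu)%qT (MkL2fun hf).

Lemma clsE f (hf : f \in sqint mu) : {ae mu, forall x, cls hf x = f x}.
Proof. exact: reprL2. Qed.

Lemma L2_eq (f g : L2 mu) : {ae mu, forall x, f x = g x} -> f = g.
Proof. by move=> h; rewrite -[f]reprK -[g]reprK; apply/piL2E. Qed.

Lemma L2B (f g : L2 mu) : {ae mu, forall x, (f - g : L2 mu) x = f x - g x}.
Proof.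
rewrite -scaleN1r; apply: filterS2 (L2D f (-1 *: g)) (L2Z (-1) g) => x -> ->.
by rewrite mulN1r.
Qed.

Definition L2form : {dot (L2 mu) for @Num.conj C} := @L2dot d T R mu.

Lemma dot_ae (f g : L2 mu) (p q : T -> C) : p \in sqint mu -> q \in sqint mu ->
  {ae mu, forall x, f x = p x} -> {ae mu, forall x, g x = q x} ->
  L2form f g = cintegral mu setT (fun x => p x * (q x)^*).
Proof.
move=> hp hq fp gq; apply: ae_eq_cintegral.
- by apply: cintegrable_dot; exact: L2_sqint.
- exact: cintegrable_dot.
- by apply: filterS2 fp gq => x -> ->.
Qed.

Lemma cintegrable_sqr (p : T -> C) : p \in sqint mu ->
  mu.-integrable setT (EFin \o (fun x => normc (p x) ^+ 2 : R)).
Proof.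
move=> hp; have [ir _] := cintegrable_dot hp hp.
apply: eq_integrable ir => // x _ /=; congr EFin.
by rewrite -sqr_normcE.
Qed.

Lemma nrm2_ae (f : L2 mu) (p : T -> C) : p \in sqint mu ->
  {ae mu, forall x, f x = p x} ->
  ((nrm2 L2form f)%:E = \int[mu]_x (normc (p x) ^+ 2)%:E)%E.
Proof.
move=> hp fp; rewrite /nrm2 (dot_ae hp hp fp fp) /= /Rintegral fineK.
  by apply: eq_integral => x _; rewrite -sqr_normcE.
have [ir _] := cintegrable_dot hp hp.
exact: integrable_fin_num.
Qed.

End SquareIntegrable.

(** * Completeness of L^2 *)

Section Completeness.
Context d (T : measurableType d) (R : realType).
Variable mu : {measure set T -> \bar R}.
Local Notation C := R[i].
Local Notation nrm := (nrm (L2form mu)).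
Local Notation nrm2 := (nrm2 (L2form mu)).

Lemma fast_cvg (a : R^nat) (c : R) :
  (forall k, 4 ^+ k * (a k.+1 - a k) ^+ 2 <= c) -> cvgn a.
Proof.
move=> h; have c0 : 0 <= c by apply: le_trans (h 0%N); rewrite mulr_ge0 ?sqr_ge0.
have -> : a = fun n => a 0%N + series (telescope a) n.
  by apply/funext => n; exact: eq_sum_telescope.
apply: is_cvgD; first exact: is_cvg_cst.
apply: normed_cvg; apply: (@series_le_cvg _ _ (geometric (Num.sqrt c) 2^-1)).
- by move=> n; exact: normr_ge0.
- by move=> n; rewrite /geometric /= mulr_ge0 ?sqrtr_ge0 ?exprn_ge0.
- move=> n; rewrite /telescope /geometric /=.
  rewrite -(@ler_pXn2r _ 2) ?nnegrE ?mulr_ge0 ?sqrtr_ge0 ?exprn_ge0 //.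
  rewrite real_normK ?num_real // exprMn sqr_sqrtr //.
  rewrite -exprM mulnC exprM.
  have -> : (2^-1 : R) ^+ 2 = 4^-1 by field.
  by rewrite exprVn ler_pdivlMr ?exprn_gt0 // mulrC.
apply: is_cvg_geometric_series.
by rewrite ger0_norm ?invr_ge0 // invf_lt1 ?ltr1n.
Qed.

(** The weighted sum G of 4^k |v_(k+1) - v_k|^2 has integral at most the sum of 4^-k. Wherever G is
    finite the values converge geometrically ([fast_cvg]), and Fatou transfers the norm bounds to
    the limit. *)
Lemma L2_riesz_fischer_subseq (v : nat -> L2 mu) :
  (forall k l, (k <= l)%N -> nrm2 (v l - v k) <= 16^-1 ^+ k) ->
  exists w : L2 mu, forall k, nrm2 (w - v k) <= 16^-1 ^+ k.
Proof.
move=> hv.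
have mv k : cmeasurable (v k : T -> C) by apply: (sqint_cmeasurable (mu := mu)); exact: L2_sqint.
have mvB k l : cmeasurable (fun x => v k x - v l x) by exact: cmeasurableB.
pose df k x : R := normc (v k.+1 x - v k x) ^+ 2.
have mdf k : measurable_fun [set: T] (fun x => (4 ^+ k * df k x)%:E).
  apply/measurable_EFinP; apply: measurable_funM => //.
  by apply/measurable_EFinP; exact: measurable_sqr_normc.
have df0 k x : (0 <= (4 ^+ k * df k x)%:E)%E.
  by rewrite lee_fin mulr_ge0 ?sqr_ge0 ?exprn_ge0.
have nrmE l m : (\int[mu]_x (normc (v l x - v m x) ^+ 2)%:E = (nrm2 (v l - v m))%:E)%E.
  symmetry; apply: (nrm2_ae (p := (fun x => v l x - v m x))); last exact: L2B.
  rewrite -[X in X \in _]/((v l : T -> C) - (v m : T -> C)).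
  by rewrite rpredB //; exact: L2_sqint.
pose G := fun x => (\sum_(k <oo) (4 ^+ k * df k x)%:E)%E.
have mG : measurable_fun [set: T] G.
  by apply: ge0_emeasurable_sum => // k x _ _.
have Gfin : (\int[mu]_x G x < +oo)%E.
  rewrite integral_nneseries //.
  have le k : (\int[mu]_x (4 ^+ k * df k x)%:E <= (geometric 1 4^-1 k)%:E)%E.
    under eq_integral do rewrite EFinM.
    rewrite ge0_integralZl_EFin ?exprn_ge0 //; last first.
    - exact: measurable_sqr_normc.
    - by move=> x _; rewrite lee_fin sqr_ge0.
    rewrite nrmE -EFinM lee_fin /geometric /= mul1r.
    apply: le_trans (ler_wpM2l _ (hv k k.+1 (leqnSn _))) _; first by rewrite exprn_ge0.
    by rewrite -exprMn (_ : 4 * 16^-1 = 4^-1 :> R) //; field.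
  apply: le_lt_trans (lee_nneseries _ (fun k _ => le k)) _.
    by move=> k _ _; exact: integral_ge0.
  have : cvgn (series (geometric (1:R) 4^-1)).
    apply: is_cvg_geometric_series.
    by rewrite ger0_norm ?invr_ge0 // invf_lt1 ?ltr1n.
  move=> /cvg_ex [l hl].
  suff -> : (\sum_(k <oo) (geometric 1 4^-1 k)%:E = l%:E)%E by exact: ltry.
  apply/cvg_lim => //.
  have -> : (fun n => \sum_(0 <= k < n | true) (geometric 1 4^-1 k)%:E)%E =
     EFin \o series (geometric (1:R) 4^-1).
    by apply/funext => n /=; rewrite /series /= sumEFin.
  by apply/fine_cvgP; split; [exact: nearW | exact: hl].
have Gae : {ae mu, forall x, G x \is a fin_num}.
  have iG : mu.-integrable setT G.
    apply/integrableP; split=> //.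
    under eq_integral do rewrite gee0_abs ?nneseries_ge0 //.
    exact: Gfin.
  by apply: filterS (integrable_ae measurableT iG) => x; exact.
pose A := [set x | (G x < +oo)%E].
have mA : measurable A.
  rewrite -[A]setTI; exact: emeasurable_fun_infty_o.
have vcv x : A x -> cvgn (fun k => Re (v k x)) /\ cvgn (fun k => Im (v k x)).
  move=> Ax; pose c := fine (G x).
  have Gx : G x = c%:E by rewrite fineK // ge0_fin_numE // nneseries_ge0.
  have le k : 4 ^+ k * df k x <= c.
    rewrite -lee_fin -Gx /G.
    apply: le_trans (_ : (\sum_(0 <= i < k.+1) (4 ^+ i * df i x)%:E <= _)%E).
      by rewrite big_nat_recr //= leeDr // sume_ge0.
    exact: nneseries_lim_ge.
  split; apply: (@fast_cvg _ c) => k; apply: le_trans (le k);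
    rewrite ler_wpM2l ?exprn_ge0 // /df normc_sqr;
    case: (v k.+1 x) (v k x) => [a b] [a' b'] /=.
    by rewrite lerDl sqr_ge0.
  by rewrite lerDr sqr_ge0.
(* The indicator of the set where G is finite makes the sequence converge at every point, so the
   limit is measurable. *)
pose re x := limn (fun k => Re (v k x) * \1_A x).
pose im x := limn (fun k => Im (v k x) * \1_A x).
have cvA (u : nat -> T -> R) x : (A x -> cvgn (u ^~ x)) ->
    (fun k => u k x * \1_A x) @ \oo --> limn (fun k => u k x * \1_A x).
  move=> ux; have [Ax|nAx] := pselect (A x).
    by apply: is_cvgM; [exact: ux | exact: is_cvg_cst].
  rewrite indicE memNset //=.
  by under eq_fun do rewrite mulr0; exact: is_cvg_cst.
have recv x : (fun k => Re (v k x) * \1_A x) @ \oo --> re x.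
  by apply: (cvA (fun k x => Re (v k x))) => /vcv [].
have imcv x : (fun k => Im (v k x) * \1_A x) @ \oo --> im x.
  by apply: (cvA (fun k x => Im (v k x))) => /vcv [].
pose phi x : C := Complex (re x) (im x).
have mphi : cmeasurable phi.
  split; [apply: measurable_fun_cvg (fun x _ => recv x)|apply: measurable_fun_cvg (fun x _ => imcv x)] => m;
  by apply: measurable_funM; [case: (mv m)|exact: measurable_indic].
have phiA x k : A x -> (fun l => (normc (v (k + l)%N x - v k x) ^+ 2)%:E) @ \oo -->
    (normc (phi x - v k x) ^+ 2)%:E.
  move=> Ax.
  have A1 : \1_A x = 1 :> R by rewrite indicE mem_set.
  have cr : (fun l => Re (v (k + l)%N x)) @ \oo --> re x.
    have := recv x; under eq_fun do rewrite A1 mulr1.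
    by rewrite -(cvg_shiftn k) /=; under eq_fun do rewrite addnC.
  have ci : (fun l => Im (v (k + l)%N x)) @ \oo --> im x.
    have := imcv x; under eq_fun do rewrite A1 mulr1.
    by rewrite -(cvg_shiftn k) /=; under eq_fun do rewrite addnC.
  apply/fine_cvgP; split; first exact: nearW.
  have -> : fine \o (fun l => (normc (v (k + l)%N x - v k x) ^+ 2)%:E) =
     fun l => (Re (v (k + l)%N x) - Re (v k x)) * (Re (v (k + l)%N x) - Re (v k x)) +
     (Im (v (k + l)%N x) - Im (v k x)) * (Im (v (k + l)%N x) - Im (v k x)).
    apply/funext => l /=; rewrite normc_sqr !expr2.
    by case: (v (k + l)%N x) (v k x) => [a b] [a' b'].
  have -> : normc (phi x - v k x) ^+ 2 = (re x - Re (v k x)) * (re x - Re (v k x)) +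
      (im x - Im (v k x)) * (im x - Im (v k x)).
    by rewrite normc_sqr !expr2 /phi; case: (v k x) => [a b].
  have cr' : (fun l => Re (v (k + l)%N x) - Re (v k x)) @ \oo --> re x - Re (v k x).
    by apply: cvgB cr _; exact: cvg_cst.
  have ci' : (fun l => Im (v (k + l)%N x) - Im (v k x)) @ \oo --> im x - Im (v k x).
    by apply: cvgB ci _; exact: cvg_cst.
  by apply: cvgD; exact: cvgM.
have mphiB k : cmeasurable (fun x => phi x - v k x) by exact: cmeasurableB.
have phiint k : (\int[mu]_x (normc (phi x - v k x) ^+ 2)%:E <= (16^-1 ^+ k)%:E)%E.
  pose f l x := (normc (v (k + l)%N x - v k x) ^+ 2)%:E.
  have mf l : measurable_fun [set: T] (f l) by exact: measurable_sqr_normc.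
  have f0 l x : [set: T] x -> (0 <= f l x)%E by rewrite lee_fin sqr_ge0.
  have -> : (\int[mu]_x (normc (phi x - v k x) ^+ 2)%:E = \int[mu]_x limn_einf (f^~ x))%E.
    apply: ge0_ae_eq_integral => //.
    - exact: measurable_sqr_normc.
    - apply: measurableT_comp => //; apply: measurable_fun_limn_esup => l.
      exact: measurableT_comp.
    - by move=> x _; rewrite lee_fin sqr_ge0.
    - move=> x _; rewrite limn_einf_lim; apply: lime_ge; first exact: is_cvg_einfs.
      by apply: nearW => l; apply: le_ereal_inf_tmp => _ [m /= _ <-]; exact: f0.
    apply: filterS Gae => x Gx _.
    have Ax : A x by rewrite /A /= ltey_eq Gx.
    have := phiA x k Ax => hx.
    rewrite is_cvg_limn_einfE; last by apply/cvg_ex; eexists; exact: hx.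
    by symmetry; apply/cvg_lim.
  apply: le_trans (fatou mu measurableT mf f0) _.
  rewrite limn_einf_lim; apply: lime_le; first exact: is_cvg_einfs.
  apply: nearW => l; apply: ereal_inf_le; exists ((\int[mu]_x f l x)%E).
    by exists l => /=.
  by rewrite /f nrmE lee_fin hv // leq_addr.
have sphiB k : (fun x => phi x - v k x) \in sqint mu.
  by apply: sqintP => //; apply: le_lt_trans (phiint k) _; exact: ltry.
have sphi : phi \in sqint mu.
  have -> : phi = (fun x => phi x - v 0%N x) + (v 0%N : T -> C).
    by apply/funext => x; rewrite fctE subrK.
  by rewrite rpredD //; exact: L2_sqint.
exists (cls sphi) => k; rewrite -lee_fin.
rewrite (nrm2_ae (sphiB k)) ?phiint //.
by apply: filterS2 (L2B (cls sphi) (v k)) (clsE sphi) => x -> ->.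
Qed.

Lemma L2_hcomplete : hcomplete (L2form mu).
Proof.
move=> u hu.
have /choice [N hN] : forall k : nat, exists N, forall m n, (N <= m)%N -> (N <= n)%N ->
     nrm (u m - u n) <= 4^-1 ^+ k.
  by move=> k; apply: hu; rewrite exprn_gt0.
(* Partial sums replace the thresholds N k by a nondecreasing sequence above them. *)
pose M k := (\sum_(i < k.+1) N i)%N.
have MN k : (N k <= M k)%N by rewrite /M big_ord_recr /= leq_addl.
have Mle k l : (k <= l)%N -> (M k <= M l)%N.
  move=> kl; rewrite -(subnKC kl); elim: (l - k)%N => [|j IH]; first by rewrite addn0.
  by rewrite addnS {2}/M big_ord_recr /=; apply: leq_trans IH _; rewrite leq_addr.
have [|w hw] := @L2_riesz_fischer_subseq (u \o M).
  move=> k l kl; rewrite -sqr_nrm.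
  have -> : (16^-1 : R) ^+ k = (4^-1 ^+ k) ^+ 2.
    by rewrite -exprM mulnC exprM (_ : 4^-1 ^+ 2 = 16^-1 :> R) //; field.
  rewrite ler_pXn2r ?nnegrE ?nrm_ge0 ?exprn_ge0 //.
  by apply: (hN k (M l) (M k)); [exact: leq_trans (MN k) (Mle _ _ kl) | exact: MN].
exists w => eps e0.
have e2 : 0 < eps / 2 by lra.
have [k hk] : exists k : nat, 4^-1 ^+ k <= eps / 2.
  have /cvgrPdist_le /(_ _ e2) [k _ hk] : ((fun n => 4^-1 ^+ n) @ \oo --> (0:R)).
    by apply: cvg_expr; rewrite ger0_norm // invf_lt1 // ltr1n.
  exists k; have /= := hk k (leqnn _).
  by rewrite sub0r normrN ger0_norm ?exprn_ge0.
exists (M k) => n hn.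
have -> : w - u n = (w - u (M k)) + (u (M k) - u n) by rewrite addrA subrK.
apply: le_trans (nrmD _ _ _) _.
have h1 : nrm (w - u (M k)) <= 4^-1 ^+ k.
  rewrite nrm_le ?exprn_ge0 // -exprM mulnC exprM.
  by rewrite (_ : 4^-1 ^+ 2 = 16^-1 :> R) //; [exact: hw | field].
have h2 : nrm (u (M k) - u n) <= 4^-1 ^+ k.
  by apply: hN => //; exact: leq_trans (MN k) hn.
lra.
Qed.
End Completeness.

(** * Fubini for products with a bounded kernel *)

Section RealFubini.
Context d (T : measurableType d) (R : realType).
Variable m : {finite_measure set T -> \bar R}.

Lemma integrableM_bounded (f k : T -> R) (B : R) :
  m.-integrable setT (EFin \o f) -> measurable_fun [set: T] k ->
  (forall x, `|k x| <= B) -> m.-integrable setT (EFin \o (fun x => f x * k x)).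
Proof.
move=> fi mk kB.
have mf : measurable_fun [set: T] f by apply/measurable_EFinP; exact: measurable_int fi.
apply: (le_integrable measurableT _ _ (integrableZr measurableT B fi)).
  by apply/measurable_EFinP; exact: measurable_funM.
move=> x _ /=; rewrite lee_fin normrM normrM ler_wpM2l //.
exact: le_trans (kB x) (ler_norm _).
Qed.

(** Since |k| <= 1, the integrand is dominated by |g(s)| |f(t)|, which is integrable on the
    product. *)
Lemma real_fubini (g f : T -> R) (k : T * T -> R) :
  m.-integrable setT (EFin \o g) -> m.-integrable setT (EFin \o f) ->
  measurable_fun [set: T * T] k -> (forall p, `|k p| <= 1) ->
  m.-integrable setT (EFin \o (fun s => g s * \int[m]_t (f t * k (s, t)))) /\
  \int[m]_t (f t * \int[m]_s (g s * k (s, t))) =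
  \int[m]_s (g s * \int[m]_t (f t * k (s, t))).
Proof.
move=> ig jf mk k1.
have mg : measurable_fun [set: T] g by apply/measurable_EFinP; exact: measurable_int ig.
have mf : measurable_fun [set: T] f by apply/measurable_EFinP; exact: measurable_int jf.
pose F (p : T * T) : \bar R := (g p.1 * f p.2 * k p)%:E.
have mF : measurable_fun [set: T * T] F.
  apply/measurable_EFinP; apply: measurable_funM => //.
  by apply: measurable_funM; apply: measurableT_comp.
have maF : measurable_fun [set: T * T] (abse \o F) by apply: measurableT_comp.
have iF : (m \x m)%E.-integrable setT F.
  apply/integrable12ltyP => //.
  pose c := fine (\int[m]_t `|(f t)%:E|)%E.
  have cE : (\int[m]_t `|(f t)%:E| = c%:E)%E.
    by rewrite fineK // ge0_fin_numE ?integral_ge0 //; case/integrableP: jf.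
  apply: (@le_lt_trans _ _ (\int[m]_s (`|(g s)%:E| * c%:E))%E).
    apply: ge0_le_integral => //.
    - by move=> s _; exact: integral_ge0.
    - exact: (@measurable_fun_fubini_tonelli_F _ _ _ _ _ m (abse \o F) maF (fun x => abse_ge0 _)).
    - apply: emeasurable_funM => //; apply: measurableT_comp => //.
      exact/measurable_EFinP.
    move=> s _; rewrite -cE -ge0_integralZl //; last 1 first.
    - by apply: measurableT_comp => //; exact/measurable_EFinP.
    apply: ge0_le_integral => //.
    - apply: measurableT_comp => //; apply/measurable_EFinP.
      apply: measurable_funM.
        by apply: measurable_funM => //=; exact: measurable_cst.
      by apply: measurableT_comp => //; exact: measurable_pair1.
    - apply: emeasurable_funM => //; apply: measurableT_comp => //.
      exact/measurable_EFinP.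
    move=> t _; rewrite /F /= lee_fin !normrM.
    by rewrite ler_piMr // mulr_ge0.
  rewrite ge0_integralZr //; last 2 first.
  - by apply: measurableT_comp => //; exact/measurable_EFinP.
  - by rewrite -cE integral_ge0.
  apply: lte_mul_pinfty; [exact: integral_ge0 | | exact: ltry].
  by rewrite ge0_fin_numE ?integral_ge0 //; case/integrableP: ig.
have E1 : (fun s => \int[m]_t F (s, t))%E = (EFin \o (fun s => g s * \int[m]_t (f t * k (s, t)))).
  apply/funext => s; rewrite /F /=.
  have mks : measurable_fun [set: T] (fun t => k (s, t)).
    by apply: measurableT_comp => //; exact: measurable_pair1.
  have ifk := integrableM_bounded jf mks (fun t => k1 (s, t)).
  rewrite -RintegralZl // /Rintegral fineK.
    by apply: eq_integral => t _; rewrite mulrA.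
  apply: integrable_fin_num => //.
  by have := integrableZl measurableT (g s) ifk.
have E2 : (fun t => \int[m]_s F (s, t))%E = (EFin \o (fun t => f t * \int[m]_s (g s * k (s, t)))).
  apply/funext => t; rewrite /F /=.
  have mks : measurable_fun [set: T] (fun s => k (s, t)).
    by apply: measurableT_comp => //; exact: measurable_pair2.
  have ifk := integrableM_bounded ig mks (fun s => k1 (s, t)).
  rewrite -RintegralZl // /Rintegral fineK.
    by apply: eq_integral => s _; congr EFin; ring.
  apply: integrable_fin_num => //.
  by have := integrableZl measurableT (f t) ifk.
split; first by rewrite -E1; exact: (integrable_fubini_F iF).
have := @Fubini _ _ _ _ _ m m F iF.
by rewrite /Rintegral => E; congr fine; have := E; rewrite E1 E2 => ->.
Qed.

(** Transport to a measure that is equal to a bundled finite measure, as [mu02pi] is to [fmu]. *)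
Lemma real_fubini_eq (mu : {measure set T -> \bar R}) (g f : T -> R) (k : T * T -> R) :
  (m : {measure set T -> \bar R}) = mu ->
  mu.-integrable setT (EFin \o g) -> mu.-integrable setT (EFin \o f) ->
  measurable_fun [set: T * T] k -> (forall p, `|k p| <= 1) ->
  mu.-integrable setT (EFin \o (fun s => g s * \int[mu]_t (f t * k (s, t)))) /\
  \int[mu]_t (f t * \int[mu]_s (g s * k (s, t))) =
  \int[mu]_s (g s * \int[mu]_t (f t * k (s, t))).
Proof. by move=> <-; exact: real_fubini. Qed.

Local Notation C := R[i].

Lemma complex_fubini (mu : {measure set T -> \bar R}) (g f : T -> C) (k : T * T -> R) :
  (m : {measure set T -> \bar R}) = mu ->
  cintegrable mu g -> cintegrable mu f ->
  measurable_fun [set: T * T] k -> (forall p, `|k p| <= 1) ->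
  cintegral mu setT (fun t => f t * cintegral mu setT (fun s => g s * (k (s, t))%:C%C)) =
  cintegral mu setT (fun s => g s * cintegral mu setT (fun t => f t * (k (s, t))%:C%C)).
Proof.
move=> mE [gr gi] [fr fi] mk k1.
have ReM (u : C) (r : R) : Re (u * r%:C%C) = Re u * r by case: u => a b /=; rewrite mulr0 subr0.
have ImM (u : C) (r : R) : Im (u * r%:C%C) = Im u * r by case: u => a b /=; rewrite mulr0 add0r.
have inner (h : T -> C) (l : T -> R) : cintegral mu setT (fun s => h s * (l s)%:C%C) =
   Complex (\int[mu]_s (Re (h s) * l s)) (\int[mu]_s (Im (h s) * l s)).
  by rewrite /cintegral; congr Complex; apply: eq_Rintegral => s _.
(* Swapping the variables yields integrability of the other iterated integrand, needed to add and
   subtract the four real pieces. *)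
pose k' (p : T * T) := k (p.2, p.1).
have mk' : measurable_fun [set: T * T] k'.
  by apply: measurableT_comp => //; apply/measurable_fun_pairP; split; [exact: measurable_snd|exact: measurable_fst].
have k1' p : `|k' p| <= 1 by exact: k1.
have RF (u v : T -> R) : mu.-integrable setT (EFin \o u) -> mu.-integrable setT (EFin \o v) ->
  [/\ mu.-integrable setT (EFin \o (fun t => v t * \int[mu]_s (u s * k (s, t)))),
      mu.-integrable setT (EFin \o (fun s => u s * \int[mu]_t (v t * k (s, t)))) &
  \int[mu]_t (v t * \int[mu]_s (u s * k (s, t))) =
  \int[mu]_s (u s * \int[mu]_t (v t * k (s, t)))].
  move=> iu iv.
  have [i1 e1] := real_fubini_eq mE iu iv mk k1.
  have [i2 e2] := real_fubini_eq mE iv iu mk' k1'.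
  by split.
have [a1 b1 e1] := RF _ _ gr fr.
have [a2 b2 e2] := RF _ _ gi fi.
have [a3 b3 e3] := RF _ _ gr fi.
have [a4 b4 e4] := RF _ _ gi fr.
have congrC (h l : T -> C) : \int[mu]_x Re (h x) = \int[mu]_x Re (l x) ->
    \int[mu]_x Im (h x) = \int[mu]_x Im (l x) ->
    cintegral mu setT h = cintegral mu setT l by move=> hR hI; congr Complex.
apply: congrC.
  transitivity (\int[mu]_t (Re (f t) * \int[mu]_s (Re (g s) * k (s, t))) -
                \int[mu]_t (Im (f t) * \int[mu]_s (Im (g s) * k (s, t)))).
    rewrite -(RintegralB measurableT a1 a2); apply: eq_Rintegral => t _ /=.
    by rewrite inner; case: (f t).
  rewrite e1 e2 -(RintegralB measurableT b1 b2); apply: eq_Rintegral => s _ /=.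
  by rewrite inner; case: (g s).
transitivity (\int[mu]_t (Re (f t) * \int[mu]_s (Im (g s) * k (s, t))) +
                \int[mu]_t (Im (f t) * \int[mu]_s (Re (g s) * k (s, t)))).
  rewrite -(RintegralD measurableT a4 a3); apply: eq_Rintegral => t _ /=.
  by rewrite inner; case: (f t).
rewrite e3 e4 addrC -(RintegralD measurableT b3 b4); apply: eq_Rintegral => s _ /=.
by rewrite inner; case: (g s).
Qed.

End RealFubini.

(** * Integration over (0, 2 pi) *)

Section Interval.
Variable R : realType.
Local Notation C := R[i].
Local Notation leb := (@lebesgue_measure R).
Local Notation mu := (mu02pi R).
Local Notation TR := (measurableTypeR R).
Local Notation D := (`]0, 2 * (pi : R)[ : set R).
Local Notation sq := (sqint mu).
Local Notation cmeas := (@cmeasurable _ TR R).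

Lemma pi2_gt0 : 0 < 2 * (pi : R). Proof. by rewrite mulr_gt0 ?pi_gt0. Qed.

Lemma leb_D : leb D = (2 * pi)%:E.
Proof. by rewrite lebesgue_measure_itv /= lte_fin pi2_gt0 sube0. Qed.

Lemma leb_D_fin : (leb D < +oo)%E. Proof. by rewrite leb_D ltry. Qed.

Definition fmu : {finite_measure set TR -> \bar R} :=
  @mfrestr _ TR R D (@lebesgue_measure R) (measurable_itv (`]0, 2 * (pi : R)[)%R) leb_D_fin.

Lemma fmuE : (fmu : {measure set TR -> \bar R}) = mu.
Proof. by apply: eq_measure; apply/funext => A. Qed.

Lemma mu_subset A : A `<=` D -> mu A = leb A.
Proof. by move=> AD; rewrite -[mu A]/(leb (A `&` D)) setIidl. Qed.

Lemma mu_ae_D : {ae mu, forall x : R, D x}.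
Proof.
exists (~` D); split; [exact: measurableC|by rewrite -[mu _]/(leb (~` D `&` D)) setICl measure0|].
by move=> x.
Qed.

Lemma mu_aeS (P Q : TR -> Prop) : (forall x, P x -> Q x) ->
  {ae mu, forall x, P x} -> {ae mu, forall x, Q x}.
Proof. by move=> PQ; apply: filterS. Qed.

Lemma L2_0 : {ae mu, forall x : TR, (0 : L2pi R) x = 0}.
Proof.
by have := L2Z 0 (0 : L2pi R); rewrite scale0r; apply: mu_aeS => x ->; rewrite mul0r.
Qed.

Lemma L2P a (f g : L2pi R) : {ae mu, forall x : TR, (a *: f + g : L2pi R) x = a * f x + g x}.
Proof. by apply: filterS2 (L2D (a *: f) g) (L2Z a f) => x -> ->. Qed.

Lemma muT : mu setT = (2 * pi)%:E.
Proof. by rewrite -[mu _]/(leb (setT `&` D)) setTI leb_D. Qed.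

Lemma le_integral_D (f g : TR -> R) : measurable_fun [set: TR] f -> measurable_fun [set: TR] g ->
  (forall x, 0 <= f x) -> (forall x, 0 <= g x) -> (forall x, D x -> f x <= g x) ->
  (\int[mu]_x (f x)%:E <= \int[mu]_x (g x)%:E)%E.
Proof.
move=> mf mg f0 g0 fg; apply: ae_ge0_le_integral => //.
- by move=> x _; rewrite lee_fin.
- exact/measurable_EFinP.
- by move=> x _; rewrite lee_fin.
- exact/measurable_EFinP.
- by apply: mu_aeS mu_ae_D => x Dx _; rewrite lee_fin fg.
Qed.

Lemma measurable_normc2 (f : TR -> C) : cmeas f -> measurable_fun [set: TR] (fun x => normc (f x) ^+ 2 : R).
Proof. by move=> mf; apply/measurable_EFinP; exact: measurable_sqr_normc. Qed.

Lemma int_bounded (f : TR -> C) (B : R) : cmeas f -> (forall x, D x -> normc (f x) <= B) ->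
  (\int[mu]_x (normc (f x) ^+ 2)%:E <= (B ^+ 2 * (2 * pi))%:E)%E.
Proof.
move=> mf fB; apply: (@le_trans _ _ (\int[mu]_x (B ^+ 2)%:E)%E).
  apply: (@le_integral_D _ (fun=> B ^+ 2)) => //.
  - exact: measurable_normc2.
  - by move=> x; exact: sqr_ge0.
  - by move=> x; exact: sqr_ge0.
  - by move=> x /fB h; rewrite ler_pXn2r ?nnegrE ?normc_ge0 // (le_trans _ h) ?normc_ge0.
by rewrite integral_cst //= muT -EFinM.
Qed.

Lemma sq_bounded (f : TR -> C) (B : R) : cmeas f -> (forall x, D x -> normc (f x) <= B) ->
  f \in sq.
Proof.
move=> mf fB; apply: sqintP => //; apply: le_lt_trans (int_bounded mf fB) _.
exact: ltry.
Qed.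

Lemma sq_mulb (f g : TR -> C) (B : R) : f \in sq -> cmeas g ->
  (forall x, D x -> normc (g x) <= B) -> (fun x => f x * g x) \in sq.
Proof.
move=> fs mg gB; have mf := sqint_cmeasurable fs.
have fi := cintegrable_sqr fs.
apply: sqintP; first exact: cmeasurableM.
apply: (@le_lt_trans _ _ (\int[mu]_x ((B ^+ 2)%:E * (normc (f x) ^+ 2)%:E))%E).
  apply: (@le_integral_D _ (fun x => B ^+ 2 * normc (f x) ^+ 2)) => //.
  - exact: measurable_normc2 (cmeasurableM mf mg).
  - by apply: measurable_funM => //; exact: measurable_normc2.
  - by move=> x; exact: sqr_ge0.
  - by move=> x; rewrite mulr_ge0 ?sqr_ge0.
  - move=> x /gB h; rewrite normcM exprMn mulrC ler_wpM2r ?sqr_ge0 //.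
    by rewrite ler_pXn2r ?nnegrE ?normc_ge0 // (le_trans _ h) ?normc_ge0.
rewrite ge0_integralZl_EFin ?sqr_ge0 //; last first.
- exact: measurable_sqr_normc.
- by move=> x _; rewrite lee_fin sqr_ge0.
case/integrableP: fi => _ h; apply: lte_mul_pinfty => //; first by rewrite lee_fin sqr_ge0.
apply: le_lt_trans h; rewrite le_eqVlt; apply/orP; left; apply/eqP.
by apply: eq_integral => x _; rewrite gee0_abs // lee_fin sqr_ge0.
Qed.

Lemma sqP c (f g : TR -> C) : f \in sq -> g \in sq -> (fun x => c * f x + g x) \in sq.
Proof. exact: (sqint_submod_closed mu).2. Qed.

Lemma sqD (f g : TR -> C) : f \in sq -> g \in sq -> (fun x => f x + g x) \in sq.
Proof.
move=> fs gs; have := sqP 1 fs gs.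
by under eq_fun do rewrite mul1r.
Qed.

Lemma sq_cst c : (fun=> c : C) \in sq.
Proof. by apply: (@sq_bounded _ (normc c)) => //; exact: cmeasurable_cst. Qed.

Lemma sqZ c (f : TR -> C) : f \in sq -> (fun x => c * f x) \in sq.
Proof.
move=> fs; have := sqP c fs (sq_cst 0).
by under eq_fun do rewrite addr0.
Qed.

Lemma sqB (f g : TR -> C) : f \in sq -> g \in sq -> (fun x => f x - g x) \in sq.
Proof.
move=> fs gs; have := sqP (-1) gs fs.
by under eq_fun do rewrite mulN1r addrC.
Qed.

Lemma sqJ (f : TR -> C) : f \in sq -> (fun x => (f x)^*) \in sq.
Proof.
move=> fs; apply: sqintP; first by apply: cmeasurableJ; exact: (sqint_cmeasurable fs).
under eq_integral do rewrite normcJ.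
case/integrableP: (cintegrable_sqr fs) => _ h; apply: le_lt_trans h.
rewrite le_eqVlt; apply/orP; left; apply/eqP.
by apply: eq_integral => x _; rewrite gee0_abs // lee_fin sqr_ge0.
Qed.

Lemma sq_cintegrable (f : TR -> C) : f \in sq -> cintegrable mu f.
Proof.
move=> fs; have := cintegrable_dot fs (sq_cst 1).
by congr cintegrable; apply/funext => x; rewrite conjC1 mulr1.
Qed.

Definition cint (f : TR -> C) : C := cintegral mu setT f.

Lemma cintD f g : f \in sq -> g \in sq -> cint (fun x => f x + g x) = cint f + cint g.
Proof.
move=> fs gs; have := cintegralP 1 (sq_cintegrable fs) (sq_cintegrable gs).
rewrite mul1r => <-; congr cintegral; apply/funext => x; by rewrite mul1r.
Qed.

Lemma cintZ c f : f \in sq -> cint (fun x => c * f x) = c * cint f.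
Proof.
move=> fs; have := cintegralP c (sq_cintegrable fs) (sq_cintegrable (sq_cst 0)).
have -> : cintegral mu setT (fun=> 0) = 0.
  by rewrite /cintegral Rintegral_cst // mul0r.
rewrite addr0 => <-; congr cintegral; apply/funext => x; by rewrite addr0.
Qed.

Lemma cintB f g : f \in sq -> g \in sq -> cint (fun x => f x - g x) = cint f - cint g.
Proof.
move=> fs gs; rewrite -mulN1r -cintZ // -cintD ?sqZ //.
by congr cintegral; apply/funext => x; rewrite mulN1r.
Qed.

Lemma eq_cint f g : (forall x, f x = g x) -> cint f = cint g.
Proof. by move=> fg; congr cintegral; apply/funext. Qed.

Lemma ae_eq_cint f g : f \in sq -> g \in sq -> {ae mu, forall x, f x = g x} -> cint f = cint g.
Proof. by move=> fs gs; apply: ae_eq_cintegral; exact: sq_cintegrable. Qed.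

Lemma eq_cint_D f g : f \in sq -> g \in sq -> (forall x, D x -> f x = g x) -> cint f = cint g.
Proof.
by move=> fs gs fg; apply: ae_eq_cint => //; apply: mu_aeS mu_ae_D => x; exact: fg.
Qed.

Lemma dot_cint (f g : L2pi R) (p q : TR -> C) : p \in sq -> q \in sq ->
  {ae mu, forall x, f x = p x} -> {ae mu, forall x, g x = q x} ->
  dot02pi R f g = cint (fun x => p x * (q x)^*).
Proof. exact: dot_ae. Qed.

Lemma nrm2_bounded (f : L2pi R) (p : TR -> C) (B : R) : cmeas p ->
  (forall x, D x -> normc (p x) <= B) -> {ae mu, forall x, f x = p x} ->
  nrm2 (dot02pi R) f <= B ^+ 2 * (2 * pi).
Proof.
move=> mp pB fp; rewrite -lee_fin (nrm2_ae (sq_bounded mp pB) fp).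
exact: int_bounded.
Qed.

(** Written as a factor, this turns integrals over subintervals into integrals over the whole space,
    to which Fubini and the inner product apply. *)
Definition chi (a b : R) (x : TR) : C := ((a < x) && (x < b))%:R.

Lemma chiE a b x : chi a b x = (\1_(`]a, b[) x : R)%:C%C.
Proof.
rewrite /chi indicE; have -> : ((a < x) && (x < b)) = (x \in (`]a, b[ : set R)).
  by rewrite mem_setE in_itv.
by case: (_ \in _).
Qed.

Lemma normc_chi a b x : normc (chi a b x) <= 1.
Proof. by rewrite /chi; case: (_ && _); rewrite ?normc1 ?normc0. Qed.

Lemma cmeas_chi a b : cmeas (chi a b).
Proof.
split.
  have -> : (fun x => Re (chi a b x)) = \1_(`]a, b[).
    by apply/funext => x; rewrite chiE.
  by apply: measurable_indic; exact: measurable_itv.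
have -> : (fun x => Im (chi a b x)) = cst 0 by apply/funext => x; rewrite chiE.
exact: measurable_cst.
Qed.

Lemma sq_chi a b : chi a b \in sq.
Proof. by apply: (@sq_bounded _ 1) => [|x _]; [exact: cmeas_chi|exact: normc_chi]. Qed.

Lemma sq_mul_chi f a b : f \in sq -> (fun x => f x * chi a b x) \in sq.
Proof. by move=> fs; apply: (@sq_mulb _ _ 1) => //; [exact: cmeas_chi|move=> x _; exact: normc_chi]. Qed.

Lemma Rint_chi (f : TR -> R) a b : 0 <= a -> b <= 2 * pi ->
  \int[mu]_x (f x * \1_(`]a, b[) x) = \int[leb]_(x in `]a, b[) f x.
Proof.
move=> a0 b2.
have E1 : \int[leb]_(x in `]a, b[) f x = \int[mu]_(x in (`]a, b[ : set TR)) f x.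
 rewrite /Rintegral; congr fine.
apply: eq_measure_integral => A mA AD.
  have : A `<=` D.
    move=> x /AD /=; rewrite !in_itv /= => /andP[h1 h2].
    by rewrite (le_lt_trans a0 h1) (lt_le_trans h2 b2).
 by move=> h; rewrite mu_subset.
rewrite [RHS]E1.
rewrite [RHS]Rintegral_mkcond.
apply: eq_Rintegral => x _.
by rewrite patchE indicE; case: ifP; rewrite ?mulr1 ?mulr0.
Qed.

Lemma cint_chi (f : TR -> C) a b : 0 <= a -> b <= 2 * pi ->
  cint (fun x => f x * chi a b x) = cintegral leb `]a, b[ f.
Proof.
move=> a0 b2; rewrite /cint /cintegral.
rewrite -(Rint_chi (fun x => Re (f x)) a0 b2) -(Rint_chi (fun x => Im (f x)) a0 b2).
congr Complex; apply: eq_Rintegral => x _; rewrite chiE.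
  by case: (f x) => u v /=; rewrite mulr0 subr0.
by case: (f x) => u v /=; rewrite mulr0 add0r.
Qed.

Lemma cint_fubini (g f : TR -> C) (k : TR * TR -> R) : g \in sq -> f \in sq ->
  measurable_fun [set: TR * TR] k -> (forall p, `|k p| <= 1) ->
  cint (fun t => f t * cint (fun s => g s * (k (s, t))%:C%C)) =
  cint (fun s => g s * cint (fun t => f t * (k (s, t))%:C%C)).
Proof.
by move=> gs fs; exact: (complex_fubini fmuE (sq_cintegrable gs) (sq_cintegrable fs)).
Qed.

(** Fubini on the triangle 0 < s < t < x, whose indicator splits as [chi 0 x t * chi 0 t s] and as
    [chi 0 x s * chi s x t]. *)
Lemma cint_fubini_chi (g f : TR -> C) (x : R) : g \in sq -> f \in sq ->
  cint (fun t => f t * chi 0 x t * cint (fun s => g s * chi 0 t s)) =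
  cint (fun s => g s * chi 0 x s * cint (fun t => f t * chi s x t)).
Proof.
move=> gs fs.
pose k (p : TR * TR) : R := ((0 < p.1) && ((p.1 < p.2) && (p.2 < x)))%:R.
have kc s t : (k (s, t))%:C%C = chi 0 x t * chi 0 t s.
  rewrite /k /chi /=.
  case: (ltP 0 s) => s0; case: (ltP s t) => st; case: (ltP t x) => tx;
    rewrite /= ?andbF ?andbT ?mulr0 ?mul0r //=.
  by rewrite (lt_trans s0 st) mulr1.
have kc' s t : (k (s, t))%:C%C = chi 0 x s * chi s x t.
  rewrite /k /chi /=.
  case: (ltP 0 s) => s0; case: (ltP s t) => st; case: (ltP t x) => tx;
    rewrite /= ?andbF ?andbT ?mulr0 ?mul0r //=.
  by rewrite (lt_trans st tx) mulr1.
have mk : measurable_fun [set: TR * TR] k.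
  have -> : k = \1_[set p | (0 < p.1) && ((p.1 < p.2) && (p.2 < x))].
    by apply/funext => p; rewrite indicE mem_setE.
  apply: measurable_indic.
  have m1 := @measurable_fst _ _ TR TR; have m2 := @measurable_snd _ _ TR TR.
  have mb : measurable_fun [set: TR * TR] (fun p => (0 < p.1) && ((p.1 < p.2) && (p.2 < x))).
    apply: measurable_and; first by apply: measurable_fun_ltr => //; exact: measurable_cst.
    apply: measurable_and; first exact: measurable_fun_ltr.
    by apply: measurable_fun_ltr => //; exact: measurable_cst.
  have mt : measurable [set true] by [].
  by have := mb measurableT _ mt; rewrite setTI.
have k1 p : `|k p| <= 1 by rewrite /k; case: (_ && _); rewrite ?normr1 ?normr0.
have := cint_fubini gs fs mk k1.
rewrite (_ : cint (fun t => f t * cint (fun s => g s * (k (s, t))%:C%C)) =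
   cint (fun t => f t * chi 0 x t * cint (fun s => g s * chi 0 t s))); last first.
  apply: eq_cint => t; rewrite -mulrA; congr (_ * _).
  rewrite -cintZ ?sq_mul_chi //; apply: eq_cint => s; rewrite kc; ring.
move=> ->; apply: eq_cint => s; rewrite -mulrA; congr (_ * _).
rewrite -cintZ ?sq_mul_chi //; apply: eq_cint => t; rewrite kc'; ring.
Qed.

End Interval.

(** * Complex exponentials and integration by parts *)

Section ComplexExp.
Variable R : realType.
Local Notation C := R[i].
Implicit Types (z w : C) (t : R).

Definition cexp z : C := Complex (expR (Re z) * cos (Im z)) (expR (Re z) * sin (Im z)).

Lemma cexpD z w : cexp (z + w) = cexp z * cexp w.
Proof.
case: z w => [a b] [c d]; apply/eqP; rewrite eq_complex /=; apply/andP; split; apply/eqP.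
  by rewrite expRD cosD; ring.
by rewrite expRD sinD; ring.
Qed.

Lemma cexp0 : cexp 0 = 1.
Proof. by rewrite /cexp /= expR0 cos0 sin0 mulr1 mulr0. Qed.

Lemma normc_cexp z : normc (cexp z) = expR (Re z).
Proof.
case: z => a b; rewrite /= !exprMn -mulrDr cos2Dsin2 mulr1 sqrtr_sqr.
by rewrite ger0_norm // expR_ge0.
Qed.

Lemma cexp_neq0 z : cexp z != 0.
Proof. by rewrite -normc_eq0 normc_cexp gt_eqF // expR_gt0. Qed.

Lemma cexpJ z : (cexp z)^* = cexp z^*.
Proof.
by case: z => a b; rewrite /cexp /= cosN sinN mulrN.
Qed.

Definition ce w t : C := cexp ('i * w * t%:C%C).

Lemma ceE w t : ce w t = Complex (expR (- Im w * t) * cos (Re w * t))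
  (expR (- Im w * t) * sin (Re w * t)).
Proof.
rewrite /ce /cexp -complexiE; case: w => a b /=.
by rewrite !mul0r !mul1r !mulr0 !sub0r !add0r !subr0.
Qed.

Lemma ceD w v t : ce (w + v) t = ce w t * ce v t.
Proof. by rewrite -cexpD; congr cexp; ring. Qed.

Lemma ce0 w : ce w 0 = 1.
Proof. by rewrite /ce mulr0 cexp0. Qed.

Lemma c0e t : ce 0 t = 1.
Proof. by rewrite /ce mulr0 mul0r cexp0. Qed.

Lemma ceN w t : ce (- w) t * ce w t = 1.
Proof. by rewrite -ceD addNr c0e. Qed.

Lemma ce_neq0 w t : ce w t != 0. Proof. exact: cexp_neq0. Qed.

Lemma ceJ w t : (ce w t)^* = ce (- w^*) t.
Proof.
rewrite cexpJ /ce; congr cexp; rewrite !rmorphM /= conjCi conj_rc; ring.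
Qed.

Lemma normc_ce w t : normc (ce w t) = expR (- Im w * t).
Proof.
rewrite ceE /= !exprMn -mulrDr cos2Dsin2 mulr1 sqrtr_sqr.
by rewrite ger0_norm // expR_ge0.
Qed.

Lemma ce_nat n t : ce n%:R t = ce 1 t ^+ n.
Proof.
elim: n => [|n IH]; first by rewrite c0e expr0.
by rewrite -natr1 ceD IH exprSr.
Qed.

Lemma ce_int_2pi (n : int) : ce n%:~R (2 * pi) = 1.
Proof.
have h : ce 1 (2 * pi) = 1.
  rewrite ceE /= oppr0 mul0r expR0 !mul1r (mulr_natl pi 2) cos2pi sin2pi.
  by [].
case: n => n; first by rewrite -pmulrn ce_nat h expr1n.
rewrite NegzE mulrNz; have := ceN (n.+1%:~R) (2 * pi).
by rewrite -pmulrn ce_nat h expr1n mulr1.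
Qed.

(** With [exp_sin], the real and imaginary parts of exp(i (a + i b) t). *)
Definition exp_cos (a b t : R) := expR (- b * t) * cos (a * t).
Definition exp_sin (a b t : R) := expR (- b * t) * sin (a * t).

Lemma is_derive_scale (c t : R) : is_derive t 1 (fun s : R => c * s) c.
Proof.
have h := is_deriveM (is_derive_cst c t 1) (is_derive_id t 1).
by apply: is_derive_eq h _; rewrite /GRing.scale /= mulr0 addr0 mulr1.
Qed.

Lemma is_derive_exp_cos (a b t : R) :
  is_derive t 1 (exp_cos a b) (- b * exp_cos a b t - a * exp_sin a b t).
Proof.
have h1 := is_derive1_comp (is_derive_expR (- b * t)) (is_derive_scale (- b) t).
have h2 := is_derive1_comp (is_derive_cos (a * t)) (is_derive_scale a t).
have h := is_deriveM h1 h2.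
apply: is_derive_eq h _; rewrite /GRing.scale /= /exp_cos /exp_sin; ring.
Qed.

Lemma is_derive_exp_sin (a b t : R) :
  is_derive t 1 (exp_sin a b) (- b * exp_sin a b t + a * exp_cos a b t).
Proof.
have h1 := is_derive1_comp (is_derive_expR (- b * t)) (is_derive_scale (- b) t).
have h2 := is_derive1_comp (is_derive_sin (a * t)) (is_derive_scale a t).
have h := is_deriveM h1 h2.
apply: is_derive_eq h _; rewrite /GRing.scale /= /exp_cos /exp_sin; ring.
Qed.

Lemma continuous_is_derive (f df : R -> R) :
  (forall t, is_derive t 1 f (df t)) -> continuous f.
Proof.
move=> h t; apply: differentiable_continuous; apply/derivable1_diffP.
by have [] := h t.
Qed.

Lemma continuous_exp_cos a b : continuous (exp_cos a b).
Proof. exact: continuous_is_derive (is_derive_exp_cos a b). Qed.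

Lemma continuous_exp_sin a b : continuous (exp_sin a b).
Proof. exact: continuous_is_derive (is_derive_exp_sin a b). Qed.

Lemma FTC_is_derive (f df : R -> R) (s x : R) : s < x -> continuous df ->
  (forall t, is_derive t 1 f (df t)) ->
  \int[@lebesgue_measure R]_(t in `]s, x[) df t = f x - f s.
Proof.
move=> sx cdf h.
have cf := continuous_is_derive h.
have mdf : measurable_fun [set: measurableTypeR R] df.
  exact: continuous_measurable_fun.
have mE (A : set R) : measurable_fun (A : set (measurableTypeR R)) (EFin \o df).
  by apply/measurable_EFinP; apply: measurable_funS mdf.
rewrite /Rintegral integral_itv_bndo_bndc; last exact: mE.
rewrite integral_itv_obnd_cbnd; last exact: mE.
rewrite (@continuous_FTC2 _ df f) //.
- exact: continuous_subspaceT.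
- split.
  + by move=> y _; have [] := h y.
  + by apply: cvg_at_right_filter; exact: cf.
  + by apply: cvg_at_left_filter; exact: cf.
- by move=> y _; rewrite derive1E; have [_] := h y.
Qed.

End ComplexExp.

(** * Primitives of square integrable functions *)

Section Primitive.
Variable R : realType.
Local Notation C := R[i].
Local Notation leb := (@lebesgue_measure R).
Local Notation mu := (mu02pi R).
Local Notation TR := (measurableTypeR R).
Local Notation D := (`]0, 2 * (pi : R)[ : set R).
Local Notation sq := (sqint mu).
Local Notation cmeas := (@cmeasurable _ TR R).
Implicit Types w : C.

Lemma FTC_ce w (s x : R) : s < x ->
  cintegral leb `]s, x[ (fun t => 'i * w * ce w t) = ce w x - ce w s.
Proof.
move=> sx; case: w => a b; rewrite /cintegral.
have E t : 'i * Complex a b * ce (Complex a b) t =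
  Complex (- b * exp_cos a b t - a * exp_sin a b t) (- b * exp_sin a b t + a * exp_cos a b t).
  rewrite ceE -complexiE /= -/(exp_cos a b t) -/(exp_sin a b t).
  by apply/eqP; rewrite eq_complex /=; apply/andP; split; apply/eqP; ring.
have -> : \int[leb]_(t in `]s, x[) Re ('i * Complex a b * ce (Complex a b) t) =
    exp_cos a b x - exp_cos a b s.
  have cd : continuous (fun t => - b * exp_cos a b t - a * exp_sin a b t).
    move=> t; apply: cvgB; apply: cvgM; try exact: cvg_cst.
      exact: continuous_exp_cos.
    exact: continuous_exp_sin.
  rewrite -(FTC_is_derive sx cd (is_derive_exp_cos a b)).
  by apply: eq_Rintegral => t _; rewrite E.
have -> : \int[leb]_(t in `]s, x[) Im ('i * Complex a b * ce (Complex a b) t) =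
    exp_sin a b x - exp_sin a b s.
  have cd : continuous (fun t => - b * exp_sin a b t + a * exp_cos a b t).
    move=> t; apply: cvgD; apply: cvgM; try exact: cvg_cst.
      exact: continuous_exp_sin.
    exact: continuous_exp_cos.
  rewrite -(FTC_is_derive sx cd (is_derive_exp_sin a b)).
  by apply: eq_Rintegral => t _; rewrite E.
by rewrite !ceE.
Qed.

Lemma cmeas_ce w : cmeas (ce w).
Proof.
split.
  have -> : (fun x => Re (ce w x)) = exp_cos (Re w) (Im w) by apply/funext => x; rewrite ceE.
  by apply: continuous_measurable_fun; exact: continuous_exp_cos.
have -> : (fun x => Im (ce w x)) = exp_sin (Re w) (Im w) by apply/funext => x; rewrite ceE.
by apply: continuous_measurable_fun; exact: continuous_exp_sin.
Qed.

Lemma D_itv t : D t -> 0 < t /\ t < 2 * pi.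
Proof. by rewrite /= in_itv /= => /andP. Qed.

Lemma normc_ce_le w t : D t -> normc (ce w t) <= expR (`|Im w| * (2 * pi)).
Proof.
move=> /D_itv [t0 t2]; rewrite normc_ce ler_expR.
apply: le_trans (ler_norm _) _; rewrite normrM normrN (ger0_norm (ltW t0)).
by rewrite ler_wpM2l // ltW.
Qed.

Lemma sq_ce w : (ce w : TR -> C) \in sq.
Proof. by apply: sq_bounded (cmeas_ce w) _ => t; exact: normc_ce_le. Qed.

Lemma sq_mul_ce (f : TR -> C) w : f \in sq -> (fun t => f t * ce w t) \in sq.
Proof. by move=> fs; apply: sq_mulb fs (cmeas_ce w) _ => t; exact: normc_ce_le. Qed.

(** Since [mu] lives on (0, 2 pi), this is defined for every real x and constant outside that
    interval; the Hoelder estimate therefore needs no range condition. *)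
Definition prim (g : TR -> C) (x : R) : C := cint (fun t => g t * chi 0 x t).

Lemma prim0 g : prim g 0 = 0.
Proof.
rewrite /prim (_ : (fun t => _) = (fun t => 0 * g t)).
  have [->|] := eqVneq g (fun=> 0); last by move=> _; rewrite /cint /cintegral;
    under eq_Rintegral do rewrite mul0r; under [X in Complex _ X]eq_Rintegral do rewrite mul0r;
    rewrite !Rintegral_cst // !mul0r.
  by rewrite cintZ ?sq_cst // mul0r.
apply/funext => t; rewrite /chi; case: ltP => t0 /=; last by rewrite mulr0 mul0r.
by rewrite ltNge (ltW t0) mulr0 mul0r.
Qed.

Lemma prim_H1 (g : TR -> C) x : x <= 2 * pi -> cintegral leb `]0, x[ g = prim g x.
Proof. by move=> x2; rewrite /prim cint_chi. Qed.

Lemma prim_2pi (g : TR -> C) : g \in sq -> prim g (2 * pi) = cint g.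
Proof.
move=> gs; apply: eq_cint_D => //; first exact: sq_mul_chi.
by move=> t /D_itv [t0 t2]; rewrite /chi t0 t2 mulr1.
Qed.

Lemma chiJ a b (t : TR) : (chi a b t : C)^* = chi a b t.
Proof. by rewrite /chi conjC_nat. Qed.

Lemma nrm2_chi (x y : R) : x <= y ->
  nrm2 (dot02pi R) (cls (sq_chi 0 y) - cls (sq_chi 0 x)) <= y - x.
Proof.
move=> xy; rewrite -lee_fin.
have sB : (fun t : TR => chi 0 y t - chi 0 x t : C) \in sq by apply: sqB; exact: sq_chi.
rewrite (@nrm2_ae _ _ _ mu _ _ sB); last first.
  have h1 := L2B (cls (sq_chi 0 y)) (cls (sq_chi 0 x)).
  by apply: filterS3 h1 (clsE (sq_chi 0 y)) (clsE (sq_chi 0 x)) => t -> -> ->.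
apply: (@le_trans _ _ (\int[mu]_t (\1_(`[x, y[) t)%:E)%E).
  apply: le_integral_D => //.
  - by apply: measurable_normc2; exact: (sqint_cmeasurable sB).
  - by move=> t; exact: sqr_ge0.
  move=> t _; rewrite indicE mem_setE in_itv /chi.
  case: (ltP 0 t) => t0; rewrite ?andFb ?andTb; last by rewrite subrr normc0 expr0n.
  case: (ltP t y) => ty; case: (ltP t x) => tx.
  - by rewrite subrr normc0 expr0n.
  - by rewrite subr0 normc1 expr1n /= tx ty.
  - by have := lt_le_trans tx xy; rewrite ltNge ty.
  - by rewrite subrr normc0 expr0n.
rewrite integral_indic //.
apply: (@le_trans _ _ (leb `[x, y[)).
  rewrite setIT -[mu _]/(leb (`[x, y[ `&` D)).
  apply: le_measure; rewrite ?inE; [|exact: measurable_itv|exact: subIsetl].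
  exact: (measurableI _ _ (measurable_itv _) (measurable_itv _)).
by rewrite lebesgue_measure_itv /= lte_fin; case: ifP => // _; rewrite lee_fin subr_ge0.
Qed.

Lemma prim_dot (g : TR -> C) (gs : g \in sq) x :
  prim g x = dot02pi R (cls gs) (cls (sq_chi 0 x)).
Proof.
rewrite (dot_cint gs (sq_chi 0 x)); [|exact: clsE|exact: clsE].
by apply: eq_cint => t; rewrite chiJ.
Qed.

(** The value at x is the inner product of g with the indicator of (0, x), and two such indicators
    differ by at most |x - y| in squared norm. *)
Lemma prim_hoelder (g : TR -> C) (gs : g \in sq) x y :
  normc (prim g x - prim g y) <= nrm (dot02pi R) (cls gs) * Num.sqrt `|x - y|.
Proof.
wlog xy : x y / y <= x.
  move=> W; case: (leP y x) => [|/ltW] h; first exact: W.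
  by rewrite -normcN opprB distrC; exact: W.
rewrite !(prim_dot gs) -dotBr; apply: le_trans (cauchy_schwarz _ _ _) _.
rewrite ler_wpM2l ?nrm_ge0 // ger0_norm ?subr_ge0 //.
by rewrite ler_wsqrtr // nrm2_chi.
Qed.

End Primitive.

(** * Integration by parts against exponentials *)

Section ProductRule.
Variable R : realType.
Local Notation C := R[i].
Local Notation leb := (@lebesgue_measure R).
Local Notation mu := (mu02pi R).
Local Notation TR := (measurableTypeR R).
Local Notation D := (`]0, 2 * (pi : R)[ : set R).
Local Notation sq := (sqint mu).
Local Notation cmeas := (@cmeasurable _ TR R).
Implicit Types w c : C.

Lemma hoelder_continuous (f : R -> R) (M : R) : 0 <= M ->
  (forall x y, `|f x - f y| <= M * Num.sqrt `|x - y|) -> continuous f.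
Proof.
move=> M0 h x; apply/cvgrPdist_le => eps e0.
pose d := (eps / (M + 1)) ^+ 2.
have d0 : 0 < d by rewrite exprn_gt0 // divr_gt0 // ltr_wpDl.
have hd : \forall t \near x, `|x - t| <= d.
  have /cvgrPdist_le : (fun t : R => t) @ x --> x by exact: cvg_id.
  by apply.
apply: filterS hd => t ht; apply: le_trans (h x t) _.
have : Num.sqrt `|x - t| <= eps / (M + 1).
  rewrite -[leRHS]ger0_norm ?divr_ge0 ?addr_ge0 ?(ltW e0) // -[leRHS]sqrtr_sqr ler_wsqrtr //.
have : 0 <= eps / (M + 1) by rewrite divr_ge0 ?addr_ge0 ?(ltW e0).
have : eps / (M + 1) * (M + 1) = eps by rewrite divfK // gt_eqF // ltr_wpDl.
have := sqrtr_ge0 `|x - t|; nra.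
Qed.

Lemma prim_Re_continuous (g : TR -> C) : g \in sq -> continuous (fun x => Re (prim g x)).
Proof.
move=> gs; apply: (@hoelder_continuous _ (nrm (dot02pi R) (cls gs))); first exact: nrm_ge0.
move=> x y; have -> : Re (prim g x) - Re (prim g y) = Re (prim g x - prim g y) by rewrite ReD' ReN'.
exact: le_trans (ge_Re _) (prim_hoelder gs x y).
Qed.

Lemma Im_ReNi (z : C) : Im z = Re (- 'i * z).
Proof. by rewrite -complexiE; case: z => a b /=; ring. Qed.

Lemma prim_Im_continuous (g : TR -> C) : g \in sq -> continuous (fun x => Im (prim g x)).
Proof.
move=> gs; apply: (@hoelder_continuous _ (nrm (dot02pi R) (cls gs))); first exact: nrm_ge0.
move=> x y; have -> : Im (prim g x) - Im (prim g y) = Re (- 'i * (prim g x - prim g y)).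
  by rewrite !Im_ReNi mulrBr ReD' ReN'.
apply: le_trans (ge_Re _) _; rewrite normcM normcN.
have -> : normc ('i : C) = 1 by rewrite -complexiE /= expr0n expr1n add0r sqrtr1.
by rewrite mul1r prim_hoelder.
Qed.

Lemma cmeas_prim (g : TR -> C) : g \in sq -> cmeas (prim g).
Proof.
move=> gs; split; apply: continuous_measurable_fun.
  exact: prim_Re_continuous.
exact: prim_Im_continuous.
Qed.

Lemma normc_prim_le (g : TR -> C) (gs : g \in sq) (x : R) : 0 <= x -> x <= 2 * pi ->
  normc (prim g x) <= nrm (dot02pi R) (cls gs) * Num.sqrt (2 * pi).
Proof.
move=> x0 x2; rewrite -[prim g x]subr0 -(prim0 g).
apply: le_trans (prim_hoelder gs _ _) _; rewrite ler_wpM2l ?nrm_ge0 //.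
by rewrite ler_wsqrtr // subr0 ger0_norm.
Qed.

Lemma sq_prim (g : TR -> C) : g \in sq -> (prim g : TR -> C) \in sq.
Proof.
move=> gs; apply: sq_bounded (cmeas_prim gs) _ => t /D_itv [t0 t2].
by apply: (normc_prim_le gs); exact: ltW.
Qed.

Lemma primD (f g : TR -> C) x : f \in sq -> g \in sq ->
  prim (fun t => f t + g t) x = prim f x + prim g x.
Proof.
move=> fs gs; rewrite -cintD ?sq_mul_chi //.
by apply: eq_cint => t; rewrite mulrDl.
Qed.

Lemma primZ c (f : TR -> C) x : f \in sq -> prim (fun t => c * f t) x = c * prim f x.
Proof.
move=> fs; rewrite -cintZ ?sq_mul_chi //.
by apply: eq_cint => t; rewrite mulrA.
Qed.

Lemma prim_ce w x : 0 <= x -> x <= 2 * pi ->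
  prim (fun t => 'i * w * ce w t) x = ce w x - 1.
Proof.
rewrite le_eqVlt => /orP[/eqP <- _|x0 x2]; first by rewrite prim0 ce0 subrr.
by rewrite -prim_H1 // FTC_ce // ce0.
Qed.

(** Fubini on the triangle leaves an inner integral of the exponential, evaluated by the fundamental
    theorem; differentiability of [prim g] is never invoked. *)
Lemma prim_ibp (g : TR -> C) w x : g \in sq -> 0 <= x -> x <= 2 * pi ->
  prim (fun t => 'i * w * ce w t * prim g t) x =
  ce w x * prim g x - prim (fun t => g t * ce w t) x.
Proof.
move=> gs x0 x2.
have fs : (fun t : TR => 'i * w * ce w t : C) \in sq by apply: sqZ; exact: sq_ce.
have gcs := sq_mul_ce w gs.
transitivity (cint (fun t => 'i * w * ce w t * chi 0 x t * prim g t)).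
  by apply: eq_cint => t; ring.
rewrite (cint_fubini_chi x gs fs) -cintZ ?sq_mul_chi // -cintB ?sqZ ?sq_mul_chi //.
apply: eq_cint => s.
have [/andP[s0 sx]|/negPf h] := boolP ((0 < s) && (s < x)).
  rewrite cint_chi ?(ltW s0) // FTC_ce //; ring.
have -> : chi 0 x s = 0 :> C by rewrite /chi h.
ring.
Qed.

(** The integrated product rule for F exp(i w x) with F = c + prim g. Solving the resolvent
    equation, its uniqueness and the role of Delta all rest on it. *)
Lemma prim_mul_ce c (g : TR -> C) w x : g \in sq -> 0 <= x -> x <= 2 * pi ->
  ce w x * (c + prim g x) =
  c + prim (fun t => g t * ce w t + 'i * w * ce w t * (c + prim g t)) x.
Proof.
move=> gs x0 x2.
have E : (fun t : TR => g t * ce w t + 'i * w * ce w t * (c + prim g t)) =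
   (fun t => g t * ce w t + (c * ('i * w * ce w t) + 'i * w * ce w t * prim g t)).
  by apply/funext => t; ring.
have s1 := sq_mul_ce w gs.
have s2 : (fun t : TR => 'i * w * ce w t : C) \in sq by apply: sqZ; exact: sq_ce.
have s3 : (fun t : TR => 'i * w * ce w t * prim g t : C) \in sq.
  have := sqZ ('i * w) (sq_mul_ce w (sq_prim gs)).
  by congr (_ \in sq); apply/funext => t; ring.
rewrite E (primD _ s1 (sqD (sqZ c s2) s3)) (primD _ (sqZ c s2) s3) (primZ c _ s2).
rewrite prim_ibp // prim_ce //; ring.
Qed.

End ProductRule.

(** * Completeness of the Fourier system *)

Section Peak.
Variable R : realType.
Local Notation C := R[i].
Local Notation leb := (@lebesgue_measure R).
Local Notation mu := (mu02pi R).
Local Notation TR := (measurableTypeR R).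
Local Notation D := (`]0, 2 * (pi : R)[ : set R).
Local Notation sq := (sqint mu).
Local Notation cmeas := (@cmeasurable _ TR R).
Implicit Types w c : C.

Lemma sqrt_le (x y : R) : 0 <= y -> x <= y ^+ 2 -> Num.sqrt x <= y.
Proof. by move=> y0 h; rewrite -[leRHS]ger0_norm // -[leRHS]sqrtr_sqr ler_wsqrtr. Qed.

Lemma cos_anti (d z : R) : 0 <= d -> d <= z -> z <= pi -> cos z <= cos d.
Proof.
move=> d0; rewrite le_eqVlt => /orP[/eqP -> //|dz zpi]; apply: ltW.
by rewrite ltr_cos // in_itv /=; apply/andP; split; lra.
Qed.

Lemma le_cos_far (d y : R) : 0 <= d -> d <= pi -> d <= y -> y <= 2 * pi - d -> cos y <= cos d.
Proof.
move=> d0 dpi dy y2.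
case: (leP y pi) => ypi; first exact: cos_anti.
have -> : cos y = cos (2 * pi - y).
  by rewrite cosB (mulr_natl pi 2) cos2pi sin2pi mul1r mul0r addr0.
apply: cos_anti => //; lra.
Qed.

(* A trigonometric polynomial whose powers concentrate at x0 (modulo 2 pi), so that
   a Hoelder function orthogonal to the Fourier system vanishes at x0. *)
Definition bump (x0 t : R) : R := (1 + cos (t - x0)) / 2.

Lemma bump_ge0 x0 t : 0 <= bump x0 t.
Proof. by rewrite /bump divr_ge0 //; have := cos_geN1 (t - x0); lra. Qed.

Lemma bump_le1 x0 t : bump x0 t <= 1.
Proof. by rewrite /bump; have := cos_le1 (t - x0); lra. Qed.

Lemma bump_ce x0 t : (bump x0 t)%:C%C =
  2^-1 + 4^-1 * ce (- 1) x0 * ce 1 t + 4^-1 * ce 1 x0 * ce (-1) t :> C.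
Proof.
have -> : (bump x0 t)%:C%C = 2^-1 + 4^-1 * (2 * (cos (t - x0))%:C%C) :> C.
  rewrite /bump rcM rcD; have -> : ((2^-1 : R)%:C%C = 2^-1 :> C) by rewrite fmorphV rmorph_nat.
  by field.
have -> : 2 * (cos (t - x0))%:C%C = ce 1 (t - x0) + ce (-1) (t - x0) :> C.
  rewrite !ceE /=; apply/eqP; rewrite eq_complex /= !oppr0 !mul0r !expR0 !mul1r !mulN1r cosN sinN.
  by apply/andP; split; apply/eqP; ring.
have ceB w : ce w (t - x0) = ce w t * ce (- w) x0.
  by rewrite -cexpD; congr cexp; rewrite rcB; ring.
by rewrite !ceB opprK; ring.
Qed.

Lemma cmeas_bump x0 k : cmeas (fun t => (bump x0 t ^+ k)%:C%C).
Proof.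
split; last exact: measurable_cst.
have h : continuous (bump x0).
  move=> s; apply: cvgM; last exact: cvg_cst.
  apply: cvgD; first exact: cvg_cst.
  apply: continuous_comp; last exact: continuous_cos.
  by apply: cvgB; [exact: cvg_id | exact: cvg_cst].
apply: continuous_measurable_fun; change (continuous (fun t => bump x0 t ^+ k)).
elim: k => [|k IH]; first by under eq_fun do rewrite expr0; move=> s; exact: cvg_cst.
under eq_fun do rewrite exprS.
by move=> s; apply: cvgM; [exact: h | exact: IH].
Qed.

Lemma sq_mul_bump (f : TR -> C) x0 k : f \in sq -> (fun t => f t * (bump x0 t ^+ k)%:C%C) \in sq.
Proof.
move=> fs; apply: (sq_mulb (B := 1) fs (cmeas_bump x0 k)) => t _.
by rewrite normc_real ger0_norm ?exprn_ge0 ?bump_ge0 // exprn_ile1 ?bump_ge0 ?bump_le1.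
Qed.

Lemma bump_orth (G : TR -> C) x0 k (n : int) : G \in sq ->
  (forall n : int, cint (fun t => G t * ce n%:~R t) = 0) ->
  cint (fun t => G t * ce n%:~R t * (bump x0 t ^+ k)%:C%C) = 0.
Proof.
move=> Gs h; elim: k n => [|k IH] n.
  by rewrite -(h n); apply: eq_cint => t; rewrite expr0 mulr1.
pose T (m : int) := fun t : TR => G t * ce m%:~R t * (bump x0 t ^+ k)%:C%C.
have Ts m : T m \in sq by apply: sq_mul_bump; exact: sq_mul_ce.
transitivity (cint (fun t => 2^-1 * T n t + ((4^-1 * ce (-1) x0) * T (n + 1) t +
     (4^-1 * ce 1 x0) * T (n - 1) t))).
  apply: eq_cint => t; rewrite /T exprS rcM bump_ce intrD intrB !ceD; ring.
by rewrite cintD ?cintD ?cintZ ?sqD ?sqZ // !IH !mulr0 !addr0.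
Qed.

Lemma cint_Re_ge0 (v : TR -> C) : v \in sq -> (forall t, D t -> 0 <= Re (v t)) -> 0 <= Re (cint v).
Proof.
move=> vs v0; have [iv _] := sq_cintegrable vs.
have -> : Re (cint v) = \int[mu]_t `|Re (v t)|.
  rewrite /cint /cintegral /Rintegral /=; congr fine; apply: ae_eq_integral => //.
  - exact: measurable_int iv.
  - apply/measurable_EFinP; apply: measurableT_comp => //.
    by case: (sqint_cmeasurable vs).
  - by apply: mu_aeS (@mu_ae_D R) => t /v0 h _; rewrite ger0_norm.
by apply: Rintegral_ge0 => t _; exact: normr_ge0.
Qed.

Lemma cint_cst (c : C) : cint (fun=> c) = c * (2 * pi)%:C%C.
Proof.
rewrite /cint /cintegral !Rintegral_cst // muT /=.
by case: c => a b; apply/eqP; rewrite eq_complex /= !mulr0 subr0 add0r !eqxx.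
Qed.

Lemma cint_chi1 (l r : R) : 0 <= l -> l <= r -> r <= 2 * pi -> cint (chi l r) = (r - l)%:C%C :> C.
Proof.
move=> l0 lr r2; have -> : cint (chi l r) = cint (fun t => 1 * chi l r t) :> C.
  by apply: eq_cint => t; rewrite mul1r.
rewrite cint_chi // /cintegral /= !Rintegral_cst //= mul0r mul1r.
rewrite lebesgue_measure_itv /= lte_fin; case: ltP => //= h.
by have -> : r - l = 0 by lra.
Qed.

(** If G(x0) were nonzero, u = Re(conj(G(x0)) G) would be at least a > 0 near x0. Against bump^k the
    near part contributes at least a d r2^k and the far part at worst -2 pi B r1^k with r1 < r2,
    while the total is 0; large k is contradictory. *)
Lemma peak_zero (G : TR -> C) (M : R) : G \in sq -> 0 <= M ->
  (forall x y, normc (G x - G y) <= M * Num.sqrt `|x - y|) ->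
  (forall n : int, cint (fun t => G t * ce n%:~R t) = 0) ->
  forall x0, D x0 -> G x0 = 0.
Proof.
move=> Gs M0 GM Gorth x0 /D_itv [x00 x02].
apply/eqP; apply: contraT => Gx0.
pose N := normc (G x0).
have N0 : 0 < N by rewrite lt_neqAle normc_ge0 eq_sym normc_eq0 Gx0.
pose a := N ^+ 2 / 2.
have a0 : 0 < a by rewrite divr_gt0 // exprn_gt0.
pose u t := Re ((G x0)^* * G t).
have uN t : `|u t - N ^+ 2| <= N * (M * Num.sqrt `|t - x0|).
  have -> : u t - N ^+ 2 = Re ((G x0)^* * (G t - G x0)).
    have -> : N ^+ 2 = Re ((G x0)^* * G x0) by rewrite mulrC -sqr_normcE.
    by rewrite mulrBr ReD' ReN'.
  apply: le_trans (ge_Re _) _; rewrite normcM normcJ ler_wpM2l ?normc_ge0 //.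
(* Within distance e of x0, u deviates from N^2 by at most N M sqrt(e) <= a = N^2 / 2. *)
pose e := (a / (N * M + 1)) ^+ 2.
have NM : 0 < N * M + 1 by rewrite ltr_wpDl // mulr_ge0 // ltW.
have e0 : 0 < e by rewrite exprn_gt0 // divr_gt0.
pose d := Num.min e (Num.min x0 (2 * pi - x0)).
have d0 : 0 < d by rewrite !lt_min e0 x00 subr_gt0.
have [de [dx dx2]] : d <= e /\ d <= x0 /\ d <= 2 * pi - x0.
  by rewrite /d; split; [rewrite ge_min lexx | split; rewrite !ge_min lexx ?orbT].
have dpi : d <= pi by lra.
have ua t : `|t - x0| <= d -> a <= u t.
  move=> td; have := uN t.
  have : N * (M * Num.sqrt `|t - x0|) <= a.
    have : Num.sqrt `|t - x0| <= a / (N * M + 1).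
      by apply: sqrt_le; [rewrite ltW // divr_gt0|exact: le_trans td de].
    have : a / (N * M + 1) * (N * M + 1) = a by rewrite divfK // gt_eqF.
    have : 0 < a / (N * M + 1) by rewrite divr_gt0.
    have : 0 <= N * M by rewrite mulr_ge0 // ltW.
    rewrite mulrA; have := sqrtr_ge0 `|t - x0|; nra.
  by rewrite ler_norml => h /andP[h1 h2]; rewrite /a in h *; lra.
pose B := N * (N + M * Num.sqrt (2 * pi)).
have B0 : 0 <= B by rewrite mulr_ge0 ?addr_ge0 ?mulr_ge0 ?sqrtr_ge0 // ltW.
have uB t : D t -> - B <= u t.
  move=> /D_itv [t0 t2]; have := uN t.
  have : N * (M * Num.sqrt `|t - x0|) <= N * (M * Num.sqrt (2 * pi)).
    rewrite ler_wpM2l ?(ltW N0) // ler_wpM2l // ler_wsqrtr // ler_norml.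
    by apply/andP; split; lra.
  by rewrite ler_norml => h /andP[h1 h2]; rewrite /B; nra.
(* The values of the bump at distances d and d / 2 from x0. *)
pose r1 := (1 + cos d) / 2; pose r2 := (1 + cos (d / 2)) / 2.
have r10 : 0 <= r1 by rewrite divr_ge0 //; have := cos_geN1 d; lra.
have r12 : r1 < r2.
  rewrite ltr_pM2r ?invr_gt0 // ltrD2l ltr_cos; first lra.
    by rewrite in_itv /=; apply/andP; split; lra.
  by rewrite in_itv /=; apply/andP; split; lra.
have near2 t : `|t - x0| < d / 2 -> r2 <= bump x0 t.
  move=> td; rewrite ler_pM2r // lerD2l.
  rewrite -(cos_norm (t - x0)).
  by apply: cos_anti; [exact: normr_ge0|exact: ltW|lra].
have far t : D t -> d <= `|t - x0| -> bump x0 t <= r1.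
  move=> /D_itv [t0 t2] td; rewrite ler_pM2r // lerD2l.
  rewrite -(cos_norm (t - x0)).
  apply: le_cos_far => //; first exact: ltW.
  rewrite ler_norml; apply/andP; split; lra.
(* Integrates u bump^k >= a r2^k chi - B r1^k, where chi is the indicator of an interval of length d
   centred at x0. *)
have key k : a * d * r2 ^+ k <= B * (2 * pi) * r1 ^+ k.
  have s1 : (fun t : TR => G t * (bump x0 t ^+ k)%:C%C) \in sq by exact: sq_mul_bump.
  have s2 := sqZ (G x0)^* s1.
  have E t : Re ((G x0)^* * (G t * (bump x0 t ^+ k)%:C%C)) = u t * bump x0 t ^+ k.
    by rewrite /u mulrA [in LHS]mulrC ReE' mulrC.
  have c2 : cint (fun t => (G x0)^* * (G t * (bump x0 t ^+ k)%:C%C)) = 0.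
    rewrite cintZ // (_ : cint _ = 0) ?mulr0 // -[RHS](bump_orth x0 k 0 Gs Gorth).
    by apply: eq_cint => t; rewrite c0e mulr1.
  pose l := x0 - d / 2; pose r := x0 + d / 2.
  have s3 : (fun t : TR => (a * r2 ^+ k)%:C%C * chi l r t : C) \in sq.
    by apply: sqZ; exact: sq_chi.
  have s4 := sq_cst (R := R) (B * r1 ^+ k)%:C%C.
  have := cint_Re_ge0 (sqD (sqB s2 s3) s4).
  rewrite (cintD (sqB s2 s3) s4) (cintB s2 s3) c2 (cintZ _ (sq_chi l r)) cint_cst.
  rewrite cint_chi1 //; [|rewrite /l; lra|rewrite /l /r; lra|rewrite /r; lra].
  have -> : r - l = d by rewrite /l /r; lra.
  rewrite sub0r ReD' ReN' -!rcM /= => h.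
  suff : 0 <= - (a * r2 ^+ k * d) + B * r1 ^+ k * (2 * pi) by lra.
  apply: h => t Dt; rewrite !ReD' ReN' E /=.
  have q0 := bump_ge0 x0 t.
  have -> : Re ((a * r2 ^+ k)%:C%C * chi l r t) = a * r2 ^+ k * ((l < t) && (t < r))%:R.
    by rewrite chiE ReE' /= indicE mem_setE in_itv.
  have r2k : 0 <= a * r2 ^+ k by rewrite mulr_ge0 ?exprn_ge0 ?(ltW a0) // (le_trans r10) // ltW.
  have r1k : 0 <= B * r1 ^+ k by rewrite mulr_ge0 ?exprn_ge0.
  case: (ltP `|t - x0| d) => td.
    have ut := ua t (ltW td).
    have [/andP[lt tr]|_] := boolP ((l < t) && (t < r)); last first.
      by rewrite mulr0 subr0 addr_ge0 // mulr_ge0 ?exprn_ge0 // (le_trans _ ut) // ltW.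
    rewrite mulr1 addr_ge0 // subr_ge0.
    apply: ler_pM; rewrite ?exprn_ge0 ?(ltW a0) ?(le_trans r10 (ltW r12)) //.
    rewrite lerXn2r ?nnegrE // ?(le_trans r10 (ltW r12)) // near2 //.
    by rewrite ltr_norml; apply/andP; split; rewrite /l /r in lt tr; lra.
  have -> : ((l < t) && (t < r)) = false.
    apply/negP => /andP[lt tr]; move: td; apply/negP; rewrite -ltNge ltr_norml.
    by apply/andP; split; rewrite /l /r in lt tr; lra.
  rewrite mulr0 subr0 -lerBlDr sub0r.
  apply: (@le_trans _ _ (- B * bump x0 t ^+ k)).
    by rewrite mulNr lerN2 ler_wpM2l // lerXn2r ?nnegrE // far.
  by rewrite ler_wpM2r ?exprn_ge0 // uB.
have r20 : 0 < r2 by exact: le_lt_trans r10 r12.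
have q0 : 0 <= r1 / r2 by rewrite divr_ge0 // ltW.
have q1 : r1 / r2 < 1 by rewrite ltr_pdivrMr // mul1r.
have B2 : 0 <= B * (2 * pi) by rewrite mulr_ge0 // ltW // pi2_gt0.
have c0 : 0 < a * d / (B * (2 * pi) + 1).
  by apply: divr_gt0; [exact: mulr_gt0 | exact: ltr_wpDl].
have /cvgrPdist_lt /(_ _ c0) [k _ hk] : ((fun n => (r1 / r2) ^+ n) @ \oo --> (0:R))%classic.
  by apply: cvg_expr; rewrite ger0_norm.
have := hk k (leqnn _); rewrite /= sub0r normrN ger0_norm ?exprn_ge0 // expr_div_n => h.
have r2k : 0 < r2 ^+ k by rewrite exprn_gt0.
have := key k.
have h2 : r1 ^+ k * (B * (2 * pi) + 1) < a * d * r2 ^+ k.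
  by move: h; rewrite ltr_pdivrMr // mulrAC ltr_pdivlMr ?ltr_wpDl.
have r1k : 0 <= r1 ^+ k by rewrite exprn_ge0.
nra.
Qed.
End Peak.

(** * Functions orthogonal to all exponentials vanish *)

Section Totality.
Variable R : realType.
Local Notation C := R[i].
Local Notation leb := (@lebesgue_measure R).
Local Notation mu := (mu02pi R).
Local Notation TR := (measurableTypeR R).
Local Notation D := (`]0, 2 * (pi : R)[ : set R).
Local Notation sq := (sqint mu).
Local Notation cmeas := (@cmeasurable _ TR R).
Implicit Types w c : C.

(** Extended by 0, h has vanishing integral over every half-line ending at x; almost everywhere h is
    the derivative of that integral. *)
Lemma ae_zero_indefinite_integral (h : R -> R) : leb.-integrable D (EFin \o h) ->
  (forall x, 0 <= x -> x <= 2 * pi -> \int[leb]_(t in `]0, x[) h t = 0) ->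
  {ae mu, forall x, h x = 0}.
Proof.
move=> hi h0; pose f := h \_ D.
have fi : leb.-integrable setT (EFin \o f).
  by rewrite /f -restrict_EFin -integrable_mkcond.
have F0 x : \int[leb]_(t in `]-oo, x]) f t = 0.
  have -> : \int[leb]_(t in `]-oo, x]) f t = \int[leb]_(t in `]-oo, x] `&` D) h t.
    by rewrite [RHS]Rintegral_mkcondr.
  have [x0|x0] := leP x 0.
    have -> : `]-oo, x] `&` D = set0.
      by apply/seteqP; split => // t /= []; rewrite !in_itv /= => tx /andP[t0 _]; lra.
    by rewrite Rintegral_set0.
  have [x2|x2] := leP (2 * pi) x.
    have -> : `]-oo, x] `&` D = D; last by apply: h0; rewrite ?(ltW (pi2_gt0 R)).
    apply/seteqP; split => t /=; rewrite !in_itv /=; first by case.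
    by move=> /andP[t0 t2]; rewrite t0 t2; split => //; lra.
  have -> : `]-oo, x] `&` D = `]0, x].
    apply/seteqP; split => t /=; rewrite !in_itv /=.
      by move=> [tx /andP[-> _]].
    by move=> /andP[t0 tx]; rewrite t0 tx; split => //=; lra.
  rewrite -Rintegral_itv_bndo_bndc ?h0 // ?ltW //.
  apply: integrableS hi => //.
  by move=> t /=; rewrite !in_itv /= => /andP[-> tx] /=; lra.
have loc : locally_integrable [set: R] f.
  exact: integrable_locally.
have hN y : leb.-integrable `]-oo, y] (EFin \o f) by apply: integrableS fi.
have := FTC1Ny hN loc.
move=> [A [mA A0 HA]].
have mu0 : mu A = 0.
  apply/eqP; rewrite eq_le measure_ge0 andbT -[mu A]/(leb (A `&` D)).
  by rewrite -A0; apply: le_measure; rewrite ?inE //; exact: measurableI.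
have f0 : {ae mu, forall x : TR, f x = 0}.
  exists A; split => // x /= fx; apply: HA => /= -[_].
  rewrite (_ : (fun x => _) = cst 0); last by apply/funext => y; exact: F0.
  by rewrite derive1_cst => /esym.
have := mu_ae_D R; move: f0; apply: filterS2 => x.
by rewrite /f patchE mem_setE => + Dx; rewrite Dx.
Qed.

Lemma prim_eq0 (g : L2pi R) : (forall x, 0 <= x -> x <= 2 * pi -> prim g x = 0) -> g = 0.
Proof.
move=> g0; have gs := L2_sqint g; have [ir ii] := sq_cintegrable gs.
have mi (h : TR -> R) : mu.-integrable setT (EFin \o h) -> leb.-integrable D (EFin \o h).
  have mD : measurable (D : set TR) by exact: measurable_itv.
  move=> ih; have /integrableP [mh fh] := integrableS measurableT mD (@subsetT _ _) ih.
  apply/integrableP; split; first exact: mh.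
  apply: le_lt_trans fh; rewrite le_eqVlt; apply/orP; left; apply/eqP.
  by apply: eq_measure_integral => A mA AD; rewrite mu_subset.
have hr := ae_zero_indefinite_integral (mi _ ir).
have hi := ae_zero_indefinite_integral (mi _ ii).
have E x : 0 <= x -> x <= 2 * pi -> cintegral leb `]0, x[ g = 0.
  by move=> x0 x2; rewrite prim_H1 // g0.
have {}hr : {ae mu, forall x : TR, complex.Re (g x) = 0} := hr (fun x x0 x2 => congr1 (@complex.Re R) (E x x0 x2)).
have {}hi : {ae mu, forall x : TR, complex.Im (g x) = 0} := hi (fun x x0 x2 => congr1 (@complex.Im R) (E x x0 x2)).
apply: L2_eq; apply: filterS3 hr hi (L2_0 R) => x /= a b ->.
by apply/eqP; rewrite eq_complex /= a b !eqxx.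
Qed.

Lemma cint_ce_neq0 (n : int) : n != 0 -> cint (ce n%:~R) = 0 :> C.
Proof.
move=> n0; have s := sq_ce (n%:~R : C).
have := prim_ce (n%:~R : C) (ltW (pi2_gt0 R)) (lexx _).
rewrite prim_2pi ?sqZ // cintZ // ce_int_2pi subrr => /eqP.
by rewrite mulf_eq0 mulf_eq0 (negPf (neq0Ci _)) intr_eq0 (negPf n0) => /eqP.
Qed.

(** The bump argument needs Hoelder continuity, which f lacks but its primitive has. Integration by
    parts makes the primitive orthogonal to all nonconstant exponentials, so minus its mean m it
    vanishes; thus it is constant on (0, 2 pi), and zero because it starts at 0. *)
Lemma fourier_total (f : L2pi R) :
  (forall n : int, cint (fun t => f t * ce n%:~R t) = 0) -> f = 0.
Proof.
move=> h; have fs := L2_sqint f; have ps := sq_prim fs.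
(* Orthogonality to the constants removes the boundary term in the integration by parts. *)
have p2 : prim f (2 * pi) = 0.
  rewrite prim_2pi // -[RHS](h 0); apply: eq_cint => t; by rewrite c0e mulr1.
have pce (n : int) : n != 0 -> cint (fun t => prim f t * ce n%:~R t) = 0.
  move=> n0; have := prim_mul_ce 0 n%:~R fs (ltW (pi2_gt0 R)) (lexx _).
  have s1 := sq_mul_ce n%:~R fs; have s2 := sq_mul_ce n%:~R ps.
  have -> : (fun t : TR => f t * ce n%:~R t + 'i * n%:~R * ce n%:~R t * (0 + prim f t)) =
     (fun t => f t * ce n%:~R t + 'i * n%:~R * (prim f t * ce n%:~R t)).
    by apply/funext => t; ring.
  rewrite p2 primD ?sqZ // primZ // !prim_2pi // h !add0r mulr0 => /esym/eqP.
  by rewrite !mulf_eq0 (negPf (neq0Ci _)) intr_eq0 (negPf n0) => /eqP.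
pose m := cint (prim f) / (2 * pi)%:C%C.
have pi20 : (2 * pi)%:C%C != 0 :> C.
  by rewrite -normc_eq0 normc_real normr_eq0 gt_eqF ?pi2_gt0.
pose G (t : TR) := prim f t - m.
have Gs : G \in sq by exact: (sqB ps (sq_cst m)).
have Gce (n : int) : cint (fun t => G t * ce n%:~R t) = 0.
  have s1 := sq_mul_ce n%:~R ps; have s2 := sqZ m (sq_ce n%:~R).
  have -> : (fun t => G t * ce n%:~R t) = (fun t => prim f t * ce n%:~R t - m * ce n%:~R t).
    by apply/funext => t; rewrite mulrBl.
  rewrite (cintB s1 s2) (cintZ _ (sq_ce _)).
  have [->|n0] := eqVneq n 0; last by rewrite pce // cint_ce_neq0 // mulr0 subr0.
  have -> : cint (ce 0%:~R : TR -> C) = (2 * pi)%:C%C.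
    by rewrite -[RHS]mul1r -cint_cst; apply: eq_cint => t; rewrite c0e.
  rewrite divfK // (_ : cint _ = cint (prim f)) ?subrr //.
  by apply: eq_cint => t; rewrite c0e mulr1.
pose M := nrm (dot02pi R) (cls fs).
have M0 : 0 <= M by exact: nrm_ge0.
have GM x y : normc (G x - G y) <= M * Num.sqrt `|x - y|.
  have -> : G x - G y = prim f x - prim f y by rewrite /G; ring.
  exact: prim_hoelder.
have G0 := peak_zero Gs M0 GM Gce.
have pm x : D x -> prim f x = m by move=> /G0 /eqP; rewrite subr_eq0 => /eqP.
have m0 : m = 0.
  apply/eqP; rewrite -normc_eq0; apply: contraT => mN.
  have N0 : 0 < normc m by rewrite lt_neqAle normc_ge0 eq_sym mN.
  (* So close to 0 that the Hoelder bound forces |prim f x| < |m|. *)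
  pose x := Num.min pi ((normc m / (M + 1)) ^+ 2).
  have M1 : 0 < M + 1 by rewrite ltr_wpDl.
  have q0 : 0 < normc m / (M + 1) by rewrite divr_gt0.
  have x0 : 0 < x by rewrite lt_min pi_gt0 exprn_gt0.
  have xpi : x <= pi by rewrite ge_min lexx.
  have Dx : D x by rewrite /= in_itv /= x0; have := pi_gt0 R; lra.
  have sx : Num.sqrt x <= normc m / (M + 1).
    by apply: sqrt_le; [exact: ltW | rewrite ge_min lexx orbT].
  have := prim_hoelder fs x 0; rewrite prim0 !subr0 pm // (ger0_norm (ltW x0)) => hh.
  have h2 : M * Num.sqrt x <= M * (normc m / (M + 1)) by rewrite ler_wpM2l.
  have h3 : normc m / (M + 1) * (M + 1) = normc m by rewrite divfK // gt_eqF.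
  have : M * (normc m / (M + 1)) < normc m by rewrite -[ltRHS]h3 [ltRHS]mulrDr mulr1 mulrC ltrDl.
  by rewrite ltNge (le_trans hh h2).
apply: prim_eq0 => x; rewrite le_eqVlt => /orP[/eqP <- _|x0]; first exact: prim0.
rewrite le_eqVlt => /orP[/eqP -> //|x2].
by rewrite pm ?m0 //= in_itv /= x0.
Qed.
End Totality.

(** * The normalized exponentials *)

Section Fourier.
Variable R : realType.
Local Notation C := R[i].
Local Notation leb := (@lebesgue_measure R).
Local Notation mu := (mu02pi R).
Local Notation TR := (measurableTypeR R).
Local Notation D := (`]0, 2 * (pi : R)[ : set R).
Local Notation sq := (sqint mu).
Local Notation cmeas := (@cmeasurable _ TR R).
Implicit Types w c : C.
Local Notation dot := (dot02pi R).
Local Notation nrm := (nrm dot).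

Lemma nrm_bounded (f : L2pi R) (p : TR -> C) (B : R) : 0 <= B -> cmeas p ->
  (forall x, D x -> normc (p x) <= B) -> {ae mu, forall x, f x = p x} ->
  nrm f <= B * Num.sqrt (2 * pi).
Proof.
move=> B0 mp pB fp; rewrite -[B]ger0_norm // -[`|B|]sqrtr_sqr -sqrtrM ?sqr_ge0 //.
by rewrite ler_wsqrtr //; exact: nrm2_bounded mp pB fp.
Qed.

Lemma normc_cint_mul (f : L2pi R) (p : TR -> C) (B : R) : 0 <= B -> cmeas p ->
  (forall x, D x -> normc (p x) <= B) ->
  normc (cint (fun t => f t * p t)) <= nrm f * (B * Num.sqrt (2 * pi)).
Proof.
move=> B0 mp pB; have ps := sq_bounded mp pB; have js := sqJ ps.
have -> : cint (fun t => f t * p t) = dot f (cls js).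
  rewrite (dot_cint (L2_sqint f) js (aeW _ (fun x => erefl)) (clsE js)).
  by apply: eq_cint => t; rewrite conjCK.
apply: le_trans (cauchy_schwarz _ _ _) _; rewrite ler_wpM2l ?nrm_ge0 //.
apply: (nrm_bounded B0 (cmeasurableJ mp)) (clsE js) => x Dx.
by rewrite normcJ pB.
Qed.

Lemma cint_linear (p : TR -> C) a (f g : L2pi R) :
  (forall f : L2pi R, (fun t => f t * p t) \in sq) ->
  cint (fun t => (a *: f + g : L2pi R) t * p t) =
  a * cint (fun t => f t * p t) + cint (fun t => g t * p t).
Proof.
move=> hp; rewrite -(cintZ _ (hp f)) -(cintD (sqZ a (hp f)) (hp g)).
apply: ae_eq_cint; rewrite ?sqD ?sqZ //.
by apply: filterS (L2P a f g) => x ->; rewrite mulrDl mulrA.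
Qed.

Lemma cint_ce_linear w a (f g : L2pi R) :
  cint (fun t => (a *: f + g : L2pi R) t * ce w t) =
  a * cint (fun t => f t * ce w t) + cint (fun t => g t * ce w t).
Proof. by apply: cint_linear => h; exact: sq_mul_ce (L2_sqint h). Qed.

Lemma cint_ce_0 w : cint (fun t => (0 : L2pi R) t * ce w t) = 0.
Proof. by have := cint_ce_linear w (-1) 0 0; rewrite scaler0 addr0 mulN1r addNr. Qed.

Lemma cint_ce_scale w a (f : L2pi R) :
  cint (fun t => (a *: f : L2pi R) t * ce w t) = a * cint (fun t => f t * ce w t).
Proof. by have := cint_ce_linear w a f 0; rewrite cint_ce_0 !addr0. Qed.

Lemma prim_linear a (f g : L2pi R) x :
  prim (a *: f + g : L2pi R) x = a * prim f x + prim g x.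
Proof. by apply: cint_linear => h; exact: sq_mul_chi (L2_sqint h). Qed.

Definition kap : C := (Num.sqrt (2 * pi))^-1%:C%C.

Lemma kap2 : kap * kap * (2 * pi)%:C%C = 1.
Proof.
rewrite -!rcM -expr2 exprVn sqr_sqrtr ?(ltW (pi2_gt0 R)) // mulVf //.
by rewrite gt_eqF // pi2_gt0.
Qed.

Lemma kap_neq0 : kap != 0.
Proof. by apply/eqP => h; have := kap2; rewrite h !mul0r => /eqP; rewrite eq_sym oner_eq0. Qed.

Lemma sq_gvec w : (fun t : TR => kap * ce (- w^*) t) \in sq.
Proof. exact: sqZ (sq_ce _). Qed.

(* The conjugate in the frequency makes [dot f (gvec w)] the (analytic)
   Fourier integral of f against exp(i w t). *)
Definition gvec w : L2pi R := cls (sq_gvec w).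

Lemma dot_gvec (f : L2pi R) (p : TR -> C) w : p \in sq -> {ae mu, forall x, f x = p x} ->
  dot f (gvec w) = kap * cint (fun t => p t * ce w t).
Proof.
move=> ps fp; rewrite (dot_cint ps (sq_gvec w) fp (clsE _)) -(cintZ _ (sq_mul_ce w ps)).
apply: eq_cint => t; have -> : (kap * ce (- w^*) t)^* = kap * ce w t.
  by rewrite rmorphM /= ceJ /kap conj_rc rmorphN /= conjCK opprK.
ring.
Qed.

Lemma dot_gvecE (f : L2pi R) w : dot f (gvec w) = kap * cint (fun t => f t * ce w t).
Proof. exact: (dot_gvec w (L2_sqint f) (aeW _ (fun x => erefl))). Qed.

Lemma fourier_orthonormal : orthonormal_family dot (fun n : int => gvec n%:~R).
Proof.
move=> n m; rewrite (dot_gvec _ (sq_gvec _) (clsE _)).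
have -> : cint (fun t => kap * ce (- n%:~R^*) t * ce m%:~R t) = kap * cint (ce (m - n)%:~R).
  rewrite -(cintZ _ (sq_ce _)); apply: eq_cint => t.
  by rewrite -mulrA -ceD rmorph_int intrB addrC.
have [->|nm] := eqVneq n m; last first.
  by rewrite cint_ce_neq0 ?mulr0 // subr_eq0 eq_sym.
rewrite subrr (_ : cint _ = (2 * pi)%:C%C) ?mulrA ?kap2 //.
by rewrite -[RHS]mul1r -cint_cst; apply: eq_cint => t; rewrite c0e.
Qed.

Lemma fourier_basis (f : L2pi R) : (forall n : int, dot f (gvec n%:~R) = 0) -> f = 0.
Proof.
move=> h; apply: fourier_total => n; have /eqP := h n.
by rewrite dot_gvecE mulf_eq0 (negPf kap_neq0) => /eqP.
Qed.

End Fourier.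

(** * The resolvent *)

Section Resolvent.
Variable R : realType.
Local Notation C := R[i].
Local Notation leb := (@lebesgue_measure R).
Local Notation mu := (mu02pi R).
Local Notation TR := (measurableTypeR R).
Local Notation D := (`]0, 2 * (pi : R)[ : set R).
Local Notation sq := (sqint mu).
Local Notation cmeas := (@cmeasurable _ TR R).
Implicit Types w c : C.
Local Notation dot := (dot02pi R).
Local Notation nrm := (nrm dot).
Variable K : L2pi R.

(* The entire function whose zeros are the eigenvalues of P_{1,K}. *)
Definition char_fun w : C := ce w (2 * pi) - 1 - 'i * cint (fun t => K t * ce w t).

(** With F = c + prim g the periodic boundary condition becomes [cint g = 0], and c is the boundary
    value f(2 pi). *)
Lemma P1P (f k : L2pi R) : P1 K f k <-> exists c (g : L2pi R),
  [/\ {ae mu, forall x, f x = c + prim g x}, cint g = 0 & k = 'i *: g + c *: K].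
Proof.
have pi20 := ltW (pi2_gt0 R); split.
  move=> [F [g [[fF FE] F02 kE]]]; exists (F 0), g.
  have FP x : 0 <= x -> x <= 2 * pi -> F x = F 0 + prim g x.
    by move=> x0 x2; rewrite FE ?in_itv /= ?x0 // prim_H1.
  split; last by rewrite F02.
    have := mu_ae_D R; move: fF; apply: filterS2 => x -> /D_itv [x0 x2].
    by rewrite FP ?ltW.
  have := FP _ pi20 (lexx _); rewrite -F02 prim_2pi ?L2_sqint // => /eqP.
  by rewrite addrC -subr_eq subrr => /eqP.
move=> [c [g [fE g0 kE]]]; exists (fun x => c + prim g x), g.
have p0 : prim g 0 = 0 := prim0 g.
have p2 : prim g (2 * pi) = 0 by rewrite prim_2pi // L2_sqint.
split; rewrite /= ?p0 ?p2 ?addr0 //; split => // x.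
by rewrite in_itv /= => /andP[x0 x2]; rewrite prim_H1 // p0 addr0.
Qed.

Lemma P1_linear a (f f' k k' : L2pi R) : P1 K f k -> P1 K f' k' ->
  P1 K (a *: f + f') (a *: k + k').
Proof.
move=> /P1P [c [g [fE g0 kE]]] /P1P [c' [g' [fE' g0' kE']]].
apply/P1P; exists (a * c + c'), (a *: g + g'); split.
- apply: filterS3 fE fE' (L2P a f f') => x fx fx' ->; rewrite fx fx' prim_linear; ring.
- have := cint_ce_linear 0 a g g'; under [X in X = _ -> _]eq_cint do rewrite c0e mulr1.
  under [X in _ = _ * X + _ -> _]eq_cint do rewrite c0e mulr1.
  by under [X in _ = _ + X -> _]eq_cint do rewrite c0e mulr1; rewrite g0 g0' mulr0 addr0.
by rewrite kE kE' !scalerDr !scalerDl !scalerA ['i * a]mulrC addrACA.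
Qed.

(* Integrating (F exp(i w x))' over (0, 2 pi). *)
Lemma P1_char_fun (f k g : L2pi R) c w : {ae mu, forall x, f x = c + prim g x} -> cint g = 0 ->
  k = 'i *: g + c *: K ->
  'i * c * char_fun w = cint (fun t => k t * ce w t) - w * cint (fun t => f t * ce w t).
Proof.
move=> fE g0 kE; have gs := L2_sqint g; have Ks := L2_sqint K; have fs := L2_sqint f.
have Fs : (fun t : TR => c + prim g t) \in sq := sqD (sq_cst c) (sq_prim gs).
have s1 := sq_mul_ce w gs; have s2 := sq_mul_ce w Fs.
have kI : cint (fun t => k t * ce w t) =
    'i * cint (fun t => g t * ce w t) + c * cint (fun t => K t * ce w t).
  by rewrite kE cint_ce_linear cint_ce_scale.
have fI : cint (fun t => f t * ce w t) = cint (fun t => (c + prim g t) * ce w t).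
  apply: ae_eq_cint => //; first exact: sq_mul_ce.
  by apply: filterS fE => x ->.
have := prim_mul_ce c w gs (ltW (pi2_gt0 R)) (lexx _).
have -> : (fun t : TR => g t * ce w t + 'i * w * ce w t * (c + prim g t)) =
     (fun t => g t * ce w t + 'i * w * ((c + prim g t) * ce w t)).
  by apply/funext => t; ring.
rewrite primD ?sqZ // primZ // !prim_2pi // g0 addr0 -fI => h.
have -> : 'i * c * char_fun w = 'i * (ce w (2 * pi) * c - c) - 'i * 'i * (c * cint (fun t => K t * ce w t)).
  by rewrite /char_fun; ring.
rewrite h kI -expr2 sqrCi.
have -> : 'i * (c + (cint (fun t => g t * ce w t) + 'i * w * cint (fun t => f t * ce w t)) - c) =
  'i * cint (fun t => g t * ce w t) + 'i ^+ 2 * (w * cint (fun t => f t * ce w t)) by ring.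
rewrite sqrCi; ring.
Qed.

(** Single-valuedness of the relation, which gives injectivity of the resolvent: if c + prim g
    vanishes almost everywhere, [prim_mul_ce] at integer frequencies kills all Fourier coefficients
    of g, and then c = 0. *)
Lemma P1_inj (h : L2pi R) : P1 K 0 h -> h = 0.
Proof.
move=> /P1P [c [g [fE g0 kE]]]; have gs := L2_sqint g.
have z0 : {ae mu, forall x : TR, c + prim g x = 0}.
  by apply: filterS2 fE (L2_0 R) => x <- ->.
have Fs : (fun t : TR => c + prim g t) \in sq := sqD (sq_cst c) (sq_prim gs).
have gN : g = 0.
  apply: fourier_total => n.
  have := prim_mul_ce c n%:~R gs (ltW (pi2_gt0 R)) (lexx _).
  have -> : (fun t : TR => g t * ce n%:~R t + 'i * n%:~R * ce n%:~R t * (c + prim g t)) =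
     (fun t => g t * ce n%:~R t + 'i * n%:~R * ((c + prim g t) * ce n%:~R t)).
    by apply/funext => t; ring.
  have s1 := sq_mul_ce n%:~R gs; have s2 := sq_mul_ce n%:~R Fs.
  rewrite primD ?sqZ // primZ // !prim_2pi // g0 addr0 ce_int_2pi mul1r.
  rewrite (_ : cint (fun t => (c + prim g t) * _) = 0); last first.
    have -> : 0 = cint (fun=> 0) :> C by rewrite cint_cst mul0r.
    apply: ae_eq_cint => //; first exact: sq_cst.
    by apply: filterS z0 => x ->; rewrite mul0r.
  by rewrite mulr0 addr0 => h0; apply: (addrI c); rewrite addr0 -h0.
have c0 : c = 0.
  have : cint (fun t => c + prim g t) = 0.
    have -> : 0 = cint (fun=> 0) :> C by rewrite cint_cst mul0r.
    by apply: ae_eq_cint => //; exact: sq_cst.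
  rewrite (cintD (sq_cst c) (sq_prim gs)) cint_cst.
  rewrite (_ : cint (prim g) = 0) ?addr0.
    move=> /eqP; rewrite mulf_eq0 => /orP[/eqP //|].
    by rewrite -normc_eq0 normc_real normr_eq0 gt_eqF ?pi2_gt0.
  have -> : 0 = cint (fun=> 0) :> C by rewrite cint_cst mul0r.
  apply: eq_cint => x; rewrite gN.
  by have := prim_linear (-1) 0 (0 : L2pi R) x; rewrite scaler0 addr0 mulN1r addNr => ->.
by rewrite kE gN c0 scaler0 scale0r addr0.
Qed.

End Resolvent.

Section ResolventBound.
Variable R : realType.
Local Notation C := R[i].
Local Notation leb := (@lebesgue_measure R).
Local Notation mu := (mu02pi R).
Local Notation TR := (measurableTypeR R).
Local Notation D := (`]0, 2 * (pi : R)[ : set R).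
Local Notation sq := (sqint mu).
Local Notation cmeas := (@cmeasurable _ TR R).
Implicit Types w c : C.
Local Notation dot := (dot02pi R).
Local Notation nrm := (nrm dot).
Variable K : L2pi R.
Local Notation disc := (char_fun K).

Lemma normc_i : normc ('i : C) = 1.
Proof. by rewrite -complexiE /= expr0n expr1n add0r sqrtr1. Qed.

Lemma ae_eq_prim (g p : TR -> C) x : g \in sq -> p \in sq -> {ae mu, forall t : TR, g t = p t} ->
  prim g x = prim p x.
Proof.
move=> gs ps gp; apply: ae_eq_cint; rewrite ?sq_mul_chi //.
by apply: filterS gp => t ->.
Qed.

(** Variation of constants. The equation reads F' = - i (h - c K) - i z F, so F exp(i z x) has
    derivative q; requiring F(2 pi) = F(0) = c gives c Delta(z) = - i times the integral of h exp(i
    z t). *)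
Lemma P1_resolvent_ex z : disc z != 0 -> exists2 M : R, 0 <= M &
  forall h : L2pi R, exists2 f : L2pi R, P1 K f (h + z *: f) & nrm f <= M * nrm h.
Proof.
move=> dz; pose s : R := Num.sqrt (2 * pi); pose E : R := expR (`|Im z| * (2 * pi)).
have s0 : 0 <= s := sqrtr_ge0 _.
have E0 : 0 <= E := expR_ge0 _.
have pi20 := ltW (pi2_gt0 R).
(* [m1] will bound |c| and [m2] the supremum of |F|, both relative to the norm of h. *)
pose m1 := E * s / normc (disc z).
have m10 : 0 <= m1 by rewrite divr_ge0 ?normc_ge0 // mulr_ge0.
pose m2 := E * (m1 + (E * s + m1 * (nrm K * (E * s)))).
have Es0 : 0 <= E * s by rewrite mulr_ge0.
have Km : 0 <= m1 * (nrm K * (E * s)) by apply: mulr_ge0 => //; rewrite mulr_ge0 ?nrm_ge0.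
have m20 : 0 <= m2 by rewrite mulr_ge0 // addr_ge0 // addr_ge0.
exists (m2 * s); first by rewrite mulr_ge0.
move=> h; have hs := L2_sqint h; have Ks := L2_sqint K.
pose I (u : L2pi R) := cint (fun t => u t * ce z t).
pose c := - 'i * I h / disc z.
pose q (t : TR) := - 'i * (h t - c * K t) * ce z t.
have hKs : (fun t : TR => h t - c * K t) \in sq := sqB hs (sqZ c Ks).
have qs : q \in sq by apply: sq_mul_ce; exact: sqZ hKs.
pose F (t : TR) := ce (- z) t * (c + prim q t).
have Fs : F \in sq.
  have := sq_mul_ce (- z) (sqD (sq_cst c) (sq_prim qs)).
  by congr (_ \in sq); apply/funext => t; rewrite mulrC.
pose p (t : TR) := - 'i * (h t - c * K t) + - 'i * z * F t.
have ps : p \in sq by apply: sqD; exact: sqZ.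
have Fp x : 0 <= x -> x <= 2 * pi -> F x = c + prim p x.
  move=> x0 x2; rewrite (_ : p = fun t : TR =>
    q t * ce (- z) t + 'i * (- z) * ce (- z) t * (c + prim q t)).
    exact: (prim_mul_ce c (- z) qs x0 x2).
  apply/funext => t; have e1 : q t * ce (- z) t = - 'i * (h t - c * K t).
    by rewrite /q -mulrA [ce z t * _]mulrC ceN mulr1.
  by rewrite e1 /p /F; congr (_ + _); ring.
have cd : c * disc z = - 'i * I h by rewrite divfK.
have qI : cint q = - 'i * I h + 'i * c * I K.
  have -> : q = (fun t => - 'i * (h t * ce z t) + 'i * c * (K t * ce z t)).
    by apply/funext => t; rewrite /q; ring.
  have s1 := sq_mul_ce z hs; have s2 := sq_mul_ce z Ks.
  by rewrite (cintD (sqZ _ s1) (sqZ _ s2)) !cintZ.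
have F2 : F (2 * pi) = c.
  rewrite /F prim_2pi // qI -cd.
  have -> : c + (c * disc z + 'i * c * I K) = ce z (2 * pi) * c by rewrite /char_fun -/(I K); ring.
  by rewrite mulrA ceN mul1r.
have aeP x : prim (cls ps) x = prim p x.
  by apply: (ae_eq_prim x (L2_sqint _) ps); exact: clsE.
exists (cls Fs).
  apply/P1P; exists c, (cls ps); split.
  - apply: filterS2 (clsE Fs) (mu_ae_D R) => x -> /D_itv [x0 x2].
    by rewrite aeP Fp ?ltW.
  - rewrite -prim_2pi ?L2_sqint // aeP; apply: (addrI c).
    by rewrite -Fp // F2 addr0.
  - rewrite addrC; apply: L2_eq.
    have a1 : {ae mu, forall x : TR, (z *: cls Fs + h : L2pi R) x = z * F x + h x}.
      by apply: filterS2 (L2P z (cls Fs) h) (clsE Fs) => x -> ->.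
    have a2 : {ae mu, forall x : TR, ('i *: cls ps + c *: K : L2pi R) x =
        'i * p x + c * K x}.
      by apply: filterS3 (L2P 'i (cls ps) (c *: K)) (L2Z c K) (clsE ps) => x -> -> ->.
    apply: filterS2 a1 a2 => x -> ->; rewrite /p.
    have -> : 'i * (- 'i * (h x - c * K x) + - 'i * z * F x) =
      - 'i ^+ 2 * (h x - c * K x + z * F x) :> C by ring.
    by rewrite sqrCi; ring.
have cz : cmeas (ce z) := cmeas_ce z.
have zE t : D t -> normc (ce z t) <= E by exact: normc_ce_le.
have cI : normc c <= nrm h * m1.
  rewrite /c normcM normcV normcM normcN normc_i mul1r mulrA ler_wpM2r ?invr_ge0 ?normc_ge0 //.
  exact: normc_cint_mul.
have prim_le (u : L2pi R) x : normc (prim (fun t => u t * ce z t) x) <= nrm u * (E * s).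
  have -> : prim (fun t => u t * ce z t) x = cint (fun t => u t * (ce z t * chi 0 x t)).
    by apply: eq_cint => t; rewrite mulrA.
  apply: normc_cint_mul => //; first exact: cmeasurableM (cmeas_chi _ _).
  move=> t Dt; rewrite normcM -[leRHS]mulr1 ler_pM ?normc_ge0 ?zE ?normc_chi //.
have q_le x : normc (prim q x) <= nrm h * (E * s + m1 * (nrm K * (E * s))).
  have -> : prim q x = - 'i * (prim (fun t => h t * ce z t) x - c * prim (fun t => K t * ce z t) x).
    have s1 := sq_mul_ce z hs; have s2 := sq_mul_ce z Ks.
    have -> : q = (fun t => - 'i * (h t * ce z t) + 'i * c * (K t * ce z t)).
      by apply/funext => t; rewrite /q; ring.
    by rewrite primD ?sqZ // !primZ //; ring.
  rewrite normcM normcN normc_i mul1r mulrDr; apply: le_trans (normcB _ _) _.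
  rewrite lerD ?prim_le // normcM mulrA; apply: ler_pM; rewrite ?normc_ge0 //.
have F_le x : D x -> normc (F x) <= nrm h * m2.
  move=> Dx; rewrite /F /m2 mulrCA normcM; apply: ler_pM; rewrite ?normc_ge0 //.
    by apply: le_trans (normc_ce_le _ Dx) _; rewrite /E; case: (z) => a b /=; rewrite normrN.
  by apply: le_trans (normcD _ _) _; rewrite mulrDr lerD.
rewrite mulrC mulrA; apply: nrm_bounded F_le (clsE Fs).
  by rewrite mulr_ge0 ?nrm_ge0.
exact: sqint_cmeasurable Fs.
Qed.

(** [P1_char_fun] at w = z yields c Delta(z) = 0, hence c = 0; then F exp(i z x) has zero derivative
    and starts at 0. *)
Lemma P1_unique z (f : L2pi R) : disc z != 0 -> P1 K f (z *: f) -> f = 0.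
Proof.
move=> dz /P1P [c [g [fE g0 kE]]]; have gs := L2_sqint g.
have c0 : c = 0.
  have := P1_char_fun z fE g0 kE.
  rewrite cint_ce_scale subrr => /eqP; rewrite !mulf_eq0 (negPf dz) (negPf (neq0Ci _)) orbF /=.
  by move/eqP.
have gE : {ae mu, forall x : TR, g x = - 'i * z * prim g x}.
  have {}kE : g = - 'i * z *: f.
    move: kE; rewrite c0 scale0r addr0 => /(congr1 ( *:%R (- 'i))).
    have i1 : - 'i * 'i = 1 :> C by rewrite mulNr -expr2 sqrCi opprK.
    by rewrite !scalerA i1 scale1r => ->.
  have := L2Z (- 'i * z) f; rewrite -kE; move: fE; apply: filterS2 => x fx ->.
  by rewrite fx c0 add0r.
have p0 x : 0 <= x -> x <= 2 * pi -> prim g x = 0.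
  move=> x0 x2; have := prim_mul_ce 0 z gs x0 x2; set r := (fun t : TR => _).
  have rs : r \in sq.
    have := sqD (sq_mul_ce z gs) (sqZ ('i * z) (sq_mul_ce z (sq_prim gs))).
    by congr (_ \in sq); apply/funext => t; rewrite /r; ring.
  have -> : prim r x = 0.
    rewrite (ae_eq_prim x rs (sqZ 0 rs)) ?primZ ?mul0r //.
    by apply: filterS gE => t gt; rewrite /r gt; ring.
  by rewrite !add0r => /eqP; rewrite mulf_eq0 (negPf (ce_neq0 _ _)) => /eqP.
apply: L2_eq; apply: filterS3 fE (L2_0 R) (mu_ae_D R) => x -> -> /D_itv [x0 x2].
by rewrite c0 add0r p0 ?ltW.
Qed.

End ResolventBound.

Section ResolventOperator.
Variable R : realType.
Local Notation C := R[i].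
Local Notation leb := (@lebesgue_measure R).
Local Notation mu := (mu02pi R).
Local Notation TR := (measurableTypeR R).
Local Notation D := (`]0, 2 * (pi : R)[ : set R).
Local Notation sq := (sqint mu).
Local Notation cmeas := (@cmeasurable _ TR R).
Implicit Types w c : C.
Local Notation dot := (dot02pi R).
Local Notation nrm := (nrm dot).
Variable K : L2pi R.
Local Notation disc := (char_fun K).

(* If it vanished at all integers, all Fourier coefficients of K would be 0, and
   then its value at 1/2 is -2. *)
Lemma char_fun_neq0 : exists z, disc z != 0.
Proof.
apply: contrapT => h; have d0 w : disc w = 0.
  by apply/eqP; apply: contrapT => /negP hw; apply: h; exists w.
have K0 : K = 0.
  apply: fourier_total => n; have := d0 n%:~R.
  rewrite /char_fun ce_int_2pi subrr sub0r => /eqP.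
  by rewrite oppr_eq0 mulf_eq0 (negPf (neq0Ci _)) => /eqP.
have := d0 (2^-1)%:C%C; rewrite /char_fun K0 cint_ce_0 mulr0 subr0 => /eqP.
rewrite subr_eq0 => /eqP h1.
have : Re (ce (2^-1)%:C%C (2 * pi) : C) = 1 by rewrite h1.
rewrite ceE /= oppr0 mul0r expR0 mul1r mulKf // cospi => h2.
by have : (0 : R) < 1 := ltr01; rewrite -h2 oppr_gt0 ltr10.
Qed.

(** The last clause says that [gvec w] is an eigenvector of the adjoint; it is [P1_char_fun] at a
    zero w, applied to f = A x and k = x + z A x. *)
Lemma P1_resolvent z : disc z != 0 -> exists A : {linear L2pi R -> L2pi R},
  [/\ bnd dot A, forall x, A x = 0 -> x = 0,
     forall f k, P1 K f k <-> f = A (k - z *: f) &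
     forall w x, disc w = 0 -> dot (A x) (gvec w) = (w - z)^-1 * dot x (gvec w)].
Proof.
move=> dz; have [M M0 hM] := P1_resolvent_ex dz.
have /choice [T hT] : forall h : L2pi R, exists f : L2pi R,
    P1 K f (h + z *: f) /\ nrm f <= M * nrm h.
  by move=> h; have [f] := hM h; exists f.
have uniq f f' h : P1 K f (h + z *: f) -> P1 K f' (h + z *: f') -> f = f'.
  move=> p1 p2; apply/eqP; rewrite -subr_eq0 -scaleN1r addrC; apply/eqP.
  apply: (P1_unique dz); have := P1_linear (-1) p2 p1; congr P1.
  by rewrite !scaleN1r opprD addrACA addNr add0r scalerDr scalerN.
have [|A AE] := @to_linear _ _ T.
  move=> a x y; apply: (uniq _ _ _ (hT _).1).
  have := P1_linear a (hT x).1 (hT y).1; congr P1.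
  by rewrite scalerDr addrACA scalerDr !scalerA [z * a]mulrC.
have hA f k : P1 K f k <-> f = A (k - z *: f).
  split=> [p|fE].
    apply: (uniq _ _ (k - z *: f)); first by rewrite subrK.
    by rewrite AE; exact: (hT _).1.
  by have := (hT (k - z *: f)).1; rewrite -AE -fE subrK.
exists A; split => //.
- by exists M => // x; rewrite AE; exact: (hT x).2.
- move=> x Ax; apply: (@P1_inj _ K); have := (hT x).1.
  by rewrite -AE Ax scaler0 addr0.
move=> w x dw; have wz : w - z != 0.
  by apply: contra dz; rewrite subr_eq0 => /eqP <-; rewrite dw.
apply: (mulfI wz); rewrite mulVKf //.
have /P1P [c [g [fE g0 kE]]] := (hT x).1.
have := P1_char_fun w fE g0 kE; rewrite dw mulr0 [x + _]addrC cint_ce_linear -AE => h.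
rewrite !dot_gvecE mulrCA; congr (_ * _).
by apply/eqP; rewrite -subr_eq0 mulrBl -addrA -opprD -opprB oppr_eq0 -h.
Qed.

End ResolventOperator.

(** * The eigenvalues near the integers *)

Section Eigenvalues.
Variable R : realType.
Local Notation C := R[i].
Local Notation leb := (@lebesgue_measure R).
Local Notation mu := (mu02pi R).
Local Notation TR := (measurableTypeR R).
Local Notation D := (`]0, 2 * (pi : R)[ : set R).
Local Notation sq := (sqint mu).
Local Notation cmeas := (@cmeasurable _ TR R).
Implicit Types w c : C.
Local Notation dot := (dot02pi R).
Local Notation nrm := (nrm dot).

Lemma normc_cint_le (p : TR -> C) (B : R) : 0 <= B -> cmeas p ->
  (forall x, D x -> normc (p x) <= B) -> normc (cint p) <= B * (2 * pi).
Proof.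
move=> B0 mp pB; have ps := sq_bounded mp pB; have s1 := @sq_cst R 1.
have -> : cint p = cint (fun t => cls s1 t * p t).
  apply: ae_eq_cint => //; first exact: (sq_mulb (L2_sqint _) mp pB).
  by apply: filterS (clsE s1) => t ->; rewrite mul1r.
apply: le_trans (normc_cint_mul _ B0 mp pB) _.
have h : nrm (cls s1) <= 1 * Num.sqrt (2 * pi).
  have m1 : cmeas (fun=> 1) by split; exact: measurable_cst.
  by apply: (nrm_bounded ler01 m1) (clsE s1) => x _; rewrite normc1.
have e2 : 2 * pi = Num.sqrt (2 * pi) * Num.sqrt (2 * pi) :> R.
  by rewrite -expr2 sqr_sqrtr // ltW // pi2_gt0.
rewrite [in leRHS]e2 mulrCA ler_wpM2l //; rewrite mul1r in h.
by rewrite ler_wpM2r // sqrtr_ge0.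
Qed.

Lemma normc_prim_bounded (p : TR -> C) (B : R) x : 0 <= B -> cmeas p ->
  (forall x, D x -> normc (p x) <= B) -> normc (prim p x) <= B * (2 * pi).
Proof.
move=> B0 mp pB; apply: normc_cint_le => //; first exact: cmeasurableM mp (cmeas_chi _ _).
by move=> t Dt; rewrite normcM -[leRHS]mulr1 ler_pM ?normc_ge0 ?pB ?normc_chi.
Qed.

Lemma ge_Im (z : C) : `|Im z| <= normc z.
Proof. by rewrite Im_ReNi; apply: le_trans (ge_Re _) _; rewrite normcM normcN normc_i mul1r. Qed.

Let E : R := expR (2 * pi).

Lemma normc_ce_le1 w x : normc w <= 1 -> 0 <= x -> x <= 2 * pi -> normc (ce w x) <= E.
Proof.
move=> w1 x0 x2; rewrite normc_ce ler_expR; have := ge_Im w.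
rewrite ler_norml => /andP[h1 _]; have := pi2_gt0 R; nra.
Qed.

Lemma normc_ce_int (n : int) t : normc (ce n%:~R t : C) = 1.
Proof.
have h : (normc (ce n%:~R t : C) ^+ 2)%:C%C = 1 :> C.
  by rewrite sqr_normcE ceJ rmorph_int mulrC ceN.
have /eqP : normc (ce n%:~R t : C) ^+ 2 = 1 := congr1 (@complex.Re R) h; rewrite sqrf_eq1 => /orP[/eqP //|/eqP h2].
by have : (0 : R) <= -1 by [rewrite -h2 normc_ge0]; rewrite ler0N1.
Qed.

Lemma normc_ce_sub1 w x : normc w <= 1 -> 0 <= x -> x <= 2 * pi ->
  normc (ce w x - 1) <= normc w * E * (2 * pi).
Proof.
move=> w1 x0 x2; rewrite -prim_ce //; apply: normc_prim_bounded.
- by rewrite mulr_ge0 ?normc_ge0 ?expR_ge0.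
- by have := sqint_cmeasurable (sqZ ('i * w) (sq_ce w)).
move=> t /D_itv [t0 t2]; rewrite normcM normcM normc_i mul1r ler_wpM2l ?normc_ge0 //.
by apply: normc_ce_le1 => //; exact: ltW.
Qed.

(** A second order Taylor bound by integration: the remainder has derivative i w (exp(i w t) - 1),
    estimated by [normc_ce_sub1]. *)
Lemma normc_ce_sub1_lin w x : normc w <= 1 -> 0 <= x -> x <= 2 * pi ->
  normc (ce w x - 1 - 'i * w * x%:C%C) <= normc w ^+ 2 * (E * (2 * pi) ^+ 2).
Proof.
move=> w1 x0 x2; have s1 := sq_ce w; have s2 := @sq_cst R (-1).
have -> : ce w x - 1 - 'i * w * x%:C%C = prim (fun t => 'i * w * (ce w t + (-1))) x.
  have px : prim (fun=> -1) x = - x%:C%C :> C.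
    have := cint_chi1 (lexx 0) x0 x2; rewrite subr0 => <-.
    by rewrite -[RHS]mulN1r -(cintZ (-1) (sq_chi 0 x)).
  rewrite primZ ?sqD // primD // px -prim_ce // primZ //; ring.
have := @normc_prim_bounded (fun t => 'i * w * (ce w t + (-1))) (normc w * (normc w * E * (2 * pi))) x.
have -> : normc w * (normc w * E * (2 * pi)) * (2 * pi) = normc w ^+ 2 * (E * (2 * pi) ^+ 2) by ring.
apply.
- by rewrite !mulr_ge0 ?normc_ge0 ?expR_ge0 // ltW // pi_gt0.
- by have := sqint_cmeasurable (sqZ ('i * w) (sqD s1 s2)).
move=> t /D_itv [t0 t2]; rewrite normcM normcM normc_i mul1r ler_wpM2l ?normc_ge0 //.
by apply: normc_ce_sub1 => //; exact: ltW.
Qed.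

(** After removal of the linear part, the exponential is Lipschitz on the disc of radius r with
    constant of order r; this smallness makes the Newton map below contract. *)
Lemma normc_ce_lip : exists2 A : R, 0 <= A &
  forall w w' (r : R) x, r <= 2^-1 -> normc w <= r -> normc w' <= r ->
  0 <= x -> x <= 2 * pi ->
  normc (ce w x - ce w' x - 'i * (w - w') * x%:C%C) <= A * r * normc (w - w').
Proof.
exists (3 * E ^+ 2 * (2 * pi) ^+ 2); first by rewrite mulr_ge0 ?sqr_ge0 // mulr_ge0 ?sqr_ge0.
move=> w w' r x r2 wr w'r x0 x2; pose d := w - w'.
have E1 : 1 <= E by rewrite /E -[leLHS]expR0 ler_expR; exact: ltW (pi2_gt0 R).
have dr : normc d <= 2 * r by apply: le_trans (normcB _ _) _; lra.
have d1 : normc d <= 1 by lra.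
have w'1 : normc w' <= 1 by lra.
have -> : ce w x - ce w' x - 'i * (w - w') * x%:C%C =
   ce w' x * (ce d x - 1 - 'i * d * x%:C%C) + (ce w' x - 1) * ('i * d * x%:C%C).
  have -> : ce w x = ce w' x * ce d x by rewrite -ceD addrC subrK.
  by rewrite -/d; ring.
apply: le_trans (normcD _ _) _; rewrite !normcM normc_i mul1r normc_real (ger0_norm x0).
have h1 := normc_ce_le1 w'1 x0 x2; have h2 := normc_ce_sub1_lin d1 x0 x2.
have h3 := normc_ce_sub1 w'1 x0 x2.
have p2 := pi2_gt0 R; have d0 := normc_ge0 d.
have r0 : 0 <= r := le_trans (normc_ge0 _) wr.
have t1 : normc (ce w' x) * normc (ce d x - 1 - 'i * d * x%:C%C) <=
   E * (normc d ^+ 2 * (E * (2 * pi) ^+ 2)).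
  by rewrite ler_pM ?normc_ge0.
have t2 : normc (ce w' x - 1) * (normc d * x) <= (normc w' * E * (2 * pi)) * (normc d * (2 * pi)).
  by rewrite ler_pM ?normc_ge0 ?mulr_ge0 ?ler_wpM2l.
apply: le_trans (lerD t1 t2) _.
have p4 : 0 <= (2 * (pi : R)) ^+ 2 := sqr_ge0 _.
have EE : E <= E ^+ 2 by rewrite ler_eXnr.
have u1 : normc d ^+ 2 <= 2 * r * normc d by rewrite expr2 ler_wpM2r.
have u2 : normc w' * E <= r * E ^+ 2 by rewrite ler_pM ?normc_ge0 // /E expR_ge0.
have -> : E * (normc d ^+ 2 * (E * (2 * pi) ^+ 2)) = normc d ^+ 2 * (E ^+ 2 * (2 * pi) ^+ 2) by ring.
have -> : normc w' * E * (2 * pi) * (normc d * (2 * pi)) = normc w' * E * (normc d * (2 * pi) ^+ 2) by ring.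
have -> : 3 * E ^+ 2 * (2 * pi) ^+ 2 * r * normc (w - w') =
  2 * r * normc d * (E ^+ 2 * (2 * pi) ^+ 2) + r * E ^+ 2 * (normc d * (2 * pi) ^+ 2) by rewrite -/d; ring.
by apply: lerD; rewrite ler_wpM2r // mulr_ge0 ?sqr_ge0.
Qed.

Lemma sq_mul_id (f : TR -> C) : f \in sq -> (fun t : TR => f t * t%:C%C) \in sq.
Proof.
move=> fs; apply: (sq_mulb (B := 2 * pi) fs) => [|t /D_itv [t0 t2]].
  by split; [exact: measurable_id | exact: measurable_cst].
by rewrite normc_real ger0_norm ltW.
Qed.

Lemma dot02pi_hcomplete : hcomplete dot.
Proof. exact: L2_hcomplete. Qed.

(** Simplified Newton iteration for Delta at n, with the constant slope 2 pi i. The two hypotheses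
    bound the deviation of Delta'(n) from that slope and the value Delta(n); the radius r does not
    depend on n. *)
Lemma eigenvalue_near_int (K : L2pi R) : exists r : R, [/\ 0 < r, r <= 4^-1 &
  forall n : int, normc (cint (fun t => K t * t%:C%C * ce n%:~R t)) <= 1 ->
    normc (cint (fun t => K t * ce n%:~R t)) <= r / 2 ->
  exists e, [/\ normc e <= r, char_fun K (n%:~R + e) = 0 &
    normc e <= 2 * normc (cint (fun t => K t * ce n%:~R t))]].
Proof.
have [A A0 hA] := normc_ce_lip.
pose s : R := Num.sqrt (2 * pi).
have s0 : 0 <= s := sqrtr_ge0 _.
have B0 : 0 <= A * (1 + nrm K * s) by rewrite mulr_ge0 // addr_ge0 // mulr_ge0 // nrm_ge0.
(* The bound 1/4 will keep zeros attached to distinct integers apart; the other term keeps the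
   nonlinear part A r (1 + |K| s) of the estimate below 1. *)
pose r := Num.min 4^-1 (1 / (A * (1 + nrm K * s) + 1)).
have r0 : 0 < r by rewrite lt_min invr_gt0 ltr0n divr_gt0 // ltr_wpDl.
have r4 : r <= 4^-1 by rewrite ge_min lexx.
have rB : r * (A * (1 + nrm K * s)) <= 1.
  have h : r <= 1 / (A * (1 + nrm K * s) + 1) by rewrite ge_min lexx orbT.
  rewrite ler_pdivlMr ?ltr_wpDl // in h; apply: le_trans h.
  by rewrite [leRHS]mulrDr mulr1 lerDl ltW.
exists r; split => // n t1 k1.
have p2 := pi2_gt0 R; have Ks := L2_sqint K.
have p0 : 2 * (pi : R)%:C%C != 0 :> C.
  by rewrite mulf_neq0 ?pnatr_eq0 // -normc_eq0 normc_real normr_eq0 gt_eqF ?pi_gt0.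
pose c : C := 2 * pi%:C%C * 'i.
have c0 : c != 0 by rewrite mulf_neq0 // neq0Ci.
have cN : normc c = 2 * pi.
  rewrite /c !normcM normc_i mulr1 normc_real ger0_norm ?pi_ge0 //.
  by have -> : 2 = 2%:C%C :> C by [rewrite rmorph_nat]; rewrite normc_real ger0_norm.
pose k := cint (fun t => K t * ce n%:~R t).
pose T e := e - char_fun K (n%:~R + e) / c.
have T0 : normc (T 0) <= normc k.
  rewrite /T addr0 /char_fun ce_int_2pi subrr !sub0r mulNr opprK normcM normcM normc_i mul1r normcV cN.
  rewrite ler_pdivrMr // -[leLHS]mulr1 ler_wpM2l ?normc_ge0 //.
  by have := pi_ge2 R; lra.
have [|e e' er e'r|e [er Te e2]] := @complex_fixpoint _ _ dot dot02pi_hcomplete (gvec 0) _ T r (le_trans T0 k1).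
- exact: (fourier_orthonormal R 0 0).
- pose d := e - e'.
  pose rem (t : TR) := ce e t - ce e' t - 'i * d * t%:C%C.
  have mrem : cmeas rem.
    apply: cmeasurableB; first exact: cmeasurableB (cmeas_ce _) (cmeas_ce _).
    apply: cmeasurableM; first exact: cmeasurable_cst.
    by split; [exact: measurable_id | exact: measurable_cst].
  have remB t : D t -> normc (ce n%:~R t * rem t) <= A * r * normc d.
    move=> /D_itv [t0 t2]; rewrite normcM normc_ce_int mul1r.
    by apply: hA => //; [lra | exact: ltW | exact: ltW].
  have Ar0 : 0 <= A * r * normc d by rewrite !mulr_ge0 ?normc_ge0 // ltW.
  have mrem2 : cmeas (fun t => ce n%:~R t * rem t) by exact: cmeasurableM (cmeas_ce _) mrem.
  pose J := cint (fun t => K t * t%:C%C * ce n%:~R t).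
  pose L := cint (fun t => K t * (ce n%:~R t * rem t)).
  have LB : normc L <= nrm K * (A * r * normc d * s) by exact: normc_cint_mul.
  have q1 := sq_mul_ce n%:~R (sq_mul_id Ks).
  have q2 := sq_mulb Ks mrem2 remB.
  have dd : char_fun K (n%:~R + e) - char_fun K (n%:~R + e') =
     (rem (2 * pi) + 'i * d * (2 * pi)%:C%C) - 'i * ('i * d * J + L).
    have -> : 'i * d * J + L = cint (fun t => K t * ce (n%:~R + e) t - K t * ce (n%:~R + e') t).
      rewrite -(cintZ _ q1) -(cintD (sqZ _ q1) q2); apply: eq_cint => t.
      rewrite !ceD /rem; ring.
    rewrite (cintB (sq_mul_ce _ Ks) (sq_mul_ce _ Ks)) /char_fun !ceD !ce_int_2pi /rem; ring.
  have -> : T e - T e' = - (rem (2 * pi) + d * J - 'i * L) / c.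
    have -> : T e - T e' = d - (char_fun K (n%:~R + e) - char_fun K (n%:~R + e')) / c.
      by rewrite /T /d; ring.
    rewrite dd rcM.
    have -> : rem (2 * pi) + 'i * d * ((2 : R)%:C%C * pi%:C%C) - 'i * ('i * d * J + L) =
      d * c + (rem (2 * pi) + d * J - 'i * L).
      have -> : (2 : R)%:C%C = 2 :> C by rewrite rmorph_nat.
      have -> : 'i * ('i * d * J + L) = 'i ^+ 2 * (d * J) + 'i * L by ring.
      rewrite sqrCi /c; ring.
    by rewrite [_ / c]mulrDl mulfK // opprD addrA subrr sub0r mulNr.
  rewrite normcM normcN normcV cN ler_pdivrMr //.
  have remN : normc (rem (2 * pi)) <= A * r * normc d.
    by apply: hA => //; [lra | exact: ltW].
  have N1 : normc (rem (2 * pi) + d * J - 'i * L) <=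
     A * r * normc d + normc d + nrm K * (A * r * normc d * s).
    apply: le_trans (normcB _ _) _; rewrite [normc ('i * _)]normcM normc_i mul1r lerD //.
    apply: le_trans (normcD _ _) _; rewrite lerD // normcM -[leRHS]mulr1 ler_wpM2l ?normc_ge0 //.
  apply: le_trans N1 _.
  have -> : A * r * normc d + normc d + nrm K * (A * r * normc d * s) =
     (r * (A * (1 + nrm K * s)) + 1) * normc d by ring.
  (* Contraction by 1/2 amounts to r A (1 + |K| s) + 1 <= pi, and the left side is at most 2. *)
  have -> : 2^-1 * normc d * (2 * pi) = pi * normc d by field.
  rewrite ler_wpM2r ?normc_ge0 //; have := pi_ge2 R; lra.
exists e; split => //.
- move/eqP: Te; rewrite /T -subr_eq0 addrAC subrr sub0r oppr_eq0 mulf_eq0 invr_eq0 (negPf c0) orbF.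
  by move/eqP.
- by apply: le_trans e2 _; rewrite ler_wpM2l.
Qed.

End Eigenvalues.

(** * Distance of the shifted exponentials from the Fourier basis *)

Section FourierTail.
Variable R : realType.
Local Notation C := R[i].
Local Notation leb := (@lebesgue_measure R).
Local Notation mu := (mu02pi R).
Local Notation TR := (measurableTypeR R).
Local Notation D := (`]0, 2 * (pi : R)[ : set R).
Local Notation sq := (sqint mu).
Local Notation cmeas := (@cmeasurable _ TR R).
Implicit Types w c : C.
Local Notation dot := (dot02pi R).
Local Notation nrm := (nrm dot).
Local Notation s := (Num.sqrt (2 * (pi : R))).

Lemma sqrt_2pi_gt0 : 0 < s. Proof. by rewrite sqrtr_gt0 pi2_gt0. Qed.

Lemma normc_kap : normc (kap R) = s^-1.
Proof. by rewrite normc_real ger0_norm // invr_ge0 sqrtr_ge0. Qed.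

Lemma normc_fourier (f : L2pi R) (p : TR -> C) (n : int) : p \in sq ->
  {ae mu, forall x, f x = p x} ->
  normc (cint (fun t => p t * ce n%:~R t)) = s * normc (dot f (gvec n%:~R)).
Proof.
move=> ps fp; rewrite (dot_gvec _ ps fp) normcM normc_kap mulrA divff ?mul1r //.
by rewrite gt_eqF // sqrt_2pi_gt0.
Qed.

(** The common factor exp(-i n t) has modulus one, so the bound is uniform in n. *)
Lemma nrm_gvec_sub (n : int) e : normc e <= 1 ->
  nrm (gvec (n%:~R + e) - gvec n%:~R) <= normc e * (expR (2 * pi) * (2 * pi)).
Proof.
move=> e1; set Q := _ * _; pose p (t : TR) := kap R * ce (- n%:~R) t * (ce (- e^*) t - 1).
have mp : cmeas p.
  apply: cmeasurableM; first exact: sqint_cmeasurable (sqZ (kap R) (sq_ce _)).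
  exact: sqint_cmeasurable (sqB (sq_ce _) (sq_cst 1)).
have pB t : D t -> normc (p t) <= s^-1 * Q.
  move=> /D_itv [t0 t2]; rewrite /p !normcM normc_kap.
  rewrite -mulrNz normc_ce_int mulr1.
  rewrite ler_wpM2l ?invr_ge0 ?sqrtr_ge0 // /Q.
  have <- : normc (- e^*) = normc e by rewrite normcN normcJ.
  by rewrite [leRHS]mulrA; apply: normc_ce_sub1; rewrite ?normcN ?normcJ //; exact: ltW.
have Q0 : 0 <= Q by rewrite mulr_ge0 ?normc_ge0 // mulr_ge0 ?expR_ge0 // ltW // pi2_gt0.
have fp : {ae mu, forall x : TR, (gvec (n%:~R + e) - gvec n%:~R : L2pi R) x = p x}.
  apply: filterS3 (L2B (gvec (n%:~R + e)) (gvec n%:~R)) (clsE (sq_gvec (n%:~R + e)))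
    (clsE (sq_gvec n%:~R)) => x -> -> ->.
  by rewrite /p rmorphD /= !rmorph_int opprD ceD; ring.
apply: le_trans (nrm_bounded _ mp pB fp) _; first by rewrite mulr_ge0 ?invr_ge0 ?sqrtr_ge0.
by rewrite mulrC mulrA divff ?mul1r // gt_eqF // sqrt_2pi_gt0.
Qed.

Lemma int_tail (B : R) : exists t : seq int, forall n, n \notin t -> B <= normc (n%:~R : C).
Proof.
pose N := Num.truncn B.
exists ([seq i%:Z | i <- iota 0 N.+1] ++ [seq - i%:Z | i <- iota 0 N.+1]) => n nt.
have Nn : (N < `|n|)%N.
  rewrite ltnNge; apply: contra nt => nN; rewrite mem_cat.
  have i0 : `|n|%N \in iota 0 N.+1 by rewrite mem_iota /= add0n ltnS.
  have [n0|n0] := leP 0 n; apply/orP; [left|right]; apply/mapP; exists `|n|%N => //.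
    by rewrite gez0_abs.
  by rewrite ltz0_abs ?opprK.
have -> : n%:~R = (n%:~R : R)%:C%C :> C by rewrite rmorph_int.
rewrite normc_real -intr_norm -abszE; apply: le_trans (_ : N.+1%:R <= _).
  by rewrite ltW // truncnS_gt.
by rewrite -pmulrn ler_nat.
Qed.

End FourierTail.

(** * Choice of the finite exceptional set and conclusion *)

Theorem theorem3p19 (R : realType) (K : L2pi R) :
  root_vectors_form_riesz_basis (dot02pi R) (P1 K) /\
  root_vectors_form_riesz_basis (dot02pi R) (adjoint (dot02pi R) (P1 K)).
Proof.
pose dot := dot02pi R; pose e (n : int) := gvec n%:~R : L2pi R.
have eo : orthonormal_family dot e := @fourier_orthonormal R.
have et := @fourier_basis R.
have [r [r0 r4 hr]] := eigenvalue_near_int K.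
have Ks := L2_sqint K.
have K1s := sq_mul_id Ks.
have b0 := pi2_gt0 R.
have sE : Num.sqrt (2 * (pi : R)) ^+ 2 = 2 * pi by rewrite sqr_sqrtr // ltW.
pose Q : R := expR (2 * pi) * (2 * pi).
have Q0 : 0 <= Q by rewrite mulr_ge0 ?expR_ge0 // ltW.
(* Up to normalization, [c] governs Delta(n) and [c1], built from t K(t), governs Delta'(n) - 2 pi
   i. *)
pose c n := dot K (e n); pose c1 n := dot (cls K1s) (e n).
have cE n : normc (cint (fun t => K t * ce n%:~R t)) ^+ 2 = 2 * pi * normc (c n) ^+ 2.
  by rewrite (normc_fourier n Ks (aeW _ (fun x => erefl))) exprMn sE.
have c1E n : normc (cint (fun t => K t * t%:C%C * ce n%:~R t)) ^+ 2 = 2 * pi * normc (c1 n) ^+ 2.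
  by rewrite (normc_fourier n K1s (clsE K1s)) exprMn sE.
have sc : sqsum c by exists (nrm2 dot K) => t; exact: bessel.
have sc1 : sqsum c1 by exists (nrm2 dot (cls K1s)) => t; exact: bessel.
(* The first term ensures that the Fourier integrals of K are at most r / 2, the second that the
   squared distances of the g_n from the e_n sum to at most 1/4. *)
pose d := Num.min ((r / 2) ^+ 2 / (2 * pi)) (4^-1 / (Q ^+ 2 * (4 * (2 * pi)) + 1)).
have q0 : 0 <= Q ^+ 2 * (4 * (2 * pi)) by rewrite mulr_ge0 ?sqr_ge0 // mulr_ge0 // ltW.
have d0 : 0 < d.
  rewrite lt_min; apply/andP; split; apply: divr_gt0 => //.
  - by rewrite exprn_gt0 // divr_gt0.
  - by rewrite ltr_wpDl.
have [t0 ht0] := sqsum_tail sc d0.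
have [|t1 ht1] := sqsum_tail sc1 (_ : 0 < (2 * pi)^-1); first by rewrite invr_gt0.
pose s0 := t0 ++ t1.
have single (I : eqType) (f : I -> R[i]) (t : seq I) (B : R) i :
    (forall u, uniq u -> (forall j, j \in u -> j \notin t) -> psum f u <= B) ->
    i \notin t -> normc (f i) ^+ 2 <= B.
  move=> h it; have := h [:: i] isT; rewrite /psum big_seq1; apply.
  by move=> j; rewrite inE => /eqP ->.
(* On the exceptional set the shift is 0 by default, so that the bound 1/4 holds for every n. *)
have /choice [eps heps] : forall n : int, exists x : R[i], normc x <= 4^-1 /\
    (n \notin s0 -> char_fun K (n%:~R + x) = 0 /\
       normc x <= 2 * normc (cint (fun t => K t * ce n%:~R t))).
  move=> n; have [ns|ns] := boolP (n \in s0).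
    by exists 0; rewrite normc0 invr_ge0 ler0n.
  move: ns; rewrite mem_cat negb_or => /andP[n0 n1].
  have [||x [xr dx x2]] := hr n.
  - rewrite -(@ler_pXn2r _ 2) ?nnegrE ?normc_ge0 // c1E expr1n.
    by rewrite mulrC -ler_pdivlMr // div1r; exact: single ht1 n1.
  - rewrite -(@ler_pXn2r _ 2) ?nnegrE ?normc_ge0 ?divr_ge0 ?(ltW r0) // cE.
    rewrite mulrC -ler_pdivlMr //; apply: le_trans (single _ _ _ _ _ ht0 n0) _.
    by rewrite ge_min lexx.
  by exists x; split => //; exact: le_trans r4.
pose lam n := n%:~R + eps n.
have [z dz] := char_fun_neq0 K.
have [A [bA iA hA Ag]] := P1_resolvent dz.
have e41 n : normc (eps n) <= 1 by apply: le_trans (heps n).1 _; rewrite invf_le1 ?ler1n.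
have lamz n : n \notin s0 -> lam n - z != 0.
  move=> /(heps n).2 [dl _]; apply: contra dz; rewrite subr_eq0 => /eqP <-.
  by rewrite dl.
apply: (@perturbed_root_riesz_basis _ _ dot _ 0 e eo et (@dot02pi_hcomplete R) _ A z s0
  (fun n => gvec (lam n)) (fun n => (lam n - z)^-1)) => //.
- by move=> x n ns; rewrite Ag // ((heps n).2 ns).1.
(* Each squared distance is at most Q^2 |eps_n|^2 with |eps_n|^2 <= 4 (2 pi) |c_n|^2. *)
- move=> u uu us; apply: (@le_trans _ _ (Q ^+ 2 * (4 * (2 * pi)) * psum c u)).
    rewrite /psum mulr_sumr big_seq [leRHS]big_seq; apply: ler_sum => n /us ns.
    rewrite -sqr_nrm; have := nrm_gvec_sub n (e41 n); rewrite -/Q => h1.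
    have [_ h2] := (heps n).2 ns.
    apply: (@le_trans _ _ ((normc (eps n) * Q) ^+ 2)).
      by rewrite ler_pXn2r ?nnegrE ?nrm_ge0 ?mulr_ge0 ?normc_ge0 ?pi_ge0 //.
    have h3 : normc (eps n) ^+ 2 <= 4 * normc (cint (fun t => K t * ce n%:~R t)) ^+ 2.
      have -> : 4 = 2 ^+ 2 :> R by ring.
      by rewrite -exprMn ler_pXn2r ?nnegrE ?normc_ge0 ?mulr_ge0 ?normc_ge0.
    rewrite exprMn mulrC -mulrA ler_wpM2l ?sqr_ge0 //.
    by apply: le_trans h3 _; rewrite cE; lra.
  have h : psum c u <= d.
    by apply: ht0 => // n /us; rewrite mem_cat negb_or => /andP[].
  have h2 : d <= 4^-1 / (Q ^+ 2 * (4 * (2 * pi)) + 1) by rewrite ge_min lexx orbT.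
  rewrite ler_pdivlMr ?ltr_wpDl // in h2.
  apply: le_trans (ler_wpM2l q0 h) _; apply: le_trans h2.
  by rewrite mulrC [leRHS]mulrDr mulr1 lerDl ltW.
- move=> del del0; have [t ht] := @int_tail R (del^-1 + 1 + normc z).
  exists t => n /ht h.
  have h1 : del^-1 <= normc (lam n - z).
    have hn : normc (n%:~R : R[i]) <= normc (lam n - z) + normc (eps n) + normc z.
      have -> : n%:~R = (lam n - z) - eps n + z by rewrite /lam; ring.
      by apply: le_trans (normcD _ _) _; rewrite lerD2r normcB.
    have := e41 n; lra.
  rewrite normcV -[del]invrK lef_pV2 // ?posrE ?invr_gt0 //.
  by apply: lt_le_trans h1; rewrite invr_gt0.
(* Equal entries give i - j = eps_j - eps_i, of modulus at most 1/2, which forces the integer i - j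
   to be 0. *)
move=> i j si sj /(congr1 (fun x => x^-1)); rewrite !invrK => /(addIr _) lij.
apply/eqP; rewrite -subr_eq0 -absz_eq0 -leqn0 -ltnS.
have h : normc ((i - j)%:~R : R[i]) <= 2^-1.
  have -> : (i - j)%:~R = eps j - eps i.
    by apply/eqP; rewrite intrB -subr_eq0; move/eqP: lij; rewrite -subr_eq0 /lam; apply: contraTT; congr (_ != 0); ring.
  by apply: le_trans (normcB _ _) _; have := (heps i).1; have := (heps j).1; lra.
have e1 : (i - j)%:~R = ((i - j)%:~R : R)%:C%C :> R[i] by rewrite rmorph_int.
rewrite e1 normc_real -intr_norm -abszE -pmulrn in h.
by rewrite -(@ltr_nat R); lra.
Qed.
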